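(* Let $\mu$ be a finite positive Borel measure on $[0,1)$. Then the following conditions are equivalent. (i) The operator $I_\mu$ is bounded from $Q_s$ into itself for some $s>0$. (ii) The operator $I_\mu$ is bounded from $Q_s$ into itself for all $s>0$. (iii) The operator $\mathcal{H}_\mu$ is bounded from $Q_s$ into itself for some $s>0$. (iv) The operator $\mathcal{H}_\mu$ is bounded from $Q_s$ into itself for all $s>0$. (v) The measure $\mu$ is a $1$-logarithmic $1$-Carleson measure.
   Context: $\mathbb{D}$ is the open unit disc in $\mathbb{C}$. For a finite positive Borel measure $\mu$ on $[0,1)$ and $n=0,1,2,\dots$, let $\mu_n=\int_{[0,1)}t^n\,d\mu(t)$. For $f(z)=\sum_{k=0}^\infty a_kz^k$ analytic in $\mathbb{D}$, define $$\mathcal{H}_\mu(f)(z)=\sum_{n=0}^\infty\left(\sum_{k=0}^\infty \mu_{n+k}a_k\right)z^n,\qquad I_\mu(f)(z)=\int_{[0,1)}\frac{f(t)}{1-tz}\,d\mu(t),$$ each whenever the right hand side makes sense (the inner series converge for all $n$, respectively the integral converges for all $z\in\mathbb{D}$) and defines an analytic function in $\mathbb{D}$. Saying that one of these operators is bounded from $X$ into itself includes that it is well defined on every $f\in X$. For $s>0$, $Q_s$ is the space of all $f$ analytic in $\mathbb{D}$ with $$\rho_{Q_s}(f)=\left(\sup_{a\in\mathbb{D}}\int_{\mathbb{D}}|f'(z)|^2g(z,a)^s\,dA(z)\right)^{1/2}<\infty,$$ where $g(z,a)=\log\left|\frac{1-\overline{a}z}{z-a}\right|$ and $dA(z)=\frac{dx\,dy}{\pi}$;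 it is normed by $|f(0)|+\rho_{Q_s}(f)$. For $\alpha\ge 0$ and $s>0$, a positive Borel measure $\mu$ on $[0,1)$ is an $\alpha$-logarithmic $s$-Carleson measure if there is $C>0$ with $\mu([t,1))\left(\log\frac{1}{1-t}\right)^\alpha\le C(1-t)^s$ for all $0\le t<1$. *)

(* Defs.v *)
From HB Require Import structures.
From mathcomp Require Import all_boot all_order all_algebra.
From mathcomp Require Import all_classical all_reals all_analysis.
From mathcomp Require Import complex.

Set Implicit Arguments.
Unset Strict Implicit.
Unset Printing Implicit Defensive.

Import Order.TTheory GRing.Theory Num.Theory.
Import numFieldNormedType.Exports.

Local Open Scope classical_set_scope.
Local Open Scope ring_scope.

(* Typed as a numClosedFieldType because MathComp-Analysis puts the norm
   topology on numeric fields; the bare type R[i] carries no topology. *)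
Definition Cplx (R : realType) : numClosedFieldType := R[i]%C.

Definition ofR (R : realType) (x : R) : Cplx R := x%:C%C.

Definition cmod (R : realType) (z : Cplx R) : R := ComplexField.Normc.normc z.

Definition disc (R : realType) : set (Cplx R) := [set z | `|z| < 1].

(* Functions on the disc are total functions Cplx R -> Cplx R; every notion
   below only depends on their values on the open unit disc. *)
(* As in the usual convention for the disc: f is the sum, on all of the disc,
   of a power series centred at 0. *)
Definition analytic_on_disc (R : realType) (f : Cplx R -> Cplx R) : Prop :=
  exists a : nat -> Cplx R, forall z, disc z ->
    series (fun k => a k * z ^+ k) @ \oo --> f z.

Definition taylor (R : realType) (f : Cplx R -> Cplx R) (k : nat) : Cplx R :=
  derive1n k f 0 / (k`!)%:R.

(* At z = a, where g is infinite, this evaluates to 0; a point is negligible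
   in the area integral below. *)
Definition green (R : realType) (z a : Cplx R) : R :=
  ln (cmod ((1 - a^* * z) / (z - a))).

Definition of_xy (R : realType) (p : R * R) : Cplx R := (p.1 +i* p.2)%C.

Definition Qs_integral (R : realType) (s : R) (f : Cplx R -> Cplx R)
    (a : Cplx R) : \bar R :=
  ((pi^-1)%:E *
   \int[(@lebesgue_measure R \x @lebesgue_measure R)%E]_(p in
       [set p : measurableTypeR R * measurableTypeR R | disc (of_xy p)])
     (cmod (derive1 f (of_xy p)) ^+ 2 * (green (of_xy p) a `^ s))%:E)%E.

Definition Qs_sup (R : realType) (s : R) (f : Cplx R -> Cplx R) : \bar R :=
  ereal_sup [set Qs_integral s f a | a in @disc R].

Definition Qs (R : realType) (s : R) : set (Cplx R -> Cplx R) :=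
  [set f | analytic_on_disc f /\ (Qs_sup s f < +oo)%E].

Definition Qs_seminorm (R : realType) (s : R) (f : Cplx R -> Cplx R) : R :=
  Num.sqrt (fine (Qs_sup s f)).

Definition Qs_norm (R : realType) (s : R) (f : Cplx R -> Cplx R) : R :=
  cmod (f 0) + Qs_seminorm s f.

(* T is a partially defined operator with domain dom. *)
Definition bounded_on_Qs (R : realType) (s : R)
    (dom : set (Cplx R -> Cplx R))
    (T : (Cplx R -> Cplx R) -> Cplx R -> Cplx R) : Prop :=
  (forall f, Qs s f -> dom f /\ Qs s (T f)) /\
  exists M : R, forall f, Qs s f -> Qs_norm s (T f) <= M * Qs_norm s f.

Definition cintegrable (R : realType)
    (mu : {finite_measure set (measurableTypeR R) -> \bar R})
    (h : R -> Cplx R) : Prop :=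
  mu.-integrable `[0, 1[ (fun t => (complex.Re (h t))%:E) /\
  mu.-integrable `[0, 1[ (fun t => (complex.Im (h t))%:E).

Definition cintegral (R : realType)
    (mu : {finite_measure set (measurableTypeR R) -> \bar R})
    (h : R -> Cplx R) : Cplx R :=
  ((\int[mu]_(t in `[0, 1[) complex.Re (h t)) +i*
   (\int[mu]_(t in `[0, 1[) complex.Im (h t)))%C.

Definition I_integrand (R : realType) (f : Cplx R -> Cplx R) (z : Cplx R)
    (t : R) : Cplx R :=
  f (ofR t) / (1 - ofR t * z).

Definition I_dom (R : realType)
    (mu : {finite_measure set (measurableTypeR R) -> \bar R}) :
    set (Cplx R -> Cplx R) :=
  [set f | forall z, disc z -> cintegrable mu (I_integrand f z)].

Definition I_op (R : realType)
    (mu : {finite_measure set (measurableTypeR R) -> \bar R})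
    (f : Cplx R -> Cplx R) (z : Cplx R) : Cplx R :=
  cintegral mu (I_integrand f z).

Definition moment (R : realType)
    (mu : {finite_measure set (measurableTypeR R) -> \bar R}) (n : nat) : R :=
  \int[mu]_(t in `[0, 1[) (t ^+ n).

Definition H_coef_series (R : realType)
    (mu : {finite_measure set (measurableTypeR R) -> \bar R})
    (f : Cplx R -> Cplx R) (n : nat) : nat -> Cplx R :=
  series (fun k => ofR (moment mu (n + k)) * taylor f k).

Definition H_series (R : realType)
    (mu : {finite_measure set (measurableTypeR R) -> \bar R})
    (f : Cplx R -> Cplx R) (z : Cplx R) : nat -> Cplx R :=
  series (fun n => limn (H_coef_series mu f n) * z ^+ n).

Definition H_dom (R : realType)
    (mu : {finite_measure set (measurableTypeR R) -> \bar R}) :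
    set (Cplx R -> Cplx R) :=
  [set f | (forall n, cvgn (H_coef_series mu f n)) /\
           (forall z, disc z -> cvgn (H_series mu f z))].

Definition H_op (R : realType)
    (mu : {finite_measure set (measurableTypeR R) -> \bar R})
    (f : Cplx R -> Cplx R) (z : Cplx R) : Cplx R :=
  limn (H_series mu f z).

Definition log_Carleson (R : realType) (alpha s : R)
    (mu : {finite_measure set (measurableTypeR R) -> \bar R}) : Prop :=
  exists2 C : R, 0 < C & forall t : R, 0 <= t < 1 ->
    (mu `[t, 1%R[%classic * (ln (1 / (1 - t)) `^ alpha)%:E <= (C * (1 - t) `^ s)%:E)%E.

(* Main.v *)
From mathcomp Require Import all_boot all_order all_algebra.
From mathcomp Require Import all_classical all_reals all_analysis.
From mathcomp Require Import measurable_realfun complex.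
From mathcomp Require Import ring lra zify.
Require Import Defs.

Set Implicit Arguments.
Unset Strict Implicit.
Unset Printing Implicit Defensive.

Import Order.TTheory GRing.Theory Num.Theory.
Import numFieldNormedType.Exports.

Local Open Scope classical_set_scope.
Local Open Scope ring_scope.

(** Write L(t) = log(1/(1-t)). Two facts about Q_s, both valid for every s > 0,
    make the parameter s irrelevant.

    - Q_s is large: an analytic g with |g'(z)| <= K / |1-z| on the disc belongs to
      Q_s, with seminorm at most a constant times K ([Qs_of_derive_bound]).
      This follows from a direct estimate of the area integral
      ([Qs_integral_le]). The power g(z,a)^s of the Green function is at most a
      multiple of (|1-a| |1-z| / |z-a|^2)^q with 0 < q <= 1/2, and the integral of
      |1-z|^(-2) times this quantity is scale invariant, hence bounded in a; it
      is summed over dyadic shells around 1 and around a. In particular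
      log(1/(1-z)) lies in every Q_s ([Qs_clog]).

    - Q_s is small: its functions are Bloch functions, that is,
      |f'(z)| (1-|z|) is at most a constant times the seminorm ([Qs_bloch]),
      because the Green function is at least 1 on a disc around a of
      radius comparable to 1-|a| and |f'|^2 has the sub-mean value property
      for area. The latter is obtained from Parseval's identity on the roots of
      unity and the rotation invariance of area ([submean_poly_area]).
      Integrating along the radius, |f(t)| <= K (1 + L(t)), with K a constant times
      the norm of f ([Qs_radial_growth]).

    Sufficiency of (v) for I_mu. Under (v) the measure (1 + L) dmu is a Carleson
    measure, so its integral against 1/(1-t+d)^2 is O(1/d)
    ([carleson_kernel_bound]). As |1-tz| is comparable to (1-t) + |1-z|, the growth
    of f gives |(I_mu f)'(z)| <= C K / |1-z| ([I_op_derive_bound]), and I_mu f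
    lies in Q_s by the first fact.

    Sufficiency for H_mu. If the series of |a_k| mu_k converges then
    H_mu f = I_mu f ([H_eq_I]). For a Bloch function, Parseval's identity on the
    circle of radius 1 - 1/(4K) gives that the sum of k^2 |a_k|^2 over k <= K is
    O(K^2), and (v) gives mu_k = O(1/k); together these yield the
    convergence ([bloch_moment_summable]).

    Necessity of (v). If F = I_mu(log(1/(1-z))) is in Q_s then it is a Bloch
    function, while positivity of the integrand gives
    F'(r) >= r L(r) mu([r,1)) / (4 (1-r)^2); comparing the two at r yields (v)
    ([log_Carleson_of_I_clog]). If instead H_mu is bounded, the convergence of the
    first row, a series of nonnegative terms, shows that
    H_mu and I_mu agree on the logarithm ([clog_summable]), and the
    same argument applies. *)

(** * The modulus of a complex number *)

Section ComplexModulus.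
Context {R : realType}.
Notation C := (Cplx R).
Implicit Types (z w : C) (x y : R).

Lemma norm_cmod z : `|z| = ofR (cmod z).
Proof. by []. Qed.

Lemma cmodE z : cmod z = Num.sqrt (complex.Re z ^+ 2 + complex.Im z ^+ 2).
Proof. by case: z. Qed.

Lemma cmod_ge0 z : 0 <= cmod z. Proof. by rewrite cmodE sqrtr_ge0. Qed.

Lemma cmod0 : cmod (0 : C) = 0. Proof. exact: ComplexField.Normc.normc0. Qed.

Lemma cmod1 : cmod (1 : C) = 1. Proof. exact: ComplexField.Normc.normc1. Qed.

Lemma cmod_eq0 z : (cmod z == 0) = (z == 0).
Proof.
apply/eqP/eqP => [|->]; last exact: cmod0.
exact: ComplexField.Normc.eq0_normc.
Qed.

Lemma cmod_gt0 z : (0 < cmod z) = (z != 0).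
Proof. by rewrite lt_def cmod_ge0 andbT cmod_eq0. Qed.

Lemma cmodM z w : cmod (z * w) = cmod z * cmod w.
Proof. exact: ComplexField.Normc.normcM. Qed.

Lemma cmodV z : cmod z^-1 = (cmod z)^-1.
Proof. exact: ComplexField.Normc.normcV. Qed.

Lemma cmodX z n : cmod (z ^+ n) = cmod z ^+ n.
Proof. by elim: n => [|n ih]; rewrite ?expr0 ?cmod1// !exprS cmodM ih. Qed.

Lemma cmodD z w : cmod (z + w) <= cmod z + cmod w.
Proof. exact: le_normcD. Qed.

Lemma cmodN z : cmod (- z) = cmod z.
Proof. exact: normcN. Qed.

Lemma cmodB z w : cmod (z - w) <= cmod z + cmod w.
Proof. by rewrite -(cmodN w) cmodD. Qed.

Lemma cmodBC z w : cmod (z - w) = cmod (w - z).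
Proof. by rewrite -cmodN opprB. Qed.

Lemma cmod_triB z w : cmod z - cmod w <= cmod (z - w).
Proof. by rewrite lerBlDr (le_trans _ (cmodD _ _))// subrK. Qed.

Lemma cmod_dist z w : `|cmod z - cmod w| <= cmod (z - w).
Proof. by rewrite ler_norml cmod_triB andbT lerNl opprB cmodBC cmod_triB. Qed.

Lemma cmod_sum (I : Type) (r : seq I) (P : pred I) (F : I -> C) :
  cmod (\sum_(i <- r | P i) F i) <= \sum_(i <- r | P i) cmod (F i).
Proof.
elim/big_ind2: _ => [||//]; first by rewrite cmod0.
by move=> z1 x1 z2 x2 h1 h2; rewrite (le_trans (cmodD _ _))// lerD.
Qed.

Lemma cmod_nat n : cmod (n%:R : C) = n%:R.
Proof.
elim: n => [|n ih]; first by rewrite cmod0.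
have -> : (n.+1%:R : C) = ofR n.+1%:R.
  by rewrite /ofR (rmorph_nat (real_complex R)).
by rewrite cmodE /= expr0n/= addr0 sqrtr_sqr ger0_norm.
Qed.

Lemma ofRD x y : ofR (x + y) = ofR x + ofR y.
Proof. exact: (rmorphD (real_complex R)). Qed.
Lemma ofRB x y : ofR (x - y) = ofR x - ofR y.
Proof. exact: (rmorphB (real_complex R)). Qed.
Lemma ofRM x y : ofR (x * y) = ofR x * ofR y.
Proof. exact: (rmorphM (real_complex R)). Qed.
Lemma ofRX x n : ofR (x ^+ n) = ofR x ^+ n.
Proof. exact: (rmorphXn (real_complex R)). Qed.
Lemma ofRV x : ofR x^-1 = (ofR x)^-1.
Proof. exact: (fmorphV (real_complex R)). Qed.
Lemma ofR0 : ofR 0 = 0 :> C. Proof. by []. Qed.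
Lemma ofR1 : ofR 1 = 1 :> C. Proof. by []. Qed.
Lemma ofR_nat n : ofR n%:R = n%:R :> C.
Proof. exact: (rmorph_nat (real_complex R)). Qed.
Lemma ofR_sum (I : Type) (r : seq I) (P : pred I) (F : I -> R) :
  ofR (\sum_(i <- r | P i) F i) = \sum_(i <- r | P i) ofR (F i).
Proof. exact: (rmorph_sum (real_complex R)). Qed.

Lemma cmod_ofR x : cmod (ofR x) = `|x|.
Proof. by rewrite cmodE /= expr0n/= addr0 sqrtr_sqr. Qed.

Lemma ReD z w : complex.Re (z + w) = complex.Re z + complex.Re w.
Proof. by case: z; case: w. Qed.
Lemma ImD z w : complex.Im (z + w) = complex.Im z + complex.Im w.
Proof. by case: z; case: w. Qed.
Lemma ReN z : complex.Re (- z) = - complex.Re z. Proof. by case: z. Qed.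
Lemma ImN z : complex.Im (- z) = - complex.Im z. Proof. by case: z. Qed.
Lemma ReB z w : complex.Re (z - w) = complex.Re z - complex.Re w.
Proof. by rewrite ReD ReN. Qed.
Lemma ImB z w : complex.Im (z - w) = complex.Im z - complex.Im w.
Proof. by rewrite ImD ImN. Qed.
Lemma ReM z w : complex.Re (z * w) =
  complex.Re z * complex.Re w - complex.Im z * complex.Im w.
Proof. by case: z; case: w. Qed.
Lemma ImM z w : complex.Im (z * w) =
  complex.Re z * complex.Im w + complex.Im z * complex.Re w.
Proof. by case: z; case: w => a b c d /=; rewrite addrC; congr (_ + _); rewrite mulrC. Qed.
Lemma Re_ofRM x z : complex.Re (ofR x * z) = x * complex.Re z.
Proof. by rewrite ReM /= mul0r subr0. Qed.
Lemma Re_sum (I : Type) (r : seq I) (P : pred I) (F : I -> C) :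
  complex.Re (\sum_(i <- r | P i) F i) = \sum_(i <- r | P i) complex.Re (F i).
Proof. by apply: (big_morph _ ReD). Qed.
Lemma Im_sum (I : Type) (r : seq I) (P : pred I) (F : I -> C) :
  complex.Im (\sum_(i <- r | P i) F i) = \sum_(i <- r | P i) complex.Im (F i).
Proof. by apply: (big_morph _ ImD). Qed.

Lemma Re_le_cmod z : `|complex.Re z| <= cmod z.
Proof. by rewrite cmodE -sqrtr_sqr ler_wsqrtr// lerDl sqr_ge0. Qed.
Lemma Im_le_cmod z : `|complex.Im z| <= cmod z.
Proof. by rewrite cmodE -sqrtr_sqr ler_wsqrtr// lerDr sqr_ge0. Qed.

Lemma cmod_le_ReIm z : cmod z <= `|complex.Re z| + `|complex.Im z|.
Proof.
have h : 0 <= `|complex.Re z| + `|complex.Im z| by rewrite addr_ge0.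
rewrite -(ler_pXn2r (n:=2)) ?nnegrE ?cmod_ge0// cmodE sqr_sqrtr ?addr_ge0 ?sqr_ge0//.
rewrite sqrrD !real_normK ?num_real// lerD2r lerDl mulrn_wge0//.
Qed.

Lemma cmod_sqr z : cmod z ^+ 2 = complex.Re z ^+ 2 + complex.Im z ^+ 2.
Proof. by rewrite cmodE sqr_sqrtr ?addr_ge0 ?sqr_ge0. Qed.

Lemma eq_ler x y : x = y -> x <= y.
Proof. by move=> ->. Qed.

Lemma discE z : disc z <-> cmod z < 1.
Proof. by rewrite /disc /= norm_cmod -ofR1 ltcR. Qed.

Lemma sqr_cmodJ z : ofR (cmod z ^+ 2) = z * z^*.
Proof. by rewrite ofRX -norm_cmod normCK. Qed.

Lemma cmodJ z : cmod z^* = cmod z.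
Proof.
have := sqr_cmodJ z; have := sqr_cmodJ z^*; rewrite conjCK mulrC => <- /complexI.
by move/eqP; rewrite eqrXn2 ?cmod_ge0// => /eqP.
Qed.

Lemma cmod_1B_gt0 z : disc z -> 0 < cmod (1 - z).
Proof.
move=> /discE z1; rewrite cmod_gt0 subr_eq0.
by apply: contraTneq z1 => <-; rewrite cmod1 ltxx.
Qed.

(** The norm on C takes values in C; the real modulus carries the order that
    estimates need. *)
Lemma cvg_cmodP (T : Type) (F : set_system T) {FF : Filter F} (f : T -> C) (l : C) :
  f @ F --> l <-> (forall e : R, 0 < e -> \forall x \near F, cmod (l - f x) < e).
Proof.
split => [/cvgrPdist_lt h e e0|h].
  have e0' : (0 : C) < ofR e by rewrite -ofR0 ltcR.
  by apply: filterS (h _ e0') => x; rewrite norm_cmod ltcR.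
apply/cvgrPdist_lt => e e0.
have ee : e = ofR (complex.Re e).
  move: e0; case: e => a b; rewrite ltcE /= => /andP[/eqP b0 _].
  by rewrite /ofR b0.
rewrite ee; apply: filterS (h (complex.Re e) _) => [x|].
  by rewrite norm_cmod ltcR.
by move: e0; rewrite ltcE /= => /andP[].
Qed.

Lemma cvg_cmod0P (T : Type) (F : set_system T) {FF : Filter F} (f : T -> C) (l : C) :
  f @ F --> l <-> (cmod (f x - l)) @[x --> F] --> (0 : R).
Proof.
split => [/cvg_cmodP h|/cvgrPdist_lt h].
  apply/cvgrPdist_lt => e e0; apply: filterS (h _ e0) => x.
  by rewrite sub0r normrN ger0_norm ?cmod_ge0// cmodBC.
apply/cvg_cmodP => e e0; apply: filterS (h _ e0) => x.
by rewrite sub0r normrN ger0_norm ?cmod_ge0// cmodBC.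
Qed.

Lemma cvg_Re (T : Type) (F : set_system T) {FF : Filter F} (f : T -> C) (l : C) :
  f @ F --> l -> complex.Re (f x) @[x --> F] --> complex.Re l.
Proof.
move=> /cvg_cmodP h; apply/cvgrPdist_lt => e e0; apply: filterS (h _ e0) => x.
by rewrite -ReB; apply: le_lt_trans; exact: Re_le_cmod.
Qed.

Lemma cvg_Im (T : Type) (F : set_system T) {FF : Filter F} (f : T -> C) (l : C) :
  f @ F --> l -> complex.Im (f x) @[x --> F] --> complex.Im l.
Proof.
move=> /cvg_cmodP h; apply/cvgrPdist_lt => e e0; apply: filterS (h _ e0) => x.
by rewrite -ImB; apply: le_lt_trans; exact: Im_le_cmod.
Qed.

Lemma cvg_ReIm (T : Type) (F : set_system T) {FF : Filter F} (f : T -> C) (a b : R) :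
  complex.Re (f x) @[x --> F] --> a -> complex.Im (f x) @[x --> F] --> b ->
  f @ F --> ((a +i* b)%C : C).
Proof.
move=> /cvgrPdist_lt ha /cvgrPdist_lt hb; apply/cvg_cmodP => e e0.
have e2 : 0 < e / 2 by rewrite divr_gt0.
apply: filterS2 (ha _ e2) (hb _ e2) => x h1 h2.
rewrite (le_lt_trans (cmod_le_ReIm _))// [e]splitr ReB ImB/=.
exact: ltrD.
Qed.

Lemma cvg_cmod (T : Type) (F : set_system T) {FF : Filter F} (f : T -> C) (l : C) :
  f @ F --> l -> cmod (f x) @[x --> F] --> cmod l.
Proof.
move=> /cvg_cmodP h; apply/cvgrPdist_lt => e e0; apply: filterS (h _ e0) => x.
by apply: le_lt_trans; exact: cmod_dist.
Qed.

Lemma cvg_seriesC (u : nat -> C) : cvgn (series (fun k => cmod (u k))) ->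
  cvgn (series u).
Proof.
move=> h.
have hRe : cvgn (series (fun k => complex.Re (u k))).
  apply: normed_cvg; apply: series_le_cvg h => k /=; [exact: normr_ge0|exact: cmod_ge0|exact: Re_le_cmod].
have hIm : cvgn (series (fun k => complex.Im (u k))).
  apply: normed_cvg; apply: series_le_cvg h => k /=; [exact: normr_ge0|exact: cmod_ge0|exact: Im_le_cmod].
apply/cvg_ex; eexists; apply: cvg_ReIm.
- rewrite (_ : (fun n => _) = series (fun k => complex.Re (u k))); first exact: hRe.
  by apply/funext => n; rewrite /series/= Re_sum.
- rewrite (_ : (fun n => _) = series (fun k => complex.Im (u k))); first exact: hIm.
  by apply/funext => n; rewrite /series/= Im_sum.
Qed.

Lemma cvg_limC (T : Type) (F : set_system T) {FF : ProperFilter F} (f : T -> C) (l : C) :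
  f @ F --> l -> lim (f @ F) = l.
Proof. by move=> h; apply: cvg_lim. Qed.

Lemma cvg_le_cst (T : Type) (F : set_system T) {FF : ProperFilter F} (u : T -> R)
  (l M : R) : u @ F --> l -> (\forall x \near F, u x <= M) -> l <= M.
Proof. by move=> h1 h2; refine (cvgr_to_le h1 h2). Qed.

Lemma cmod_lim_le (u : nat -> C) (l : C) (M : R) : u @ \oo --> l ->
  (\forall n \near \oo, cmod (u n) <= M) -> cmod l <= M.
Proof. by move=> h1; move=> h2; refine (cvg_le_cst (cvg_cmod h1) h2). Qed.

End ComplexModulus.

(** * Power series on the unit disc *)

Section PowerSeries.
Context {R : realType}.
Notation C := (Cplx R).
Implicit Types (z w : C) (a : nat -> C) (f g : C -> C) (r : R).

Definition abs_cvg_disc a := forall r, 0 <= r < 1 ->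
  cvgn (series (fun k => cmod (a k) * r ^+ k)).

Definition psum a z : C := limn (series (fun k => a k * z ^+ k)).

Definition sum_on_disc f a :=
  abs_cvg_disc a /\ forall z, disc z -> f z = psum a z.

Lemma psum_cvg a z : abs_cvg_disc a -> cmod z < 1 ->
  series (fun k => a k * z ^+ k) @ \oo --> psum a z.
Proof.
move=> ha z1; apply: cvg_seriesC.
rewrite (_ : (fun k => _) = (fun k => cmod (a k) * cmod z ^+ k)).
  by apply: ha; rewrite cmod_ge0.
by apply/funext => k; rewrite cmodM cmodX.
Qed.

Lemma ge0_series_cvg (u : R^nat) (M : R) : (forall k, 0 <= u k) ->
  (forall n, series u n <= M) -> cvgn (series u).
Proof.
move=> u0 uM; apply: nondecreasing_is_cvgn.
  by apply: nondecreasing_series => k _ _; exact: u0.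
by exists M => _ [n _ <-]; exact: uM.
Qed.

Lemma ge0_series_le_lim (u : R^nat) n : (forall k, 0 <= u k) ->
  cvgn (series u) -> series u n <= limn (series u).
Proof.
move=> u0 cu; apply: nondecreasing_cvgn_le => //.
by apply: nondecreasing_series => k _ _; exact: u0.
Qed.

(** A bound for the terms at the radius (1 + r) / 2 makes the series at radius r
    comparable to a geometric one. *)
Lemma bounded_abs_cvg_disc a :
  (forall r, 0 <= r < 1 -> exists M : R, forall k, cmod (a k) * r ^+ k <= M) ->
  abs_cvg_disc a.
Proof.
move=> ha r /andP[r0 r1].
pose t : R := (1 + r) / 2.
have t01 : 0 <= t < 1 by apply/andP; split; rewrite /t; lra.
have [M hM] := ha t t01.
have t0 : 0 < t by rewrite /t; lra.
have M0 : 0 <= M by apply: le_trans (hM 0%N); rewrite mulr_ge0 ?cmod_ge0.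
apply: (@series_le_cvg _ _ (geometric M (r / t))).
- by move=> k; rewrite mulr_ge0 ?cmod_ge0 ?exprn_ge0.
- by move=> k; rewrite geometric_ge0// divr_ge0// ltW.
- move=> k /=; rewrite expr_div_n mulrA ler_pdivlMr ?exprn_gt0//.
  by rewrite mulrAC ler_wpM2r// exprn_ge0.
apply: is_cvg_geometric_series; rewrite ger0_norm; last by rewrite divr_ge0// ltW.
by rewrite ltr_pdivrMr// mul1r /t; lra.
Qed.

Lemma analytic_sum_on_disc f : analytic_on_disc f -> exists a, sum_on_disc f a.
Proof.
move=> [a ha]; exists a; split.
  apply: bounded_abs_cvg_disc => r /andP[r0 r1].
  have rd : disc (ofR r) by apply/discE; rewrite cmod_ofR ger0_norm.
  have /cvg_series_cvg_0 h := cvgP _ (ha _ rd).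
  have /cvg_cmod : (fun k => a k * ofR r ^+ k) @ \oo --> (0 : C) by exact: h.
  rewrite cmod0 => /cvgP /cvg_seq_bounded [M [_ hM]].
  exists (M + 1) => k.
  have := hM (M + 1); rewrite ltrDl ltr01 => /(_ isT k I) /=.
  rewrite ger0_norm ?cmod_ge0// cmodM cmodX cmod_ofR ger0_norm//.
by move=> z dz; rewrite /psum; apply/esym; apply: cvg_limC; exact: ha.
Qed.

Lemma sum_on_disc_analytic f a : sum_on_disc f a -> analytic_on_disc f.
Proof.
move=> [ha hf]; exists a => z dz; rewrite hf//.
by apply: psum_cvg => //; apply/discE.
Qed.

Definition dcoef a : nat -> C := fun k => k.+1%:R * a k.+1.

Lemma sum_geo_le (t : R) n : 0 <= t < 1 -> \sum_(0 <= j < n) t ^+ j <= (1 - t)^-1.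
Proof.
move=> /andP[t0 t1].
have := geometric_seriesE 1 (negbT (lt_eqF t1)) => /(congr1 (fun v : R^nat => v n)).
rewrite /series/= => E.
rewrite (eq_bigr (fun j => 1 * t ^+ j)); last by move=> j _; rewrite mul1r.
rewrite E mul1r ler_pdivrMr ?subr_gt0// mulVf ?subr_eq0 ?gt_eqF//.
by rewrite gerBl exprn_ge0.
Qed.

(** Each of the first k + 1 terms of the geometric series is at least p ^ k. *)
Lemma mulrn_expr_le1 (p : R) k : 0 <= p < 1 -> k.+1%:R * p ^+ k <= (1 - p)^-1.
Proof.
move=> p01; case/andP: (p01) => p0 p1; apply: le_trans (sum_geo_le k.+1 p01).
rewrite mulr_natl -{1}[k.+1]subn0 -sumr_const_nat ler_sum_nat// => i ik.
by rewrite ler_wiXn2l// ?p0 1?ltW.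
Qed.

Lemma abs_cvg_dcoef a : abs_cvg_disc a -> abs_cvg_disc (dcoef a).
Proof.
move=> ha; apply: bounded_abs_cvg_disc => r /andP[r0 r1].
pose t : R := (1 + r) / 2.
have t01 : 0 <= t < 1 by apply/andP; split; rewrite /t; lra.
have t0 : 0 < t by rewrite /t; lra.
have rt : 0 <= r / t < 1.
  apply/andP; split; first exact: divr_ge0 r0 (ltW t0).
  by rewrite ltr_pdivrMr// mul1r /t; lra.
have hc := ha _ t01.
exists ((1 - r / t)^-1 * (limn (series (fun k => cmod (a k) * t ^+ k)) / t)) => k.
rewrite /dcoef cmodM cmod_nat.
have -> : k.+1%:R * cmod (a k.+1) * r ^+ k =
    (k.+1%:R * (r / t) ^+ k) * (cmod (a k.+1) * t ^+ k.+1 / t).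
  rewrite expr_div_n exprSr; field.
  by rewrite expf_neq0 ?gt_eqF.
apply: ler_pM; rewrite ?mulrn_expr_le1//.
- by rewrite mulr_ge0// exprn_ge0//; case/andP: rt.
- have t0' := ltW t0.
  by apply: divr_ge0 => //; apply: mulr_ge0; [exact: cmod_ge0|exact: exprn_ge0].
rewrite ler_pM2r ?invr_gt0//.
have h0 j : 0 <= cmod (a j) * t ^+ j.
  by apply: mulr_ge0; [exact: cmod_ge0|exact/exprn_ge0/ltW].
apply: le_trans (ge0_series_le_lim k.+2 h0 hc).
by rewrite /series/= big_nat_recr//= lerDr sumr_ge0.
Qed.

Lemma psum_tail_le a z r n : abs_cvg_disc a -> cmod z <= r -> r < 1 ->
  cmod (psum a z - series (fun k => a k * z ^+ k) n) <=
  limn (series (fun k => cmod (a k) * r ^+ k)) -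
  series (fun k => cmod (a k) * r ^+ k) n.
Proof.
move=> ha zr r1.
have r0 : 0 <= r by apply: le_trans zr; exact: cmod_ge0.
have z1 : cmod z < 1 by apply: le_lt_trans r1.
have hr : cvgn (series (fun k => cmod (a k) * r ^+ k)) by apply: ha; rewrite r0.
have hz := psum_cvg ha z1.
have h1 : series (fun k => a k * z ^+ k) m - series (fun k => a k * z ^+ k) n
  @[m --> \oo] --> psum a z - series (fun k => a k * z ^+ k) n.
  by refine (cvgB hz _); exact: cvg_cst.
refine (cmod_lim_le h1 _).
exists n => // m /= nm.
rewrite (@sub_series_geq _ _ n m)//.
apply: (@le_trans _ _ (\sum_(n <= k < m) cmod (a k) * r ^+ k)).
  rewrite (le_trans (cmod_sum _ _ _))//; apply: ler_sum => k _.
  by rewrite cmodM cmodX ler_wpM2l ?cmod_ge0// lerXn2r ?nnegrE ?cmod_ge0.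
rewrite -(@sub_series_geq _ (fun k => cmod (a k) * r ^+ k) n m)// lerD2r.
apply: ge0_series_le_lim => // k.
by rewrite mulr_ge0 ?cmod_ge0 ?exprn_ge0.
Qed.

Lemma psum_approx a r e : abs_cvg_disc a -> 0 <= r < 1 -> 0 < e ->
  \forall n \near \oo, forall z, cmod z <= r ->
    cmod (psum a z - series (fun k => a k * z ^+ k) n) <= e.
Proof.
move=> ha r01 e0; have := ha _ r01 => /cvgrPdist_le /(_ e e0).
case/andP: r01 => r0 r1.
apply: filterS => n hn z zr.
apply: le_trans (psum_tail_le n ha zr r1) _.
by apply: le_trans hn; exact: ler_norm.
Qed.

(** The second-order error for monomials, with a constant that stays summable
    against the coefficients of any power series on the disc; this replaces
    contour integrals. *)
Lemma pow_taylor2 z w r n : cmod z <= r -> cmod w <= r ->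
  cmod (w ^+ n.+1 - z ^+ n.+1 - n.+1%:R * z ^+ n * (w - z)) <=
  (n * n.+1)%:R * r ^+ n.-1 * cmod (w - z) ^+ 2.
Proof.
move=> zr wr; have r0 : 0 <= r by apply: le_trans zr; exact: cmod_ge0.
elim: n => [|n ih].
  by rewrite !expr1 expr0 !mul1r subrr cmod0 mul0n !mul0r.
have -> : w ^+ n.+2 - z ^+ n.+2 - n.+2%:R * z ^+ n.+1 * (w - z) =
  w * (w ^+ n.+1 - z ^+ n.+1 - n.+1%:R * z ^+ n * (w - z)) +
  n.+1%:R * z ^+ n * (w - z) ^+ 2.
  rewrite -(natr1 n.+1) !exprS; ring.
apply: le_trans (cmodD _ _) _; rewrite !cmodM !cmodX cmod_nat.
have h1 : cmod w * cmod (w ^+ n.+1 - z ^+ n.+1 - n.+1%:R * z ^+ n * (w - z)) <=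
   (n * n.+1)%:R * r ^+ n * cmod (w - z) ^+ 2.
  apply: (@le_trans _ _ (r * ((n * n.+1)%:R * r ^+ n.-1 * cmod (w - z) ^+ 2))).
    by apply: ler_pM; rewrite ?cmod_ge0.
  case: (n) => [|m]; first by rewrite mul0n !mul0r mulr0.
  rewrite (exprS r m) /=; apply: eq_ler; ring.
have h2 : n.+1%:R * cmod z ^+ n * cmod (w - z) ^+ 2 <=
   n.+1%:R * r ^+ n * cmod (w - z) ^+ 2.
  rewrite ler_wpM2r ?exprn_ge0 ?cmod_ge0// ler_wpM2l//.
  by rewrite lerXn2r ?nnegrE ?cmod_ge0.
apply: le_trans (lerD h1 h2) _.
rewrite -!mulrDl -natrD /= ler_wpM2r ?exprn_ge0 ?cmod_ge0//.
rewrite ler_wpM2r ?exprn_ge0// ler_nat.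
by rewrite !mulnS !mulSn; lia.
Qed.

End PowerSeries.

(** * Differentiation of power series *)

Section PowerSeriesDerivative.
Context {R : realType}.
Notation C := (Cplx R).
Implicit Types (z w : C) (a : nat -> C) (f g : C -> C) (r : R).

(** Termwise differentiation with a quadratic error which is uniform on compact
    discs. The uniformity is what allows increments of f along a radius to be
    added up later. *)
Lemma psum_taylor2 a r : abs_cvg_disc a -> 0 <= r < 1 ->
  exists2 K : R, 0 <= K & forall z w, cmod z <= r -> cmod w <= r ->
    cmod (psum a w - psum a z - psum (dcoef a) z * (w - z)) <=
    K * cmod (w - z) ^+ 2.
Proof.
move=> ha /[dup] r01 /andP[r0 r1].
have ha' := abs_cvg_dcoef ha; have ha'' := abs_cvg_dcoef ha'.
pose u k := cmod (dcoef (dcoef a) k) * r ^+ k.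
have u0 k : 0 <= u k by rewrite mulr_ge0 ?cmod_ge0 ?exprn_ge0.
have cu : cvgn (series u) by exact: ha''.
exists (limn (series u)).
  by refine (le_trans _ (ge0_series_le_lim 0 u0 cu)); rewrite /series/= big_geq.
move=> z w zr wr.
have z1 : cmod z < 1 by apply: le_lt_trans r1.
have w1 : cmod w < 1 by apply: le_lt_trans r1.
have hw := psum_cvg ha w1; have hz := psum_cvg ha z1.
have hd := psum_cvg ha' z1.
rewrite -cvg_shiftS in hw; rewrite -cvg_shiftS in hz.
have h : (series (fun k => a k * w ^+ k) n.+1 - series (fun k => a k * z ^+ k) n.+1 -
    series (fun k => dcoef a k * z ^+ k) n * (w - z)) @[n --> \oo] -->
    psum a w - psum a z - psum (dcoef a) z * (w - z).
  by refine (cvgB (cvgB hw hz) (cvgM hd (cvg_cst (w - z)))).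
refine (cmod_lim_le h _); apply: nearW => n /=.
have -> : (series (fun k => a k * w ^+ k) n.+1 - series (fun k => a k * z ^+ k) n.+1 -
  series (fun k => dcoef a k * z ^+ k) n * (w - z)) =
  \sum_(0 <= k < n) a k.+1 * (w ^+ k.+1 - z ^+ k.+1 - k.+1%:R * z ^+ k * (w - z)).
  rewrite /series/= !big_nat_recl//= !expr0 opprD addrACA subrr add0r mulr_suml -!sumrB.
  by apply: eq_bigr => k _; rewrite /dcoef; ring.
apply: (@le_trans _ _ (series u n * cmod (w - z) ^+ 2)); last first.
  rewrite ler_wpM2r ?exprn_ge0 ?cmod_ge0//.
  exact: ge0_series_le_lim.
apply: (@le_trans _ _ (\sum_(0 <= k < n) cmod (a k.+1) *
   ((k * k.+1)%:R * r ^+ k.-1 * cmod (w - z) ^+ 2))).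
  rewrite (le_trans (cmod_sum _ _ _))//; apply: ler_sum => k _.
  rewrite cmodM ler_wpM2l ?cmod_ge0//.
  exact: pow_taylor2.
under eq_bigr do rewrite mulrA.
rewrite -mulr_suml ler_wpM2r ?exprn_ge0 ?cmod_ge0//.
case: n => [|n]; first by rewrite /series/= !big_geq.
rewrite big_nat_recl//= mul0n mul0r mulr0 add0r /series/=.
rewrite big_nat_recr//= -[leLHS]addr0 lerD//; apply: ler_sum => k _.
by rewrite /u /dcoef !cmodM !cmod_nat natrM; apply: eq_ler; ring.
Qed.

Lemma near_dnbhs0C (P : C -> Prop) (d : R) : 0 < d ->
  (forall h, h != 0 -> cmod h < d -> P h) -> \forall h \near 0^', P h.
Proof.
move=> d0 hP; rewrite /dnbhs /within /=; apply/nbhs_ballP.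
exists (ofR d) => /=; first by rewrite -ofR0 ltcR.
move=> h; rewrite /ball /= sub0r normrN norm_cmod ltcR => hd h0.
exact: hP.
Qed.

Lemma quotient_psum f a z : sum_on_disc f a -> disc z ->
  h^-1 *: (f (h + z) - f z) @[h --> 0^'] --> psum (dcoef a) z.
Proof.
move=> [ha hf] /[dup] zd /discE z1; apply/cvg_cmodP => e e0.
pose r : R := (1 + cmod z) / 2.
have z0 := cmod_ge0 z.
have r01 : 0 <= r < 1 by apply/andP; split; rewrite /r; lra.
have [K K0 hK] := psum_taylor2 ha r01.
have zr : cmod z <= r by rewrite /r; lra.
have K1 : 0 < K + 1 by lra.
apply: (@near_dnbhs0C _ (Num.min ((1 - cmod z) / 2) (e / (K + 1)))).
  by rewrite lt_min; apply/andP; split; [lra|exact: divr_gt0].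
move=> h h0; rewrite lt_min => /andP[h1 h2].
have hzr : cmod (h + z) <= r by rewrite (le_trans (cmodD _ _))// /r; lra.
have hzd : disc (h + z) by apply/discE; case/andP: r01 => _; exact: le_lt_trans.
have := hK _ _ zr hzr; rewrite -!hf// addrK => hh.
have ch0 : 0 < cmod h by rewrite cmod_gt0.
have -> : psum (dcoef a) z - h^-1 *: (f (h + z) - f z) =
   - (h^-1 * (f (h + z) - f z - psum (dcoef a) z * h)).
  rewrite /GRing.scale/=; field; exact: h0.
rewrite cmodN cmodM cmodV.
apply: (@le_lt_trans _ _ (K * cmod h)).
  rewrite mulrC ler_pdivrMr// (le_trans hh)// expr2 mulrA//.
apply: (@le_lt_trans _ _ ((K + 1) * cmod h)).
  by rewrite ler_wpM2r ?cmod_ge0// lerDl.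
by rewrite mulrC -ltr_pdivlMr.
Qed.

Lemma derive1_psum f a z : sum_on_disc f a -> disc z ->
  derive1 f z = psum (dcoef a) z.
Proof. by move=> hf zd; refine (cvg_limC (quotient_psum hf zd)). Qed.

Lemma sum_on_disc_derive1 f a : sum_on_disc f a ->
  sum_on_disc (derive1 f) (dcoef a).
Proof.
move=> hf; split; first by apply: abs_cvg_dcoef; case: hf.
by move=> z; exact: derive1_psum.
Qed.

Lemma sum_on_disc_derive1n f a n : sum_on_disc f a ->
  sum_on_disc (derive1n n f) (iter n dcoef a).
Proof. by move=> hf; elim: n => //= n; exact: sum_on_disc_derive1. Qed.

Lemma iter_dcoef a n k : iter n dcoef a k = ((n + k)`!)%:R / (k`!)%:R * a (n + k)%N.
Proof.
elim: n k => [|n ih] k /=.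
  by rewrite divff ?mul1r// pnatr_eq0 -lt0n fact_gt0.
rewrite /dcoef ih addSnnS mulrA; congr (_ * _).
rewrite factS natrM; field.
by rewrite !pnatr_eq0 -lt0n fact_gt0 /=.
Qed.

Lemma psum0 a : psum a 0 = a 0%N.
Proof.
rewrite /psum; apply: cvg_limC; rewrite -cvg_shiftS.
rewrite (_ : (fun n => _) = fun=> a 0%N); first exact: cvg_cst.
apply/funext => n; rewrite /series/= big_nat_recl//= expr0 mulr1 big1 ?addr0//.
by move=> k _; rewrite exprS mul0r mulr0.
Qed.

Lemma disc0 : disc (0 : C).
Proof. by apply/discE; rewrite cmod0. Qed.

Lemma taylor_sum_on_disc f a k : sum_on_disc f a -> taylor f k = a k.
Proof.
move=> /(sum_on_disc_derive1n k)[_ h]; rewrite /taylor h; last exact: disc0.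
rewrite psum0 iter_dcoef addn0 fact0 divr1 mulrAC mulfV ?mul1r//.
Qed.

(** The derivative at z is a limit along increments that may be taken so small
    that z + h stays in the disc; hence membership in Q_s and the norm depend
    only on the values on the disc. *)
Lemma derive1_eq_on_disc f g z : (forall w, disc w -> f w = g w) -> disc z ->
  derive1 f z = derive1 g z.
Proof.
move=> fg /[dup] zd /discE z1; rewrite /derive1; congr (lim _).
apply/seteqP; split => P /=; apply: filter_app;
  (apply: (@near_dnbhs0C _ (1 - cmod z)); first by rewrite subr_gt0);
  move=> h _ hd; have hz : disc (h + z) by [
    apply/discE; apply: le_lt_trans (cmodD _ _) _; rewrite -ltrBrDr].
- by rewrite /= !fg.
- by rewrite /= !fg.
Qed.

Lemma Qs_integral_eq_on_disc (s : R) f g (b : C) : (forall w, disc w -> f w = g w) ->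
  Qs_integral s f b = Qs_integral s g b.
Proof.
move=> fg; rewrite /Qs_integral.
refine (congr1 (fun x => ((pi^-1)%:E * x)%E) _).
apply: eq_integral => p; rewrite inE => /= hp.
by rewrite (derive1_eq_on_disc fg hp).
Qed.

Lemma Qs_eq_on_disc (s : R) f g : (forall w, disc w -> f w = g w) ->
  Qs s f -> Qs s g /\ Qs_norm s f = Qs_norm s g.
Proof.
move=> fg [[a ha] hf].
have E : Qs_sup s f = Qs_sup s g.
  refine (congr1 (@ereal_sup R) _); apply: eq_imagel => b _.
  exact: Qs_integral_eq_on_disc.
split; first split.
- by exists a => z zd; rewrite -(fg z zd); exact: ha.
- by move: hf; rewrite E.
by rewrite /Qs_norm /Qs_seminorm E (fg 0 disc0).
Qed.

End PowerSeriesDerivative.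

(** * Rotation invariance of area *)

Section PlaneMeasure.
Context {R : realType}.
Notation T1 := (measurableTypeR R).
Notation T2 := (measurableTypeR R * measurableTypeR R)%type.
Notation leb := (@lebesgue_measure R).
Notation leb2 := (leb \x leb)%E.

Lemma measurable_shiftR (c : R) : measurable_fun setT ((fun x => x + c) : T1 -> T1).
Proof. by apply: measurable_funD => //; exact: measurable_cst. Qed.

Lemma lebesgue_measure_shift (c : R) (A : set T1) : measurable A ->
  pushforward leb ((fun x => x + c) : T1 -> T1) A = leb A.
Proof.
move=> mA; apply/esym/lebesgue_measure_unique => //=.
  exact: measurable_shiftR.
move=> mf _ [[a b]] _ <-.
rewrite /pushforward.
have -> : (fun x : R => x + c) @^-1` `]a, b] = `]a - c, b - c]%classic.
  apply/seteqP; split => x /=; rewrite !in_itv/= => /andP[h1 h2]; apply/andP; split.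
  - by rewrite ltrBlDr. - by rewrite lerBrDr.
  - by rewrite -ltrBlDr. - by rewrite -lerBrDr.
rewrite !lebesgue_measure_itv/= !lte_fin ltrD2r; case: ifPn => // _.
by rewrite -!EFinD; congr (_%:E); rewrite opprB addrA subrK.
Qed.

Lemma integral_shift (c : R) (f : T1 -> \bar R) : measurable_fun setT f ->
  (forall x, 0 <= f x)%E ->
  (\int[leb]_x f (x + c)%R = \int[leb]_x f x)%E.
Proof.
move=> mf f0.
have := ge0_integral_pushforward (measurable_shiftR c) leb measurableT mf.
move=> /(_ (fun y _ => f0 y)); rewrite preimage_setT => <-.
apply: eq_measure_integral; first exact: measurable_shiftR.
by move=> mh A mA _; exact: lebesgue_measure_shift.
Qed.

Lemma measurable_pairR (g h : T2 -> T1) : measurable_fun setT g ->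
  measurable_fun setT h -> measurable_fun setT (fun p => (g p, h p) : T2).
Proof. by move=> mg mh; exact: measurable_fun_pair. Qed.

(** By Tonelli's theorem, since Lebesgue measure on each line is translation
    invariant. Shears are what rotations are made of. *)
Lemma integral_shear1 (phi : R -> R) (f : T2 -> \bar R) :
  measurable_fun setT (phi : T1 -> T1) -> measurable_fun setT f ->
  (forall p, 0 <= f p)%E ->
  (\int[leb2]_p f (p.1 + phi p.2, p.2)%R = \int[leb2]_p f p)%E.
Proof.
move=> mphi mf f0.
have mh : measurable_fun setT (fun p : T2 => (p.1 + phi p.2, p.2)%R : T2).
  apply: measurable_pairR; last exact: measurable_snd.
  apply: measurable_funD; first exact: measurable_fst.
  exact: measurableT_comp mphi (measurable_snd).
have mfh : measurable_fun setT (fun p : T2 => f (p.1 + phi p.2, p.2)%R).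
  by apply: (measurableT_comp mf mh).
rewrite (fubini_tonelli2 (fun p : T2 => f (p.1 + phi p.2, p.2)%R))//.
rewrite (fubini_tonelli2 f)//; apply: eq_integral => y _.
rewrite /fubini_G /=.
apply: (integral_shift (phi y) (f := fun x => f (x, y))) => //.
by apply: (measurableT_comp mf); exact: measurable_fun_pair.
Qed.

Lemma integral_shear2 (phi : R -> R) (f : T2 -> \bar R) :
  measurable_fun setT (phi : T1 -> T1) -> measurable_fun setT f ->
  (forall p, 0 <= f p)%E ->
  (\int[leb2]_p f (p.1, p.2 + phi p.1)%R = \int[leb2]_p f p)%E.
Proof.
move=> mphi mf f0.
have mh : measurable_fun setT (fun p : T2 => (p.1, p.2 + phi p.1)%R : T2).
  apply: measurable_pairR; first exact: measurable_fst.
  apply: measurable_funD; first exact: measurable_snd.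
  exact: measurableT_comp mphi (measurable_fst).
have mfh : measurable_fun setT (fun p : T2 => f (p.1, p.2 + phi p.1)%R).
  by apply: (measurableT_comp mf mh).
rewrite (fubini_tonelli1 (fun p : T2 => f (p.1, p.2 + phi p.1)%R))//.
rewrite (fubini_tonelli1 f)//; apply: eq_integral => x _.
rewrite /fubini_F /=.
apply: (integral_shift (phi x) (f := fun y => f (x, y))) => //.
by apply: (measurableT_comp mf); exact: measurable_fun_pair.
Qed.

Lemma integral_shift2 (a b : R) (f : T2 -> \bar R) :
  measurable_fun setT f -> (forall p, 0 <= f p)%E ->
  (\int[leb2]_p f (p.1 + a, p.2 + b)%R = \int[leb2]_p f p)%E.
Proof.
move=> mf f0.
rewrite -(integral_shear1 (phi := fun=> a) _ mf f0); last exact: measurable_cst.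
rewrite -(integral_shear2 (phi := fun=> b) (f := fun p => f (p.1 + a, p.2)%R))//.
apply: (measurableT_comp mf); apply: measurable_pairR; last exact: measurable_snd.
by apply: measurable_funD; [exact: measurable_fst|exact: measurable_cst].
Qed.

(** Rotation by c + i s, c <> -1, as three shears with the slopes
    -tan(theta/2), sin(theta) and -tan(theta/2), where
    tan(theta/2) = s / (1 + c). *)
Lemma integral_rotation (c s : R) (f : T2 -> \bar R) :
  c ^+ 2 + s ^+ 2 = 1 -> 1 + c != 0 ->
  measurable_fun setT f -> (forall p, 0 <= f p)%E ->
  (\int[leb2]_p f (c * p.1 - s * p.2, s * p.1 + c * p.2)%R = \int[leb2]_p f p)%E.
Proof.
move=> cs1 c1 mf f0; pose t := s / (1 + c).
have mmul (k : R) : measurable_fun setT ((fun x => k * x) : T1 -> T1).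
  by apply: measurable_funM => //; exact: measurable_cst.
pose g p : \bar R := f (p.1 + - t * p.2, p.2).
have mg : measurable_fun setT g.
  apply: (measurableT_comp mf); apply: measurable_pairR; last exact: measurable_snd.
  apply: measurable_funD; first exact: measurable_fst.
  exact: measurableT_comp (mmul _) (measurable_snd).
pose h p : \bar R := g (p.1, p.2 + s * p.1).
have mh : measurable_fun setT h.
  apply: (measurableT_comp mg); apply: measurable_pairR; first exact: measurable_fst.
  apply: measurable_funD; first exact: measurable_snd.
  exact: measurableT_comp (mmul _) (measurable_fst).
rewrite -(integral_shear1 (mmul (- t)) mf f0).
rewrite -(integral_shear2 (mmul s) mg (fun p => f0 _)).
rewrite -(integral_shear1 (mmul (- t)) mh (fun p => f0 _)).
apply: eq_integral => -[x y] _; rewrite /h /g /=.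
have e1 : t * s = 1 - c.
  rewrite /t mulrAC -expr2; apply: (mulIf c1); rewrite divfK//.
  have -> : s ^+ 2 = 1 - c ^+ 2 by rewrite -cs1 addrC addKr.
  by ring.
have e2 : t * (1 + c) = s by rewrite /t divfK.
congr f; congr (_, _); last by rewrite -[c](subKr 1) -e1; ring.
have -> : x + - t * y + - t * (y + s * (x + - t * y)) =
  (1 - t * s) * x - t * (1 + (1 - t * s)) * y by ring.
by rewrite e1 subKr e2.
Qed.

End PlaneMeasure.

(** * The finite Fourier transform *)

Section RootsOfUnity.
Context {R : realType}.
Notation C := (Cplx R).
Implicit Types (z w : C).

(** Primitive roots of unity of order 2 ^ m are enough for averaging, and iterated
    square roots of -1 produce them. *)
Lemma exists_root_neg1 m : exists w : C, w ^+ (2 ^ m) = -1.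
Proof.
elim: m => [|m [w hw]]; first by exists (-1); rewrite expn0 expr1.
by exists (sqrtC w); rewrite expnS exprM sqrtCK.
Qed.

Lemma prim_root_neg1 m w : w ^+ (2 ^ m) = -1 -> (2 ^ m.+1).-primitive_root w.
Proof.
move=> hw.
have wN : w ^+ (2 ^ m.+1) = 1 by rewrite expnSr exprM hw sqrrN expr1n.
have N0 : (0 < 2 ^ m.+1)%N by rewrite expn_gt0.
have [d dprim ddvd] := prim_order_exists N0 wN.
have [k km dE] := dvdn_pfactor d m.+1 (isT : prime 2) ddvd.
have [<-|km'] := eqVneq k m.+1; first by rewrite -dE.
have : (d %| 2 ^ m)%N by rewrite dE dvdn_exp2l// -ltnS ltn_neqAle km' km.
rewrite (prim_order_dvd dprim) hw eq_sym -subr_eq0 opprK.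
by rewrite -(natrD _ 1 1) pnatr_eq0.
Qed.

Lemma cmod_prim_root N w : N.-primitive_root w -> cmod w = 1.
Proof.
move=> wp; have N0 := prim_order_gt0 wp.
have : cmod w ^+ N == 1 by rewrite -cmodX (prim_expr_order wp) cmod1.
by rewrite pexpr_eq1 ?cmod_ge0// => /eqP.
Qed.

Lemma sum_root_powers N w k l : N.-primitive_root w -> (k < N)%N -> (l < N)%N ->
  \sum_(j < N) (w ^+ j) ^+ k * ((w ^+ j) ^+ l)^* = (k == l)%:R * N%:R.
Proof.
move=> wp kN lN; pose x := w ^+ k * (w ^+ l)^*.
have wJ i : w ^+ i * (w ^+ i)^* = 1.
  by rewrite -sqr_cmodJ cmodX (cmod_prim_root wp) !expr1n.
have -> : \sum_(j < N) (w ^+ j) ^+ k * ((w ^+ j) ^+ l)^* = \sum_(j < N) x ^+ j.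
  by apply: eq_bigr => j _; rewrite !(exprAC w j) rmorphXn -exprMn.
have [kl|kl] := eqVneq k l.
  rewrite mul1r (eq_bigr (fun=> 1)); last by move=> j _; rewrite /x kl wJ expr1n.
  by rewrite sumr_const card_ord.
rewrite mul0r; apply/eqP.
have x1 : x - 1 != 0.
  rewrite subr_eq0; apply: contra_neq kl => x1.
  have /eqP : w ^+ k = w ^+ l.
    by rewrite -[LHS]mulr1 -(wJ l) mulrCA -/x x1 mulr1.
  by rewrite (eq_prim_root_expr wp) !modn_small// => /eqP.
have : (x - 1) * (\sum_(j < N) x ^+ j) = 0.
  rewrite -subrX1 /x exprMn -rmorphXn/= !(exprAC w _ N) (prim_expr_order wp).
  by rewrite !expr1n conjC1 mulr1 subrr.
by move/eqP; rewrite mulf_eq0 (negbTE x1).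
Qed.

(** Parseval's identity for the finite Fourier transform: q has at most N
    coefficients, so no two of them alias on the N-th roots of unity. *)
Lemma parseval N w (q : {poly C}) : N.-primitive_root w -> (size q <= N)%N ->
  \sum_(j < N) cmod q.[w ^+ j] ^+ 2 = N%:R * \sum_(k < N) cmod q`_k ^+ 2.
Proof.
move=> wp qN; apply: (@complexI R).
rewrite -[LHS]/(ofR _) -[RHS]/(ofR _) ofR_sum ofRM ofR_nat ofR_sum.
have -> : \sum_(j < N) ofR (cmod q.[w ^+ j] ^+ 2) =
  \sum_(j < N) \sum_(k < N) \sum_(l < N)
    (q`_k * (q`_l)^*) * ((w ^+ j) ^+ k * ((w ^+ j) ^+ l)^*).
  apply: eq_bigr => j _.
  rewrite sqr_cmodJ (horner_coef_wide _ qN) rmorph_sum mulr_suml.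
  apply: eq_bigr => k _; rewrite mulr_sumr; apply: eq_bigr => l _.
  by rewrite rmorphM /= mulrACA.
rewrite exchange_big /= mulr_sumr; apply: eq_bigr => k _.
rewrite exchange_big /=.
under eq_bigr => l _ do rewrite -mulr_sumr (sum_root_powers wp)//.
rewrite (bigD1 k)//= big1 ?addr0; last first.
  by move=> l lk; rewrite eq_sym val_eqE (negbTE lk) mul0r mulr0.
by rewrite eqxx mul1r -sqr_cmodJ mulrC.
Qed.

Lemma submean_poly N w (q : {poly C}) : N.-primitive_root w -> (size q <= N)%N ->
  N%:R * cmod q.[0] ^+ 2 <= \sum_(j < N) cmod q.[w ^+ j] ^+ 2.
Proof.
move=> wp qN; rewrite (parseval wp qN) ler_wpM2l//.
rewrite horner_coef0 (bigD1 (Ordinal (prim_order_gt0 wp)))//= lerDl.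
by apply: sumr_ge0 => k _; rewrite exprn_ge0 ?cmod_ge0.
Qed.

End RootsOfUnity.

(** * Integrals and complex measurability *)

(** No measurability is assumed: the integral of a nonnegative function is the
    supremum over the simple functions below it. This lets integrands built
    from f' and the Green function be compared directly. *)
Lemma le_integral_ge0 d (T : measurableType d) (R : realType)
  (mu : {measure set T -> \bar R}) (f g : T -> \bar R) :
  (forall x, 0 <= f x)%E -> (forall x, f x <= g x)%E ->
  (\int[mu]_x f x <= \int[mu]_x g x)%E.
Proof.
move=> f0 fg; rewrite !ge0_integralTE//; last by move=> x; exact: le_trans (fg x).
apply: le_ereal_sup => _ [h hf <-]; exists h => // x.
exact: le_trans (fg x).
Qed.

Section ComplexMeasurable.
Context d (T : measurableType d) {R : realType}.
Notation C := (Cplx R).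
Implicit Types (D : set T) (f g : T -> C).

Definition cmeasurable D f :=
  measurable_fun D (fun x => complex.Re (f x)) /\
  measurable_fun D (fun x => complex.Im (f x)).

Lemma cmeasurable_cst D (c : C) : cmeasurable D (fun=> c).
Proof. by split; exact: measurable_cst. Qed.

Lemma cmeasurableD D f g : cmeasurable D f -> cmeasurable D g ->
  cmeasurable D (fun x => f x + g x).
Proof.
move=> [f1 f2] [g1 g2]; split.
  by under eq_fun do rewrite ReD; exact: measurable_funD.
by under eq_fun do rewrite ImD; exact: measurable_funD.
Qed.

Lemma cmeasurableM D f g : cmeasurable D f -> cmeasurable D g ->
  cmeasurable D (fun x => f x * g x).
Proof.
move=> [f1 f2] [g1 g2]; split.
  under eq_fun do rewrite ReM.
  by apply: measurable_funB; exact: measurable_funM.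
under eq_fun do rewrite ImM.
by apply: measurable_funD; exact: measurable_funM.
Qed.

Lemma cmeasurable_horner D f (p : {poly C}) : cmeasurable D f ->
  cmeasurable D (fun x => p.[f x]).
Proof.
move=> mf; elim/poly_ind: p => [|p c ih].
  by under eq_fun do rewrite horner0; exact: cmeasurable_cst.
under eq_fun do rewrite hornerMXaddC.
by apply: cmeasurableD; [exact: cmeasurableM|exact: cmeasurable_cst].
Qed.

Lemma measurable_cmod_sqr D f : cmeasurable D f ->
  measurable_fun D (fun x => cmod (f x) ^+ 2).
Proof.
move=> [f1 f2]; under eq_fun do rewrite cmod_sqr.
by apply: measurable_funD; exact: measurable_funX.
Qed.

End ComplexMeasurable.

(** * The area sub-mean value property of polynomials *)

Section AreaSubmean.
Context {R : realType}.
Notation C := (Cplx R).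
Notation T1 := (measurableTypeR R).
Notation T2 := (measurableTypeR R * measurableTypeR R)%type.
Notation leb := (@lebesgue_measure R).
Notation leb2 := (leb \x leb)%E.

Lemma cmeasurable_of_xy : cmeasurable setT (fun p : T2 => of_xy p).
Proof. by split; [exact: measurable_fst|exact: measurable_snd]. Qed.

(** The centre is removed because [green z a] evaluates to 0 at z = a, where a
    lower bound is needed on a whole neighbourhood. *)
Definition punctured (r : R) : set T2 :=
  [set p | 0 < cmod (of_xy p : C) ^+ 2 < r ^+ 2].

Lemma measurable_punctured r : measurable (punctured r).
Proof.
have := measurable_cmod_sqr cmeasurable_of_xy.
move=> /(_ measurableT `]0, r ^+ 2[%classic (measurable_itv _)).
rewrite setTI; congr measurable; apply/seteqP; split => p /=;
  by rewrite /punctured /= in_itv.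
Qed.

Lemma puncturedE r p : \1_(punctured r) p = (0 < cmod (of_xy p : C) ^+ 2 < r ^+ 2)%R%:R :> R.
Proof.
rewrite indicE; congr ((nat_of_bool _)%:R).
by apply/idP/idP => [/set_mem //|h]; apply: mem_set.
Qed.

Lemma measurable_poly_punctured (q : {poly C}) r :
  measurable_fun setT (fun p : T2 => (cmod q.[of_xy p] ^+ 2 * \1_(punctured r) p)%:E).
Proof.
apply/measurable_EFinP; apply: measurable_funM.
  exact/measurable_cmod_sqr/cmeasurable_horner/cmeasurable_of_xy.
by apply: measurable_indic; exact: measurable_punctured.
Qed.

Lemma poly_punctured_ge0 (q : {poly C}) r (p : T2) :
  (0 <= (cmod q.[of_xy p] ^+ 2 * \1_(punctured r) p)%:E)%E.
Proof. by rewrite lee_fin mulr_ge0 ?exprn_ge0 ?cmod_ge0. Qed.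

Lemma integral_poly_rotation (w : C) (q : {poly C}) r :
  cmod w = 1 -> w != -1 ->
  (\int[leb2]_p (cmod q.[w * of_xy p] ^+ 2 * \1_(punctured r) p)%:E =
   \int[leb2]_p (cmod q.[of_xy p] ^+ 2 * \1_(punctured r) p)%:E)%E.
Proof.
move=> w1 wN1; pose c := complex.Re w; pose s := complex.Im w.
have cs : c ^+ 2 + s ^+ 2 = 1 by rewrite /c /s -cmod_sqr w1 expr1n.
have c1 : 1 + c != 0.
  apply: contra_neq wN1 => /eqP; rewrite addrC addr_eq0 => /eqP cE.
  move: cs; rewrite cE sqrrN expr1n -[RHS]addr0 => /addrI/eqP.
  rewrite sqrf_eq0 => /eqP sE.
  by apply/eqP; rewrite eq_complex -/c -/s cE sE /= oppr0 !eqxx.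
rewrite -[RHS](@integral_rotation _ c s
  (fun p : T2 => (cmod q.[of_xy p] ^+ 2 * \1_(punctured r) p)%:E))//.
- apply: eq_integral => p _.
  have E : of_xy (c * p.1 - s * p.2, s * p.1 + c * p.2) = w * of_xy p.
    rewrite /c /s; case: (w) => u v; rewrite /of_xy /=.
    by apply/eqP; rewrite eq_complex/= eqxx/= addrC.
  by rewrite !puncturedE !E cmodM w1 mul1r.
- exact: measurable_poly_punctured.
- exact: poly_punctured_ge0.
Qed.

Lemma integral_poly_rotationX (w : C) (q : {poly C}) r j :
  cmod w = 1 -> w != -1 ->
  (\int[leb2]_p (cmod q.[w ^+ j * of_xy p] ^+ 2 * \1_(punctured r) p)%:E =
   \int[leb2]_p (cmod q.[of_xy p] ^+ 2 * \1_(punctured r) p)%:E)%E.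
Proof.
move=> w1 wN1; elim: j => [|j <-].
  by apply: eq_integral => p _; rewrite expr0 mul1r.
pose q' := q \Po (w ^+ j *: 'X).
transitivity (\int[leb2]_p (cmod q'.[w * of_xy p] ^+ 2 * \1_(punctured r) p)%:E)%E.
  by apply: eq_integral => p _; rewrite /q' horner_comp hornerZ hornerX (exprSr w) mulrA.
rewrite integral_poly_rotation//; apply: eq_integral => p _.
by rewrite /q' horner_comp hornerZ hornerX.
Qed.

(** The average of |q|^2 over a group of rotations with more elements than the
    degree of q is, by Parseval, the sum of the squares of the terms of q, hence
    at least the square of the constant one; and the integral over the disc is
    invariant under each rotation. *)
Lemma submean_poly_area (q : {poly C}) r :
  ((cmod q.[0] ^+ 2)%:E * leb2 (punctured r) <=
   \int[leb2]_p (cmod q.[of_xy p] ^+ 2 * \1_(punctured r) p)%:E)%E.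
Proof.
pose m := (size q).+1; have [w hw] := exists_root_neg1 (R := R) m.
have wp := prim_root_neg1 hw; have w1 := cmod_prim_root wp.
have wN1 : w != -1.
  apply: contra_eq_neq hw => ->; rewrite /m expnS exprM sqrrN !expr1n.
  by rewrite -subr_eq0 opprK -(natrD _ 1 1) pnatr_eq0.
set N := (2 ^ m.+1)%N in wp.
have szN : ((size q).+2 < N)%N by rewrite /N /m ltn_expl.
have N0 : (0 < N%:R :> R) by rewrite ltr0n (prim_order_gt0 wp).
have NE : (0 < N%:R%:E :> \bar R)%E by rewrite lte_fin.
rewrite -(@lee_pmul2l _ N%:R%:E)//.
have -> : (N%:R%:E * \int[leb2]_p (cmod q.[of_xy p] ^+ 2 * \1_(punctured r) p)%:E)%E =
  (\int[leb2]_p (\sum_(j < N)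
   (cmod q.[w ^+ j * of_xy p] ^+ 2 * \1_(punctured r) p)%:E))%E.
  rewrite ge0_integral_sum//; last 2 first.
  - move=> j; pose q' := q \Po (w ^+ j *: 'X).
    rewrite [X in measurable_fun _ X](_ : _ = fun p : T2 =>
      (cmod q'.[of_xy p] ^+ 2 * \1_(punctured r) p)%:E).
      exact: measurable_poly_punctured.
    by apply/funext => p; rewrite /q' horner_comp hornerZ hornerX.
  - by move=> j p _; rewrite lee_fin mulr_ge0 ?exprn_ge0 ?cmod_ge0.
  under [RHS]eq_bigr do rewrite integral_poly_rotationX//.
  by rewrite sumr_const card_ord mule_natl.
rewrite muleA -EFinM.
have -> : ((N%:R * cmod q.[0] ^+ 2)%:E * leb2 (punctured r) =
  \int[leb2]_p (N%:R * cmod q.[0] ^+ 2 * \1_(punctured r) p)%:E)%E.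
  under eq_integral do rewrite EFinM.
  rewrite ge0_integralZl//; last 2 first.
  - by apply/measurable_EFinP; apply: measurable_indic; exact: measurable_punctured.
  - by rewrite lee_fin mulr_ge0// exprn_ge0 ?cmod_ge0.
  by rewrite integral_indic ?setIT//; exact: measurable_punctured.
apply: le_integral_ge0 => p; first by rewrite lee_fin mulr_ge0// mulr_ge0// exprn_ge0 ?cmod_ge0.
rewrite sumEFin lee_fin -mulr_suml ler_wpM2r//.
pose q' := q \Po (of_xy p *: 'X).
have q'N : (size q' <= N)%N.
  rewrite (leq_trans (size_comp_poly_leq _ _))//.
  have szX : ((size (of_xy p *: 'X : {poly C})).-1 <= 1)%N.
    by rewrite -subn1 leq_subLR (leq_trans (size_scale_leq _ _))// size_polyX.
  rewrite (leq_ltn_trans (leq_mul (leqnn _) szX))// muln1.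
  by move: szN; clear; lia.
have := submean_poly wp q'N.
rewrite {1}/q' horner_comp hornerZ hornerX mulr0 => /le_trans; apply.
by apply: ler_sum => j _; rewrite /q' horner_comp hornerZ hornerX mulrC.
Qed.

End AreaSubmean.

(** * Functions in Q_s are Bloch functions *)

Section Bloch.
Context {R : realType}.
Notation C := (Cplx R).
Notation T1 := (measurableTypeR R).
Notation T2 := (measurableTypeR R * measurableTypeR R)%type.
Notation leb := (@lebesgue_measure R).
Notation leb2 := (leb \x leb)%E.

Lemma leb_itvcc (x u : R) : x <= u -> leb `[x, u]%classic = (u - x)%:E.
Proof.
rewrite lebesgue_measure_itv/= lte_fin -EFinD le_eqVlt => /predU1P[->|->//].
by rewrite ltxx subrr.
Qed.

Lemma leb2_box (x y u v : R) : x <= u -> y <= v ->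
  leb2 (`[x, u]%classic `*` `[y, v]%classic) = ((u - x) * (v - y))%:E.
Proof.
move=> xu yv; rewrite product_measure1E; try exact: measurable_itv.
by rewrite EFinM /= !leb_itvcc.
Qed.

Lemma punctured_xy (r x y : R) : punctured r (x, y) = (0 < x ^+ 2 + y ^+ 2 < r ^+ 2) :> Prop.
Proof. by rewrite /punctured /mkset cmod_sqr. Qed.

Lemma leb2_punctured_bounds (r : R) : 0 < r ->
  exists2 l : R, leb2 (punctured r) = l%:E & r ^+ 2 / 4 <= l.
Proof.
move=> r0.
have lb : ((r ^+ 2 / 4)%:E <= leb2 (punctured r))%E.
  apply: (@le_trans _ _ (leb2 (`]0, (r / 2)]%classic `*` `]0, (r / 2)]%classic))).
    rewrite product_measure1E; try exact: measurable_itv.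
    rewrite /= lebesgue_measure_itv/= lte_fin divr_gt0// -EFinD -EFinM lee_fin subr0.
    by rewrite expr2 -mulrACA; apply: eq_ler; field.
  apply: le_measure; rewrite ?inE.
  - by apply: measurableX; exact: measurable_itv.
  - exact: measurable_punctured.
  move=> [x y] /= []; rewrite !in_itv/= => /andP[x0 x1] /andP[y0 y1].
  rewrite punctured_xy; apply/andP; split.
    by rewrite addr_gt0// exprn_gt0.
  have : x ^+ 2 <= (r / 2) ^+ 2 by rewrite lerXn2r// nnegrE ltW// divr_gt0.
  have : y ^+ 2 <= (r / 2) ^+ 2 by rewrite lerXn2r// nnegrE ltW// divr_gt0.
  have : 0 < r ^+ 2 by rewrite exprn_gt0.
  rewrite expr_div_n; lra.
have ub : (leb2 (punctured r) <= ((r - - r) * (r - - r))%:E)%E.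
  have rr : - r <= r by lra.
  rewrite -(leb2_box rr rr).
  apply: le_measure; rewrite ?inE.
  - exact: measurable_punctured.
  - by apply: measurableX; exact: measurable_itv.
  move=> [x y]; rewrite punctured_xy => /andP[_ h] /=.
  rewrite !in_itv/=; split; rewrite -ler_norml -(ler_pXn2r (n:=2)) ?nnegrE ?(ltW r0)//;
    rewrite real_normK ?num_real//.
    by rewrite (le_trans _ (ltW h))// lerDl sqr_ge0.
  by rewrite (le_trans _ (ltW h))// lerDr sqr_ge0.
have fin : leb2 (punctured r) \is a fin_num.
  by rewrite ge0_fin_numE ?measure_ge0// (le_lt_trans ub)// ltry.
exists (fine (leb2 (punctured r))); first by rewrite fineK.
by rewrite -lee_fin fineK.
Qed.

Lemma ln4_ge1 : 1 <= ln (4 : R).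
Proof.
have h : ln (2^-1 : R) <= - 2^-1.
  have E : (2^-1 : R) = 1 + - 2^-1 by field.
  rewrite {1}E; apply: le_ln1Dx; lra.
move: h; rewrite lnV ?posrE// lerN2 => h.
have -> : (4 : R) = 2 * 2 by rewrite -natrM.
rewrite lnM ?posrE//; lra.
Qed.

Lemma green_ge1 (a z : C) : disc a -> disc z -> z != a ->
  cmod (z - a) <= (1 - cmod a) / 4 -> 1 <= green z a.
Proof.
move=> /discE a1 /discE z1 za zar; rewrite /green (le_trans ln4_ge1)//.
have d0 : 0 < cmod (z - a) by rewrite cmod_gt0 subr_eq0.
have num : 1 - cmod a <= cmod (1 - a^* * z).
  apply: le_trans (cmod_triB _ _); rewrite cmod1 lerD2l lerN2 cmodM cmodJ.
  by rewrite ler_piMr ?cmod_ge0// ltW.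
have n4 : 4 <= cmod ((1 - a^* * z) / (z - a)).
  rewrite cmodM cmodV ler_pdivlMr//; lra.
by rewrite ler_ln ?posrE//; lra.
Qed.

Lemma sqr_le_2 (x y e : R) : 0 <= x -> x <= y + e -> x ^+ 2 <= 2 * y ^+ 2 + 2 * e ^+ 2.
Proof.
move=> x0 xy; have : 0 <= (y - e) ^+ 2 by exact: sqr_ge0.
have : x ^+ 2 <= (y + e) ^+ 2 by rewrite lerXn2r ?nnegrE// (le_trans x0).
rewrite sqrrB sqrrD; lra.
Qed.

Lemma of_xy_shift (p : T2) (a : C) :
  of_xy (p.1 + - complex.Re a, p.2 + - complex.Im a) = of_xy p - a :> C.
Proof. by case: a. Qed.

(** On a small disc around a the Green function is at least log 4 >= 1, so the
    integral of |f'|^2 against its power dominates the area integral of |f'|^2,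
    to which the sub-mean value property of an approximating polynomial applies.
    The error e of the approximation is removed in [Qs_integral_ge]. *)
Lemma sub_mean_derive1 (s : R) (f : C -> C) (c : nat -> C) (a : C) (Jr l e : R) :
  0 < s -> sum_on_disc f c -> disc a ->
  (\int[leb2]_(p in [set p : T2 | disc (of_xy p : C)])
     (cmod (derive1 f (of_xy p)) ^+ 2 * (green (of_xy p) a `^ s))%:E = Jr%:E)%E ->
  leb2 (punctured ((1 - cmod a) / 4)) = l%:E -> 0 < e ->
  cmod (derive1 f a) ^+ 2 * l <= 4 * Jr + 6 * e ^+ 2 * l.
Proof.
move=> s0 /sum_on_disc_derive1 [hc hf] da JE lE e0.
have a1 : cmod a < 1 by apply/discE.
have a0 := cmod_ge0 a.
set r := (1 - cmod a) / 4 in lE *; have r0 : 0 < r by rewrite /r; lra.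
pose rho := cmod a + r.
have rho01 : 0 <= rho < 1 by rewrite /rho /r; apply/andP; split; lra.
have [n _ /(_ n (leqnn n)) hn] := psum_approx hc rho01 e0.
pose P := \poly_(k < n) (dcoef c k).
have PE z : P.[z] = series (fun k => dcoef c k * z ^+ k) n.
  by rewrite horner_poly /series/= big_mkord.
have hP z : cmod z <= rho -> cmod (derive1 f z - P.[z]) <= e.
  move=> zr; rewrite PE hf ?hn//; apply/discE.
  by apply: le_lt_trans zr _; case/andP: rho01.
pose q := P \Po ('X + a%:P).
have qE z : q.[z] = P.[z + a] by rewrite horner_comp hornerD hornerX hornerC.
pose E := @punctured R r.
(* If |q| <= |f'| + e then |f'|^2 >= |q|^2 / 2 - e^2; the maximum with 0 keeps
   the minorant nonnegative. *)
pose G (p : T2) := (Num.max (cmod q.[of_xy p] ^+ 2 / 2 - e ^+ 2) 0 * \1_E p)%:E.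
have mE : measurable E by exact: measurable_punctured.
have G0 p : (0 <= G p)%E by rewrite lee_fin mulr_ge0// le_max lexx orbT.
have mG : measurable_fun setT G.
  apply/measurable_EFinP; apply: measurable_funM; last exact: measurable_indic.
  apply: measurable_maxr; last exact: measurable_cst.
  apply: measurable_funB; last exact: measurable_cst.
  apply: measurable_funM; last exact: measurable_cst.
  exact/measurable_cmod_sqr/cmeasurable_horner/cmeasurable_of_xy.
have intG : (\int[leb2]_p G p <= Jr%:E)%E.
  rewrite -JE [leRHS]integral_mkcond -(integral_shift2 (- complex.Re a) (- complex.Im a) mG G0).
  apply: le_integral_ge0 => // p; rewrite patchE.
  rewrite /G puncturedE of_xy_shift.
  case: ifPn => [|/negP pd]; last first.
    case: ltP => [|_]; rewrite ?mulr0// => za0; case: ltP => [|_]; rewrite ?mulr0// => zar.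
    exfalso; apply: pd; rewrite inE /=; apply/discE.
    have zr : cmod (of_xy p - a) < r by rewrite -(ltr_pXn2r (n:=2)) ?nnegrE ?cmod_ge0// ltW.
    have := cmod_triB (of_xy p) a; move: zr; rewrite /r; lra.
  rewrite inE /= => pd; rewrite lee_fin.
  have N0 : 0 <= cmod (derive1 f (of_xy p)) ^+ 2 * green (of_xy p) a `^ s.
    by rewrite mulr_ge0 ?powR_ge0// exprn_ge0 ?cmod_ge0.
  case: ltP => [|_]; rewrite ?mulr0// => za0; case: ltP => [|_]; rewrite ?mulr0// => zar.
  rewrite mulr1 ge_max; apply/andP; split => //.
  have zr : cmod (of_xy p - a) < r by rewrite -(ltr_pXn2r (n:=2)) ?nnegrE ?cmod_ge0// ltW.
  have zN : of_xy p != a.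
    by apply: contraTneq za0 => ->; rewrite subrr cmod0 expr0n ltxx.
  have g1 : 1 <= green (of_xy p) a `^ s.
    have := green_ge1 da pd zN (ltW zr) => g1.
    by rewrite -(powRr0 (green (of_xy p) a)) ler_powR// ltW.
  apply: (@le_trans _ _ (cmod (derive1 f (of_xy p)) ^+ 2)); last first.
    by rewrite ler_peMr// exprn_ge0 ?cmod_ge0.
  rewrite qE subrK.
  have prho : cmod (of_xy p) <= rho.
    have := cmod_triB (of_xy p) a; rewrite /rho; lra.
  have h1 : cmod P.[of_xy p] <= cmod (derive1 f (of_xy p)) + e.
    have := cmod_triB P.[of_xy p] (derive1 f (of_xy p)).
    rewrite cmodBC; have := hP _ prho; lra.
  have := sqr_le_2 (cmod_ge0 _) h1; lra.
have := submean_poly_area q r; rewrite lE -EFinM => /le_trans.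
have h2 : (\int[leb2]_p (cmod q.[of_xy p] ^+ 2 * \1_E p)%:E <=
    \int[leb2]_p (2%:E * G p + (2 * e ^+ 2)%:E * (\1_E p)%:E))%E.
  apply: le_integral_ge0 => p; first exact: poly_punctured_ge0.
  rewrite /G -!EFinM -EFinD lee_fin mulrA -mulrDl ler_wpM2r//.
  have : cmod q.[of_xy p] ^+ 2 / 2 - e ^+ 2 <=
    Num.max (cmod q.[of_xy p] ^+ 2 / 2 - e ^+ 2) 0 by rewrite le_max lexx.
  lra.
move=> /(_ _ h2).
rewrite ge0_integralD//; last 4 first.
- by move=> p _; rewrite mule_ge0.
- exact: measurable_funeM.
- by move=> p _; rewrite -EFinM lee_fin mulr_ge0// mulr_ge0// sqr_ge0.
- by apply: measurable_funeM; apply/measurable_EFinP; exact: measurable_indic.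
rewrite ge0_integralZl// ge0_integralZl//; last 2 first.
- by apply/measurable_EFinP; exact: measurable_indic.
- by rewrite lee_fin mulr_ge0// sqr_ge0.
have -> : (\int[leb2]_p (\1_E p)%:E = l%:E)%E.
  by rewrite integral_indic// setIT; exact: lE.
have h3 : (2%:E * \int[leb2]_p G p <= (2 * Jr)%:E)%E by rewrite EFinM lee_pmul2l.
rewrite -EFinM => /le_trans /(_ (leeD2r _ h3)).
rewrite -EFinD lee_fin qE add0r => h4.
have arho : cmod a <= rho by rewrite lerDl ltW.
have h1 : cmod (derive1 f a) <= cmod P.[a] + e.
  have := cmod_triB (derive1 f a) P.[a]; have := hP _ arho; lra.
have l0 : 0 <= l by rewrite -lee_fin -lE measure_ge0.
have := ler_wpM2r l0 (sqr_le_2 (cmod_ge0 _) h1).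
move: h4; rewrite -!mulrA; lra.
Qed.

(** The constant collects the factor 4 of [sub_mean_derive1] and the area bound
    r ^ 2 / 4 for the disc of radius r = (1 - |a|) / 4. *)
Lemma Qs_integral_ge (s : R) (f : C -> C) (c : nat -> C) (a : C) :
  0 < s -> sum_on_disc f c -> disc a ->
  ((256 * pi)^-1%:E * ((cmod (derive1 f a) * (1 - cmod a)) ^+ 2)%:E <= Qs_integral s f a)%E.
Proof.
move=> s0 hf da; rewrite /Qs_integral; set J := (\int[_]_(_ in _) _)%E.
have a1 : cmod a < 1 by apply/discE.
have p0 : 0 < (pi : R) by exact: pi_gt0.
have J0 : (0 <= J)%E.
  apply: integral_ge0 => p _.
  by rewrite lee_fin mulr_ge0 ?powR_ge0// exprn_ge0 ?cmod_ge0.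
have [Jfin|] := boolP (J \is a fin_num); last first.
  rewrite ge0_fin_numE// -leNgt leye_eq => /eqP ->.
  by rewrite gt0_muley ?leey// lte_fin invr_gt0.
have JE : J = (fine J)%:E by rewrite fineK.
set Jr := fine J in JE.
have r0 : 0 < (1 - cmod a) / 4 by lra.
have [l lE ll] := leb2_punctured_bounds r0.
have l0 : 0 < l by apply: lt_le_trans ll; rewrite divr_gt0// exprn_gt0.
have h : cmod (derive1 f a) ^+ 2 * l <= 4 * Jr.
  apply/ler_addgt0Pr => d d0.
  pose e := Num.sqrt (d / (6 * l)).
  have e0 : 0 < e by rewrite sqrtr_gt0 divr_gt0// mulr_gt0.
  apply: le_trans (sub_mean_derive1 s0 hf da JE lE e0) _.
  rewrite lerD2l sqr_sqrtr; last by rewrite ltW// divr_gt0// mulr_gt0.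
  by apply: eq_ler; field; rewrite gt_eqF.
have h' : cmod (derive1 f a) ^+ 2 * (((1 - cmod a) / 4) ^+ 2 / 4) <= 4 * Jr.
  by apply: le_trans h; rewrite ler_wpM2l// exprn_ge0 ?cmod_ge0.
rewrite JE -!EFinM lee_fin invfM mulrC mulrA mulrC ler_pM2l ?invr_gt0//.
rewrite ler_pdivrMr; last by rewrite ltr0n.
rewrite mulrC exprMn; move: h'.
rewrite expr_div_n; lra.
Qed.

Lemma Qs_integral_ge0 (s : R) (f : C -> C) (a : C) : (0 <= Qs_integral s f a)%E.
Proof.
rewrite /Qs_integral mule_ge0// ?lee_fin ?invr_ge0 ?pi_ge0//.
apply: integral_ge0 => p _.
by rewrite lee_fin mulr_ge0 ?powR_ge0// exprn_ge0 ?cmod_ge0.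
Qed.

Lemma Qs_integral_le_seminorm (s : R) (f : C -> C) (a : C) : Qs s f -> disc a ->
  (Qs_integral s f a <= (Qs_seminorm s f ^+ 2)%:E)%E.
Proof.
move=> [_ hs] da.
have h : (Qs_integral s f a <= Qs_sup s f)%E.
  by apply: ereal_sup_ubound; exists a.
have S0 : (0 <= Qs_sup s f)%E by apply: le_trans h; exact: Qs_integral_ge0.
rewrite /Qs_seminorm sqr_sqrtr; last exact: fine_ge0.
by rewrite fineK// ge0_fin_numE.
Qed.

(** The square root of the constant 256 pi of [Qs_integral_ge]. *)
Definition bloch_const : R := 16 * Num.sqrt pi.

Lemma Qs_bloch (s : R) (f : C -> C) (a : C) : 0 < s -> Qs s f -> disc a ->
  cmod (derive1 f a) * (1 - cmod a) <= bloch_const * Qs_seminorm s f.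
Proof.
move=> s0 qf da; have [fa _] := qf; have [c hc] := analytic_sum_on_disc fa.
have h := le_trans (Qs_integral_ge s0 hc da) (Qs_integral_le_seminorm qf da).
have a1 : cmod a < 1 by apply/discE.
rewrite -(ler_pXn2r (n:=2)) ?nnegrE//; last 2 first.
- by rewrite mulr_ge0 ?cmod_ge0// subr_ge0 ltW.
- by rewrite mulr_ge0 ?sqrtr_ge0// mulr_ge0// sqrtr_ge0.
rewrite [leRHS]exprMn /bloch_const [X in _ <= X * _]exprMn sqr_sqrtr ?pi_ge0//.
move: h; rewrite -EFinM lee_fin mulrC ler_pdivrMr; last by rewrite mulr_gt0// pi_gt0.
by rewrite [leRHS]mulrC -natrX.
Qed.

End Bloch.

(** * Power bounds for the Green function *)

Section GreenBound.
Context {R : realType}.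
Notation C := (Cplx R).
Implicit Types (a z : C) (s q t : R).

(** Hence |(1 - conj(a) z) / (z - a)|^2 = 1 + X for
    X = (1 - |a|^2) (1 - |z|^2) / |z - a|^2, and the Green function is
    log(1 + X) / 2, which is small where X is. *)
Lemma cmod_mobius a z : cmod (1 - a^* * z) ^+ 2 =
  cmod (z - a) ^+ 2 + (1 - cmod a ^+ 2) * (1 - cmod z ^+ 2).
Proof.
apply: (@complexI R).
rewrite -[LHS]/(ofR _) -[RHS]/(ofR _) (ofRD (_ ^+ 2)) (ofRM (1 - _)) !(ofRB 1) !sqr_cmodJ.
rewrite !rmorphB !rmorphM /= conjCK conjC1 ofR1; ring.
Qed.

Lemma ln1D_le_powR t (p : R) : 0 <= t -> 0 < p <= 1 -> ln (1 + t) <= 2 / p * t `^ p.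
Proof.
move=> t0 /andP[p0 p1].
have pV : 1 <= 2 / p by rewrite ler_pdivlMr// mul1r; lra.
have tp0 : 0 <= t `^ p by exact: powR_ge0.
have [t1|t1] := leP t 1.
  have h1 : ln (1 + t) <= t by apply: le_ln1Dx; lra.
  have h2 : t <= t `^ p.
    move: t0; rewrite le_eqVlt => /predU1P[<-|t0]; first exact: powR_ge0.
    by apply: ger1_powR => //; rewrite t0.
  have h3 : t `^ p <= 2 / p * t `^ p.
    by rewrite ler_peMl.
  lra.
have t2 : 0 < 2 * t by lra.
have h1 : ln (1 + t) <= ln (2 * t) by rewrite ler_ln ?posrE//; lra.
have h2 : ln (2 * t) = p^-1 * ln ((2 * t) `^ p).
  by rewrite ln_powR mulrA mulVf ?mul1r// gt_eqF.
have h3 : ln ((2 * t) `^ p) <= (2 * t) `^ p.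
  by apply: ltW; apply: ln_sublinear; exact: powR_gt0.
have h4 : (2 * t) `^ p <= 2 * t `^ p.
  rewrite powRM//.
  by rewrite ler_wpM2r// ler1_powR// ler1n.
rewrite h2 in h1; apply: le_trans h1 _.
rewrite [2 / p]mulrC -mulrA ler_pM2l ?invr_gt0//; lra.
Qed.

Lemma green_le a z : disc a -> disc z -> z != a ->
  0 <= green z a <= ln (1 + 4 * (cmod (1 - a) * cmod (1 - z) / cmod (z - a) ^+ 2)) / 2.
Proof.
move=> /discE a1 /discE z1 za.
have k0 : 0 < cmod (z - a) by rewrite cmod_gt0 subr_eq0.
pose X := (1 - cmod a ^+ 2) * (1 - cmod z ^+ 2) / cmod (z - a) ^+ 2.
have bd (u : C) : cmod u < 1 -> 0 <= 1 - cmod u ^+ 2 <= 2 * cmod (1 - u).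
  move=> u1; have u0 := cmod_ge0 u.
  have := cmod_triB 1 u; rewrite cmod1 => h.
  have e : 1 - cmod u ^+ 2 = (1 - cmod u) * (1 + cmod u) by ring.
  rewrite e; apply/andP; split; first by rewrite mulr_ge0//; lra.
  have : (1 - cmod u) * (1 + cmod u) <= (1 - cmod u) * 2 by rewrite ler_wpM2l//; lra.
  lra.
have /andP[a20 a2] := bd _ a1; have /andP[z20 z2] := bd _ z1.
have X0 : 0 <= X by rewrite divr_ge0 ?exprn_ge0 ?cmod_ge0// mulr_ge0.
have E : cmod ((1 - a^* * z) / (z - a)) ^+ 2 = 1 + X.
  rewrite cmodM cmodV exprMn cmod_mobius /X; field.
  by rewrite gt_eqF.
have XE : X <= 4 * (cmod (1 - a) * cmod (1 - z) / cmod (z - a) ^+ 2).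
  rewrite /X !mulrA ler_pM2r ?invr_gt0 ?exprn_gt0//.
  have -> : 4 * cmod (1 - a) * cmod (1 - z) = (2 * cmod (1 - a)) * (2 * cmod (1 - z)) by ring.
  by apply: ler_pM.
have ratio1 : 1 <= cmod ((1 - a^* * z) / (z - a)).
  rewrite -(ler_pXn2r (n:=2)) ?nnegrE ?cmod_ge0// E expr1n; lra.
rewrite /green ln_ge0//=.
have -> : ln (cmod ((1 - a^* * z) / (z - a))) = ln (1 + X) / 2.
  rewrite -E lnXn; last by lra.
  by rewrite -mulr_natr; field.
by rewrite ler_pM2r ?invr_gt0// ler_ln ?posrE//; lra.
Qed.

(** The inequality log(1 + t) <= C t^p, for p in (0, 1], trades the logarithmic
    singularity and the power s for one power q of X. With q <= 1/2 the
    singularity |z - a|^(-2 q) is integrable over the plane. *)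
Lemma green_powR_le s : 0 < s -> exists q (M : R), [/\ 0 < q <= 2^-1, 0 <= M &
  forall a z, disc a -> disc z -> green z a `^ s <=
    M * (cmod (1 - a) * cmod (1 - z) / cmod (z - a) ^+ 2) `^ q].
Proof.
move=> s0; pose q := Num.min s 2^-1.
have q0 : 0 < q by rewrite lt_min s0 invr_gt0 ltr0n.
have qs : q <= s by rewrite ge_min lexx.
pose p := q / s.
have p01 : 0 < p <= 1 by rewrite divr_gt0//= ler_pdivrMr// mul1r.
exists q, ((2 / p / 2) `^ s * 4 `^ q); split.
- by rewrite q0/= ge_min lexx orbT.
- by rewrite mulr_ge0 ?powR_ge0.
move=> a z da dz; have [->|za] := eqVneq z a.
  rewrite {1}/green subrr invr0 mulr0 cmod0 ln0// powR0 ?gt_eqF//.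
  by rewrite mulr_ge0 ?powR_ge0// mulr_ge0 ?powR_ge0.
set Y := cmod (1 - a) * _ / _.
have Y0 : 0 <= Y by rewrite /Y divr_ge0 ?exprn_ge0 ?cmod_ge0// mulr_ge0 ?cmod_ge0.
have /andP[g0 g1] := green_le da dz za.
have Y40 : 0 <= 4 * Y by rewrite mulr_ge0.
have h := ln1D_le_powR Y40 p01.
have g2 : green z a <= 2 / p / 2 * (4 * Y) `^ p.
  rewrite (le_trans g1)// -/Y mulrAC ler_pM2r ?invr_gt0//.
have p0 : 0 < p by case/andP: p01.
have c0 : 0 <= 2 / p / 2 by apply: divr_ge0 => //; apply: divr_ge0 => //; exact: ltW.
have Yp0 : 0 <= (4 * Y) `^ p by exact: powR_ge0.
apply: (@le_trans _ _ ((2 / p / 2 * (4 * Y) `^ p) `^ s)).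
  by apply: ge0_ler_powR => //; rewrite ?nnegrE ?(ltW s0)// mulr_ge0.
rewrite (powRM _ c0 Yp0) -powRrM.
have -> : p * s = q by rewrite /p divfK ?gt_eqF.
by rewrite (powRM _ _ Y0)// mulrA.
Qed.

End GreenBound.

(** * A homogeneous profile on dyadic shells *)

Section Dyadic.
Context {R : realType}.
Implicit Types (h k q x y : R).

Lemma half_exp_lt h : 0 < h -> exists n, (2^-1 : R) ^+ n < h.
Proof.
move=> h0.
have : geometric 1 (2^-1 : R) @ \oo --> 0.
  by apply: cvg_geometric; rewrite ger0_norm ?invr_ge0// invf_lt1// ltr1n.
move=> /cvgrPdist_lt /(_ _ h0) [n _ /(_ n (leqnn n))] /=.
rewrite sub0r normrN mul1r ger0_norm ?exprn_ge0 ?invr_ge0// => hn.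
by exists n.
Qed.

Lemma dyadic_small h : 0 < h <= 1 ->
  exists j, (2^-1 : R) ^+ j.+1 < h <= 2^-1 ^+ j.
Proof.
move=> /andP[/half_exp_lt ex h1].
have [[|j] hj jmin] := ex_minnP ex; first by rewrite expr0 ltNge h1 in hj.
exists j; rewrite hj/= leNgt; apply/negP => /jmin; by rewrite ltnn.
Qed.

Lemma dyadic_large h : 1 < h -> exists j, (2 : R) ^+ j < h <= 2 ^+ j.+1.
Proof.
move=> h1; have h0 : 0 < h by apply: lt_trans h1.
have ex : exists n, h <= (2 : R) ^+ n.
  have := half_exp_lt (h := h^-1); rewrite invr_gt0 => /(_ h0)[n].
  by rewrite exprVn ltf_pV2 ?posrE ?exprn_gt0// => /ltW; exists n.
have [[|j] hj jmin] := ex_minnP ex; first by move: hj; rewrite expr0 leNgt h1.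
by exists j; rewrite hj andbT ltNge; apply/negP => /jmin; rewrite ltnn.
Qed.

Lemma powRX (u q : R) j : 0 <= u -> (u ^+ j) `^ q = (u `^ q) ^+ j.
Proof.
by move=> u0; rewrite -(powR_mulrn j u0) powRAC (powR_mulrn j (powR_ge0 u q)).
Qed.

Lemma powR_inv (u q : R) : 0 <= u -> u^-1 `^ q = (u `^ q)^-1.
Proof. by move=> u0; rewrite -(powR_inv1 u0) -powRrM mulN1r powRN. Qed.

Lemma four_powE j : (4 : R) ^+ j = (2 ^+ j) ^+ 2.
Proof. by rewrite -exprM mulnC exprM; congr (_ ^+ _); rewrite -natrX. Qed.

Section Profile.
Variables (q : R).
Hypothesis q01 : 0 < q <= 2^-1.
Let x : R := (2^-1) `^ q.
Let y : R := (3^-1) `^ q.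

(** The majorant of the integrand of the Q_s norm in the scaled variables
    h = |1 - z| / |1 - a| and k = |z - a| / |1 - a|. *)
Definition profile h k := h `^ q / h ^+ 2 / (k `^ q) ^+ 2.

Let q0 : 0 <= q. Proof. by case/andP: q01 => /ltW. Qed.
Let x0 : 0 < x. Proof. exact: powR_gt0. Qed.
Let y0 : 0 < y. Proof. exact: powR_gt0. Qed.

Lemma profile_ratio_lt1 : x < 1.
Proof.
have : (2^-1 : R) `^ q < 1 `^ q.
  apply: gt0_ltr_powR; rewrite ?nnegrE ?invr_ge0//; first by case/andP: q01.
  by rewrite invf_lt1// ltr1n.
by rewrite powR1.
Qed.

Lemma profile_ratio_sqr : 2^-1 <= x ^+ 2.
Proof.
rewrite /x -powR_mulrn ?powR_ge0// -powRrM -{1}[2^-1](powRr1 (a := 2^-1))//.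
have /ger_powR : 0 < (2^-1 : R) <= 1 by rewrite invr_gt0 invf_le1 ?ler1n ltr0n.
apply; case/andP: q01 => _ h; lra.
Qed.

Let half_powR j : ((2^-1 : R) ^+ j) `^ q = x ^+ j.
Proof. by rewrite powRX ?invr_ge0. Qed.

Let le_powR h k : 0 <= h -> h <= k -> h `^ q <= k `^ q.
Proof. by move=> h0 hk; apply: ge0_ler_powR => //; rewrite nnegrE// (le_trans h0). Qed.

Lemma profile_small h k j : (2^-1 : R) ^+ j.+1 < h <= 2^-1 ^+ j -> 2^-1 <= k ->
  profile h k <= 4 * 4 ^+ j * x ^+ j / x ^+ 2.
Proof.
move=> /andP[hl hu] kl.
have h0 : 0 < h by apply: lt_trans hl; rewrite exprn_gt0.
have e1 : h `^ q <= x ^+ j by rewrite -half_powR le_powR// ltW.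
have e2 : (h ^+ 2)^-1 <= 4 * 4 ^+ j.
  rewrite -[leRHS]invrK lef_pV2 ?posrE ?invr_gt0 ?exprn_gt0 ?mulr_gt0 ?exprn_gt0//.
  apply: (@le_trans _ _ ((2^-1 ^+ j.+1) ^+ 2)).
    by rewrite !exprVn -four_powE exprS.
  by rewrite lerXn2r ?nnegrE ?exprn_ge0 ?invr_ge0// ltW.
have e3 : ((k `^ q) ^+ 2)^-1 <= (x ^+ 2)^-1.
  rewrite lef_pV2 ?posrE ?exprn_gt0 ?powR_gt0 ?(lt_le_trans _ kl)//.
  by rewrite lerXn2r ?nnegrE ?powR_ge0// le_powR// invr_ge0.
rewrite /profile; apply: ler_pM => //.
- by rewrite mulr_ge0 ?powR_ge0// invr_ge0 exprn_ge0// ltW.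
- by rewrite invr_ge0 exprn_ge0 ?powR_ge0.
rewrite mulrC; apply: ler_pM => //; last exact: powR_ge0.
by rewrite invr_ge0 exprn_ge0// ltW.
Qed.

Lemma profile_large h k j : (2 : R) ^+ j < h <= 2 ^+ j.+1 -> h / 3 <= k ->
  profile h k <= x ^+ j / 4 ^+ j / y ^+ 2.
Proof.
move=> /andP[hl hu] kl.
have h0 : 0 < h by apply: lt_trans hl; rewrite exprn_gt0.
have h30 : 0 < h / 3 by rewrite divr_gt0.
have hq0 : 0 < h `^ q by exact: powR_gt0.
have e3 : ((k `^ q) ^+ 2)^-1 <= ((h `^ q) ^+ 2 * y ^+ 2)^-1.
  rewrite lef_pV2 ?posrE ?mulr_gt0 ?exprn_gt0 ?powR_gt0 ?(lt_le_trans _ kl)//.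
  rewrite -exprMn /y -powRM ?invr_ge0 ?(ltW h0)//.
  by rewrite lerXn2r ?nnegrE ?powR_ge0// le_powR// ltW.
have e1 : (h `^ q)^-1 <= x ^+ j.
  rewrite -[leRHS]invrK lef_pV2 ?posrE ?invr_gt0 ?exprn_gt0//.
  rewrite -half_powR exprVn powR_inv ?exprn_ge0// invrK.
  by rewrite le_powR ?exprn_ge0// ltW.
have e2 : (h ^+ 2)^-1 <= (4 ^+ j)^-1.
  rewrite lef_pV2 ?posrE ?exprn_gt0//.
  by rewrite four_powE lerXn2r ?nnegrE ?exprn_ge0// ltW.
apply: (@le_trans _ _ (h `^ q / h ^+ 2 / ((h `^ q) ^+ 2 * y ^+ 2))).
  by rewrite /profile ler_wpM2l// divr_ge0 ?powR_ge0// exprn_ge0// ltW.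
have -> : h `^ q / h ^+ 2 / ((h `^ q) ^+ 2 * y ^+ 2) =
   (h `^ q)^-1 * (h ^+ 2)^-1 / y ^+ 2.
  by field; rewrite !gt_eqF.
rewrite ler_wpM2r ?invr_ge0 ?exprn_ge0 ?(ltW y0)//.
by apply: ler_pM; rewrite ?invr_ge0 ?exprn_ge0// ltW.
Qed.

Lemma profile_near h k j : (2^-1 : R) ^+ j.+1 < k <= 2^-1 ^+ j -> 2^-1 <= h <= 2 ->
  profile h k <= 8 / (x ^+ 2) ^+ j.+1.
Proof.
move=> /andP[kl ku] /andP[hl hu].
have k0 : 0 < k by apply: lt_trans kl; rewrite exprn_gt0.
have h0 : 0 < h by apply: lt_le_trans hl.
have e1 : h `^ q <= 2.
  have : h `^ q <= 2 `^ q by rewrite le_powR// ltW.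
  have : (2 : R) `^ q <= 2 `^ 1.
    by rewrite ler_powR ?ler1n//; case/andP: q01 => _ hq; lra.
  by rewrite powRr1//; lra.
have e2 : (h ^+ 2)^-1 <= 4.
  rewrite -[leRHS]invrK lef_pV2 ?posrE ?invr_gt0 ?exprn_gt0//.
  have -> : (4 : R)^-1 = 2^-1 ^+ 2 by field.
  by rewrite lerXn2r ?nnegrE ?invr_ge0// ltW.
have e3 : ((k `^ q) ^+ 2)^-1 <= ((x ^+ 2) ^+ j.+1)^-1.
  rewrite lef_pV2 ?posrE ?exprn_gt0 ?powR_gt0//.
  rewrite -exprM mulnC exprM -half_powR.
  by rewrite lerXn2r ?nnegrE ?powR_ge0// le_powR ?exprn_ge0 ?invr_ge0// ltW.
rewrite /profile; apply: ler_pM => //.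
- by rewrite mulr_ge0 ?powR_ge0// invr_ge0 exprn_ge0// ltW.
- by rewrite invr_ge0 exprn_ge0 ?powR_ge0.
have -> : (8 : R) = 2 * 4 by rewrite -natrM.
by apply: ler_pM; rewrite ?powR_ge0 ?invr_ge0 ?exprn_ge0// ltW.
Qed.

(** By the triangle inequality among 1, a and z, the point z is near 1, near a,
    or far from both, and in each case lies in one dyadic shell, on which the
    profile is bounded by the value of a geometric sequence. *)
Lemma profile_cases h k : 0 < h -> 0 < k -> h <= k + 1 -> 1 <= h + k ->
  exists j, [\/ h <= 2^-1 ^+ j /\ profile h k <= 4 * 4 ^+ j * x ^+ j / x ^+ 2,
    h <= 2 ^+ j.+1 /\ profile h k <= x ^+ j / 4 ^+ j / y ^+ 2 |
    k <= 2^-1 ^+ j /\ profile h k <= 8 / (x ^+ 2) ^+ j.+1].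
Proof.
move=> h0 k0 hk1 hk2.
have [k1|k1] := ltP k 2^-1.
  have [|j hj] := @dyadic_small k; first by rewrite k0/=; lra.
  exists j; apply: Or33; split; first by case/andP: hj.
  by apply: profile_near => //; apply/andP; split; lra.
have [h1|h1] := leP h 1.
  have [|j hj] := @dyadic_small h; first by rewrite h0/=; lra.
  exists j; apply: Or31; split; first by case/andP: hj.
  exact: profile_small.
have [j hj] := dyadic_large h1.
exists j; apply: Or32; split; first by case/andP: hj.
by apply: profile_large => //; lra.
Qed.

End Profile.

End Dyadic.

(** * The Q_s integral of functions with f'(z) = O(1 / |1 - z|) *)

Section KeyEstimate.
Context {R : realType}.
Notation C := (Cplx R).
Notation T1 := (measurableTypeR R).
Notation T2 := (measurableTypeR R * measurableTypeR R)%type.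
Notation leb := (@lebesgue_measure R).
Notation leb2 := (leb \x leb)%E.

(** Squares play the role of discs: their area is a product of lengths. *)
Definition box (b : C) (r : R) : set T2 :=
  `[complex.Re b - r, complex.Re b + r]%classic `*`
  `[complex.Im b - r, complex.Im b + r]%classic.

Lemma measurable_box b r : measurable (box b r).
Proof. by apply: measurableX; exact: measurable_itv. Qed.

Lemma box_cmod b r (p : T2) : cmod (of_xy p - b) <= r -> box b r p.
Proof.
move=> h; have h1 := le_trans (Re_le_cmod _) h; have h2 := le_trans (Im_le_cmod _) h.
move: h1 h2; rewrite ReB ImB /= !ler_norml => /andP[h1 h2] /andP[h3 h4].
by split; rewrite /= in_itv /=; apply/andP; split; lra.
Qed.

Lemma leb2_boxE b r : 0 <= r -> leb2 (box b r) = (4 * r ^+ 2)%:E.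
Proof.
move=> r0; rewrite /box leb2_box; [|lra|lra].
by congr (_%:E); ring.
Qed.

Definition shells (b : C) (c r : nat -> R) (p : T2) : \bar R :=
  (\sum_(0 <= j <oo) (c j * \1_(box b (r j)) p)%:E)%E.

Lemma shells_ge0 b c r p : (forall j, 0 <= c j) -> (0 <= shells b c r p)%E.
Proof. by move=> c0; apply: nneseries_ge0 => j _ _; rewrite lee_fin mulr_ge0. Qed.

Lemma measurable_shell (b : C) (c r : R) :
  measurable_fun setT (fun p : T2 => (c * \1_(box b r) p)%:E).
Proof.
apply/measurable_EFinP; apply: measurable_funM; first exact: measurable_cst.
by apply: measurable_indic; exact: measurable_box.
Qed.

Lemma measurable_shells b c r : (forall j, 0 <= c j) ->
  measurable_fun setT (shells b c r).
Proof.
move=> c0; apply: ge0_emeasurable_sum => [j p _ _|j _].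
  by rewrite lee_fin mulr_ge0.
exact: measurable_shell.
Qed.

Lemma shells_ge b c r p j : (forall i, 0 <= c i) -> cmod (of_xy p - b) <= r j ->
  ((c j)%:E <= shells b c r p)%E.
Proof.
move=> c0 h; refine (le_trans _ (nneseries_lim_ge j.+1 _)); last first.
  by move=> i _ _; rewrite lee_fin mulr_ge0.
rewrite big_nat_recr//= indicE mem_set ?mulr1; last exact: box_cmod.
by rewrite leeDr// sume_ge0// => i _; rewrite lee_fin mulr_ge0.
Qed.

Lemma integral_shells b c r (S : R) : (forall j, 0 <= c j) -> (forall j, 0 <= r j) ->
  (forall n, \sum_(0 <= j < n) c j * r j ^+ 2 <= S) ->
  (\int[leb2]_p shells b c r p <= (4 * S)%:E)%E.
Proof.
move=> c0 r0 hS; rewrite integral_nneseries//; last 2 first.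
- by move=> j; exact: measurable_shell.
- by move=> j p _; rewrite lee_fin mulr_ge0.
apply: lime_le.
  apply: is_cvg_nneseries => j _ _; apply: integral_ge0 => p _.
  by rewrite lee_fin mulr_ge0.
apply: nearW => n.
rewrite (eq_bigr (fun j => (4 * (c j * r j ^+ 2))%:E)); last first.
  move=> j _; under eq_integral do rewrite EFinM.
  rewrite ge0_integralZl//; last 2 first.
  - apply/measurable_EFinP; apply: measurable_indic; exact: measurable_box.
  - by rewrite lee_fin.
  rewrite integral_indic//; last exact: measurable_box.
  rewrite setIT; transitivity ((c j)%:E * (4 * r j ^+ 2)%:E)%E.
    by congr (_ * _)%E; exact: leb2_boxE.
  by rewrite -EFinM; congr (_%:E); ring.
by rewrite sumEFin lee_fin -mulr_sumr ler_pM2l.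
Qed.

(** The area estimate behind log(1/(1-z)) in Q_s. With h = |1-z|/|1-a| and
    k = |z-a|/|1-a| the integrand is at most a constant times
    profile h k / |1-a|^2, which is homogeneous of degree -2 and is summed
    over dyadic shells around 1 and around a. *)
Lemma Qs_integral_le (s : R) : 0 < s -> exists2 A : R, 0 <= A &
  forall (f : C -> C) (K : R) (a : C), disc a ->
    (forall z, disc z -> cmod (derive1 f z) <= K / cmod (1 - z)) ->
    (Qs_integral s f a <= (K ^+ 2 * A)%:E)%E.
Proof.
move=> s0; have [q [M [q01 M0 hg]]] := green_powR_le s0.
have q0 : 0 < q by case/andP: q01.
pose x : R := 2^-1 `^ q; pose y : R := 3^-1 `^ q.
have x0 : 0 < x by exact: powR_gt0.
have y0 : 0 < y by exact: powR_gt0.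
have x1 : x < 1 := profile_ratio_lt1 q01.
have xx := profile_ratio_sqr q01; rewrite -/x in xx.
pose S1 := 4 / x ^+ 2 * (1 - x)^-1.
pose S2 := 4 / y ^+ 2 * (1 - x)^-1.
pose S3 := 8 / x ^+ 2 * (1 - 2^-1)^-1.
have S10 : 0 <= S1.
  by rewrite mulr_ge0 ?invr_ge0 ?subr_ge0 ?(ltW x1)// divr_ge0// exprn_ge0// ltW.
have S20 : 0 <= S2.
  by rewrite mulr_ge0 ?invr_ge0 ?subr_ge0 ?(ltW x1)// divr_ge0// exprn_ge0// ltW.
have S30 : 0 <= S3.
  by rewrite mulr_ge0 ?invr_ge0 ?subr_ge0 ?invf_le1 ?ler1n// divr_ge0// exprn_ge0// ltW.
have p0 : 0 < (pi : R) by exact: pi_gt0.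
exists (pi^-1 * (M * (4 * S1 + 4 * S2 + 4 * S3))).
  by rewrite mulr_ge0 ?invr_ge0 ?(ltW p0)// mulr_ge0//; lra.
move=> f K a da hf; have a1 : cmod a < 1 by apply/discE.
pose d := cmod (1 - a).
have d0 : 0 < d := cmod_1B_gt0 da.
pose B := K ^+ 2 * M / d ^+ 2.
have B0 : 0 <= B by rewrite divr_ge0 ?exprn_ge0 ?(ltW d0)// mulr_ge0// sqr_ge0.
pose c1 j := B * (4 * 4 ^+ j * x ^+ j / x ^+ 2); pose r1 j : R := d * 2^-1 ^+ j.
pose c2 j := B * (x ^+ j / 4 ^+ j / y ^+ 2); pose r2 j : R := d * 2 ^+ j.+1.
pose c3 j := B * (8 / (x ^+ 2) ^+ j.+1).
have c10 j : 0 <= c1 j.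
  by rewrite mulr_ge0// divr_ge0 ?mulr_ge0 ?exprn_ge0 ?(ltW x0).
have c20 j : 0 <= c2 j.
  by rewrite mulr_ge0// !divr_ge0 ?exprn_ge0 ?(ltW x0) ?(ltW y0).
have c30 j : 0 <= c3 j.
  by rewrite mulr_ge0// divr_ge0 ?exprn_ge0 ?(ltW x0).
have r10 j : 0 <= r1 j by rewrite mulr_ge0 ?(ltW d0)// exprn_ge0// invr_ge0.
have r20 j : 0 <= r2 j by rewrite mulr_ge0 ?(ltW d0)// exprn_ge0.
have x01 : 0 <= x < 1 by rewrite (ltW x0).
have I1 : (\int[leb2]_p shells 1 c1 r1 p <= (4 * (K ^+ 2 * M * S1))%:E)%E.
  apply: integral_shells => // n.
  rewrite (eq_bigr (fun j => K ^+ 2 * M * (4 / x ^+ 2) * x ^+ j)); last first.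
    move=> j _; rewrite /c1 /r1 /B exprMn exprVn exprVn -four_powE; field.
    by rewrite !gt_eqF ?exprn_gt0.
  by rewrite -mulr_sumr /S1 !mulrA ler_wpM2l ?sum_geo_le// mulr_ge0 ?invr_ge0
    ?exprn_ge0 ?(ltW x0)// mulr_ge0// mulr_ge0// sqr_ge0.
have I2 : (\int[leb2]_p shells 1 c2 r2 p <= (4 * (K ^+ 2 * M * S2))%:E)%E.
  apply: integral_shells => // n.
  rewrite (eq_bigr (fun j => K ^+ 2 * M * (4 / y ^+ 2) * x ^+ j)); last first.
    move=> j _; rewrite /c2 /r2 /B exprMn -four_powE (exprS 4 j); field.
    by rewrite !gt_eqF ?exprn_gt0.
  by rewrite -mulr_sumr /S2 !mulrA ler_wpM2l ?sum_geo_le// mulr_ge0 ?invr_ge0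
    ?exprn_ge0 ?(ltW y0)// mulr_ge0// mulr_ge0// sqr_ge0.
have I3 : (\int[leb2]_p shells a c3 r1 p <= (4 * (K ^+ 2 * M * S3))%:E)%E.
  apply: integral_shells => // n.
  apply: (@le_trans _ _ (\sum_(0 <= j < n) K ^+ 2 * M * (8 / x ^+ 2) * 2^-1 ^+ j)).
    apply: ler_sum => j _.
    have -> : c3 j * r1 j ^+ 2 = K ^+ 2 * M * (8 / x ^+ 2) * ((4 * x ^+ 2)^-1) ^+ j.
      rewrite /c3 /r1 /B (exprS (x ^+ 2) j) (exprMn 2 d) !exprVn -four_powE (exprMn j 4); field.
      by rewrite !gt_eqF ?exprn_gt0.
    rewrite ler_wpM2l//.
      by rewrite mulr_ge0 ?divr_ge0 ?exprn_ge0 ?(ltW x0)// mulr_ge0// sqr_ge0.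
    rewrite lerXn2r ?nnegrE ?invr_ge0 ?mulr_ge0 ?exprn_ge0 ?(ltW x0)//.
    by rewrite lef_pV2 ?posrE ?mulr_gt0 ?exprn_gt0//; lra.
  have h01 : 0 <= (2^-1 : R) < 1 by rewrite invr_ge0 ler0n invf_lt1// ltr1n.
  by rewrite -mulr_sumr /S3 !mulrA ler_wpM2l ?sum_geo_le// mulr_ge0 ?invr_ge0
    ?exprn_ge0 ?(ltW x0)// mulr_ge0// mulr_ge0// sqr_ge0.
have main : (\int[leb2]_(p in [set p : T2 | disc (of_xy p : C)])
     (cmod (derive1 f (of_xy p)) ^+ 2 * (green (of_xy p) a `^ s))%:E <=
     \int[leb2]_p (shells 1 c1 r1 p + shells 1 c2 r2 p + shells a c3 r1 p))%E.
  rewrite [leLHS]integral_mkcond; apply: le_integral_ge0 => p; rewrite patchE;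
    case: ifPn => // pd.
  - by rewrite lee_fin mulr_ge0 ?powR_ge0// exprn_ge0 ?cmod_ge0.
  - have {}pd : disc (of_xy p : C) by move: pd; rewrite inE.
    set z := of_xy p in pd *.
    have hz := hf z pd; have gz := hg a z da pd.
    pose eta := cmod (1 - z); pose kap := cmod (z - a).
    have z1 : cmod z < 1 by apply/discE.
    have eta0 : 0 < eta := cmod_1B_gt0 pd.
    rewrite -/d -/eta -/kap in gz hz.
    have [za|za] := eqVneq z a.
      apply: (@le_trans _ _ 0%E); last by rewrite !adde_ge0 ?shells_ge0.
      rewrite lee_fin mulr_ge0_le0 ?exprn_ge0 ?cmod_ge0//.
      apply: le_trans gz _; rewrite /kap za subrr cmod0 expr0n/= invr0 mulr0.
      by rewrite powR0 ?gt_eqF// mulr0.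
    have kap0 : 0 < kap by rewrite cmod_gt0 subr_eq0.
    pose h := eta / d; pose k := kap / d.
    have h0 : 0 < h by rewrite divr_gt0.
    have k0 : 0 < k by rewrite divr_gt0.
    have YE : (d * eta / kap ^+ 2) `^ q = h `^ q / (k `^ q) ^+ 2.
      have -> : d * eta / kap ^+ 2 = h * k^-1 ^+ 2.
        by rewrite /h /k; field; rewrite !gt_eqF.
      rewrite powRM ?exprn_ge0 ?invr_ge0 ?(ltW h0) ?(ltW k0)//; congr (_ * _).
      rewrite powRX ?invr_ge0 ?(ltW k0)// -exprVn; congr (_ ^+ _).
      exact: powR_inv (ltW k0).
    have bnd : cmod (derive1 f z) ^+ 2 * green z a `^ s <= B * profile q h k.
      apply: (@le_trans _ _ ((K / eta) ^+ 2 * (M * (h `^ q / (k `^ q) ^+ 2)))).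
        apply: ler_pM; rewrite ?powR_ge0 ?exprn_ge0 ?cmod_ge0//.
          rewrite lerXn2r ?nnegrE ?cmod_ge0//.
          exact: le_trans (cmod_ge0 _) hz.
        by rewrite -YE.
      apply: eq_ler.
      have -> : eta = h * d by rewrite divfK ?gt_eqF.
      have hq0 := powR_gt0 q h0; have kq0 := powR_gt0 q k0.
      rewrite /B /profile; move: (h `^ q) (k `^ q) hq0 kq0 => u v u0 v0.
      move: h0; clearbody h => h0.
      by field; rewrite !gt_eqF.
    have hk1 : h <= k + 1.
      rewrite /h /k -(divff (lt0r_neq0 d0)) -mulrDl ler_pM2r ?invr_gt0//.
      have := cmodD (1 - a) (a - z).
      by rewrite addrA subrK [cmod (a - z)]cmodBC [leRHS]addrC.
    have hk2 : 1 <= h + k.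
      rewrite /h /k -{1}(divff (lt0r_neq0 d0)) -mulrDl ler_pM2r ?invr_gt0//.
      by rewrite /eta /kap /d; have := cmodD (1 - z) (z - a); rewrite addrA subrK.
    have etaE : cmod (z - 1) = d * h by rewrite cmodBC /h mulrC divfK ?gt_eqF.
    have kapE : cmod (z - a) = d * k by rewrite /k mulrC divfK ?gt_eqF.
    have [j [[hj pj]|[hj pj]|[hj pj]]] := profile_cases q01 h0 k0 hk1 hk2.
    + have c1j : ((cmod (derive1 f z) ^+ 2 * green z a `^ s)%:E <= (c1 j)%:E)%E.
        by rewrite lee_fin (le_trans bnd)// ler_wpM2l.
      apply: (le_trans c1j); rewrite -addeA; apply: (@le_trans _ _ (shells 1 c1 r1 p)).
        by apply: shells_ge => //; rewrite -/z etaE ler_wpM2l// ltW.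
      by rewrite leeDl// adde_ge0 ?shells_ge0.
    + have c2j : ((cmod (derive1 f z) ^+ 2 * green z a `^ s)%:E <= (c2 j)%:E)%E.
        by rewrite lee_fin (le_trans bnd)// ler_wpM2l.
      apply: (le_trans c2j); rewrite -addeA; apply: (@le_trans _ _ (shells 1 c2 r2 p)).
        by apply: shells_ge => //; rewrite -/z etaE ler_wpM2l// ltW.
      by rewrite addeCA leeDl// adde_ge0 ?shells_ge0.
    + have c3j : ((cmod (derive1 f z) ^+ 2 * green z a `^ s)%:E <= (c3 j)%:E)%E.
        by rewrite lee_fin (le_trans bnd)// ler_wpM2l.
      apply: (le_trans c3j); apply: (@le_trans _ _ (shells a c3 r1 p)).
        by apply: shells_ge => //; rewrite -/z kapE ler_wpM2l// ltW.
      by rewrite leeDr// adde_ge0 ?shells_ge0.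
  - by rewrite !adde_ge0 ?shells_ge0.
rewrite /Qs_integral.
apply: (@le_trans _ _ ((pi^-1)%:E * (4 * (K ^+ 2 * M * S1) + 4 * (K ^+ 2 * M * S2) +
   4 * (K ^+ 2 * M * S3))%:E)%E); last first.
  rewrite -EFinM lee_fin; apply: eq_ler; ring.
rewrite lee_pmul2l ?lte_fin ?invr_gt0//; apply: le_trans main _.
rewrite ge0_integralD//; last 4 first.
- by move=> p _; rewrite adde_ge0 ?shells_ge0.
- by apply: emeasurable_funD; exact: measurable_shells.
- by move=> p _; exact: shells_ge0.
- exact: measurable_shells.
rewrite ge0_integralD//; last 4 first.
- by move=> p _; exact: shells_ge0.
- exact: measurable_shells.
- by move=> p _; exact: shells_ge0.
- exact: measurable_shells.
by rewrite !EFinD !leeD.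
Qed.

End KeyEstimate.

(** * Complex integrals over [0,1) *)

Section ComplexIntegral.
Context {R : realType}.
Notation C := (Cplx R).
Notation T1 := (measurableTypeR R).
Variable mu : {finite_measure set (measurableTypeR R) -> \bar R}.
Notation I01 := (`[(0:R), 1[%classic : set T1).
Implicit Types (h g : R -> C) (a : nat -> C).

Lemma measurable_I01 : measurable I01. Proof. exact: measurable_itv. Qed.

Lemma I01P (t : R) : I01 t <-> 0 <= t < 1.
Proof. by rewrite /= in_itv. Qed.

Lemma disc_ofR (t : R) : I01 t -> disc (ofR t).
Proof. by move=> /I01P/andP[t0 t1]; apply/discE; rewrite cmod_ofR ger0_norm. Qed.

Lemma le_integral_dom (D : set T1) (f g : T1 -> \bar R) : (forall t, D t -> 0 <= f t)%E ->
  (forall t, D t -> f t <= g t)%E -> (\int[mu]_(t in D) f t <= \int[mu]_(t in D) g t)%E.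
Proof.
move=> f0 fg; rewrite [leLHS]integral_mkcond [leRHS]integral_mkcond.
apply: le_integral_ge0 => t; rewrite !patchE; case: ifPn => //; rewrite inE => Dt.
  exact: f0.
exact: fg.
Qed.

(** The factor 2 comes from estimating the real and imaginary parts separately. *)
Lemma cintegral_dom h (G : R -> R) (M : R) : cmeasurable I01 h ->
  (forall t, I01 t -> cmod (h t) <= G t) ->
  (\int[mu]_(t in I01) (G t)%:E <= M%:E)%E ->
  cintegrable mu h /\ cmod (cintegral mu h) <= 2 * M.
Proof.
move=> [mRe mIm] hG GM.
have part (u : R -> R) : measurable_fun I01 u -> (forall t, `|u t| <= cmod (h t)) ->
    mu.-integrable I01 (EFin \o u) /\ `|\int[mu]_(t in I01) u t| <= M.
  move=> mu' hu.
  have le1 : (\int[mu]_(t in I01) `|(u t)%:E| <= M%:E)%E.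
    apply: le_trans GM; apply: le_integral_dom => t It; first exact: abse_ge0.
    by rewrite abse_EFin lee_fin (le_trans (hu t))// hG.
  have iu : mu.-integrable I01 (EFin \o u).
    apply/integrableP; split; first exact/measurable_EFinP.
    by apply: le_lt_trans le1 _; exact: ltry.
  split => //; rewrite -lee_fin EFin_normr_Rintegral//.
  have mE : measurable_fun I01 (EFin \o u) by exact/measurable_EFinP.
  exact: le_trans (le_abse_integral mu measurable_I01 mE) le1.
have [iRe bRe] := part _ mRe (fun t => Re_le_cmod (h t)).
have [iIm bIm] := part _ mIm (fun t => Im_le_cmod (h t)).
split; first by split.
rewrite (le_trans (cmod_le_ReIm _))// mulr_natl mulr2n.
exact: lerD bRe bIm.
Qed.

Lemma eq_cintegral h g : (forall t, I01 t -> h t = g t) -> cintegral mu h = cintegral mu g.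
Proof.
move=> hg; rewrite /cintegral; congr (_ +i* _)%C; apply: eq_Rintegral => t;
  by rewrite inE => It; rewrite hg.
Qed.

Lemma cintegralB h g : cintegrable mu h -> cintegrable mu g ->
  cintegral mu (fun t => h t - g t) = cintegral mu h - cintegral mu g.
Proof.
move=> [h1 h2] [g1 g2]; rewrite /cintegral.
under eq_Rintegral do rewrite ReB.
under [X in (_ +i* X)%C]eq_Rintegral do rewrite ImB.
by rewrite !RintegralB//; exact: measurable_I01.
Qed.

Lemma cintegralZ (c : C) h : cintegrable mu h ->
  cintegral mu (fun t => c * h t) = c * cintegral mu h.
Proof.
move=> [h1 h2]; rewrite /cintegral.
under eq_Rintegral do rewrite ReM.
under [X in (_ +i* X)%C]eq_Rintegral do rewrite ImM.
have mI := measurable_I01.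
have iZ (k : R) u : mu.-integrable I01 (EFin \o u) ->
    mu.-integrable I01 (EFin \o (fun t => k * u t)).
  move=> iu; have := integrableZl mI k iu; apply: eq_integrable => // t _.
rewrite RintegralB//; [|exact: (iZ _ _ h1)|exact: (iZ _ _ h2)].
rewrite RintegralD//; [|exact: (iZ _ _ h2)|exact: (iZ _ _ h1)].
rewrite !RintegralZl//.
by case: c => u v; apply/eqP; rewrite eq_complex/= eqxx/= addrC; apply/eqP.
Qed.

Lemma cmeasurable_ofR : cmeasurable I01 (fun t : T1 => (ofR t : C)).
Proof. by split; [exact: measurable_id|exact: measurable_cst]. Qed.

Lemma cmeasurable_psum a : abs_cvg_disc a ->
  cmeasurable I01 (fun t => psum a (ofR t)).
Proof.
move=> ha.
have mp n : cmeasurable I01 (fun t => series (fun k => a k * ofR t ^+ k) n).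
  have mt := cmeasurable_ofR.
  have := cmeasurable_horner (\poly_(k < n) a k) mt.
  congr cmeasurable; apply/funext => t.
  by rewrite horner_poly /series/= big_mkord.
have hc t : I01 t -> series (fun k => a k * ofR t ^+ k) @ \oo --> psum a (ofR t).
  by move=> It; apply: psum_cvg => //; apply/discE; exact: disc_ofR.
split.
  apply: (measurable_fun_cvg (fun n => (mp n).1)) => t /hc h.
  by apply: cvg_Re h.
apply: (measurable_fun_cvg (fun n => (mp n).2)) => t /hc h.
by apply: cvg_Im h.
Qed.

Lemma cmeasurable_sum_on_disc (f : C -> C) a : sum_on_disc f a ->
  cmeasurable I01 (fun t => f (ofR t)).
Proof.
move=> hf; have [m1 m2] := cmeasurable_psum hf.1.
by split; [apply: (eq_measurable_fun _ _ m1)|apply: (eq_measurable_fun _ _ m2)];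
  move=> t; rewrite inE => It; rewrite -hf.2//; exact: disc_ofR.
Qed.

(** With w = z this expands t |-> 1 / (1 - t z), which is therefore measurable;
    with w = 1 it is the derivative of log(1 / (1 - z)). *)
Lemma sum_on_disc_kernel (w : C) : cmod w <= 1 ->
  sum_on_disc (fun z => (1 - w * z)^-1) (fun k => w ^+ k).
Proof.
move=> w1; split.
  apply: bounded_abs_cvg_disc => r /andP[r0 r1]; exists 1 => k.
  rewrite cmodX -exprMn exprn_ile1 ?mulr_ge0 ?cmod_ge0//.
  by rewrite mulr_ile1 ?cmod_ge0// ltW.
move=> z /discE z1.
have wz1 : cmod (w * z) < 1.
  by rewrite cmodM (le_lt_trans _ z1)// ler_piMl ?cmod_ge0.
have nz : 1 - w * z != 0.
  by rewrite subr_eq0; apply: contraTneq wz1 => <-; rewrite cmod1 ltxx.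
apply/esym/cvg_limC/cvg_cmod0P.
have E n : cmod (series (fun k => w ^+ k * z ^+ k) n - (1 - w * z)^-1) =
    cmod (1 - w * z)^-1 * cmod (w * z) ^+ n.
  have wz_neq1 : w * z != 1 by rewrite eq_sym -subr_eq0.
  have -> : (fun k => w ^+ k * z ^+ k) = geometric 1 (w * z).
    by apply/funext => k; rewrite /= mul1r exprMn.
  rewrite geometric_seriesE//= mul1r -cmodX -cmodM -cmodN; congr cmod.
  by rewrite mulrBl mul1r addrAC subrr add0r opprK mulrC.
have h : cmod (1 - w * z)^-1 * cmod (w * z) ^+ n @[n --> \oo] -->
    cmod (1 - w * z)^-1 * 0.
  refine (cvgM (cvg_cst _) (cvg_expr _)).
  by rewrite ger0_norm ?cmod_ge0.
rewrite mulr0 in h; apply: cvg_trans h; apply: near_eq_cvg.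
by apply: nearW => n; rewrite E.
Qed.

End ComplexIntegral.

(** * Logarithmic Carleson measures *)

Section Carleson.
Context {R : realType}.
Notation T1 := (measurableTypeR R).
Variable mu : {finite_measure set (measurableTypeR R) -> \bar R}.
Notation I01 := (`[(0:R), 1[%classic : set T1).

(** The growth of a Bloch function on the radius. *)
Definition radial_log (t : R) : R := ln (1 / (1 - t)).

Lemma radial_log_ge0 t : 0 <= t < 1 -> 0 <= radial_log t.
Proof.
by move=> /andP[t0 t1]; rewrite ln_ge0// ler_pdivlMr ?subr_gt0// mul1r gerBl.
Qed.

Lemma radial_log_le s t : s <= t -> t < 1 -> radial_log s <= radial_log t.
Proof.
move=> st t1; rewrite /radial_log !div1r ler_ln ?posrE ?invr_gt0 ?subr_gt0//.
  by rewrite lef_pV2 ?posrE ?subr_gt0 ?(le_lt_trans st)// lerD2l lerN2.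
exact: le_lt_trans t1.
Qed.

Lemma ln2_le1 : ln (2 : R) <= 1.
Proof. by have := @le_ln1Dx R 1; rewrite -(natrD _ 1 1) => ->//; rewrite ltrN10. Qed.

Lemma ln2_ge_half : 2^-1 <= ln (2 : R).
Proof.
have h := @ln4_ge1 R; have E : (4 : R) = 2 ^+ 2 by rewrite -natrX.
move: h; rewrite E lnXn// -mulr_natr => h; lra.
Qed.

Lemma radial_log_dyadic j : radial_log (1 - 2^-1 ^+ j) = j%:R * ln 2.
Proof.
by rewrite /radial_log subKr div1r exprVn invrK lnXn// mulr_natl.
Qed.

(** Each term is at most 2 (phi(2^-(j+1)) - phi(2^-j)) for phi(x) = 1 / (x + d),
    and these differences telescope. *)
Lemma dyadic_telescope (d : R) n : 0 < d ->
  \sum_(0 <= j < n) 2^-1 ^+ j / (2^-1 ^+ j + d) ^+ 2 <= 2 / d.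
Proof.
move=> d0; pose phi (j : nat) : R := (2^-1 ^+ j + d)^-1.
have p0 j : 0 < (2^-1 : R) ^+ j by rewrite exprn_gt0// invr_gt0.
have s0 j : 0 < (2^-1 : R) ^+ j + d by rewrite addr_gt0.
apply: (@le_trans _ _ (\sum_(0 <= j < n) 2 * (phi j.+1 - phi j))).
  apply: ler_sum => j _.
  have s1 := s0 j.+1; have s2 := s0 j; have p2 := p0 j.
  rewrite /phi exprS in s1 *; set p := 2^-1 ^+ j in p2 s1 s2 *.
  have -> : 2 * ((2^-1 * p + d)^-1 - (p + d)^-1) = p / ((2^-1 * p + d) * (p + d)).
    by field; rewrite !gt_eqF//; lra.
  rewrite ler_wpM2l ?(ltW p2)// lef_pV2 ?posrE ?exprn_gt0 ?mulr_gt0//.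
  by rewrite expr2 ler_wpM2r ?(ltW s2)//; lra.
rewrite -mulr_sumr telescope_sumr// ler_wpM2l//.
apply: (@le_trans _ _ (phi n)); first by rewrite gerBl invr_ge0 ltW.
by rewrite lef_pV2 ?posrE// lerDr ltW.
Qed.

Hypothesis hmu : log_Carleson 1 1 mu.

(** The factor j + 2 is an upper bound for 1 + log(1/(1-t)) on the j-th dyadic
    piece; the logarithm in the hypothesis pays for it, except at j = 0, where the
    total mass does. *)
Lemma carleson_dyadic : exists2 C : R, 0 <= C & forall j,
  (j.+2%:R%:E * mu `[(1 - 2^-1 ^+ j)%R, 1%R[%classic <= (C * 2^-1 ^+ j)%:E)%E.
Proof.
have [C0 C00 hC] := hmu.
pose m := fine (mu setT).
have mT : mu setT = m%:E by rewrite fineK// fin_num_measure.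
have m0 : 0 <= m by exact: fine_ge0.
exists (6 * C0 + 2 * m); first by rewrite addr_ge0// mulr_ge0// ltW.
have le_m (A : set T1) : measurable A -> (mu A <= m%:E)%E.
  by move=> mA; rewrite -mT; apply: le_measure; rewrite ?inE.
move=> j; set A := `[_, _[%classic.
have mA : measurable A by exact: measurable_itv.
have Afin : mu A \is a fin_num by exact: fin_num_measure.
have AE : mu A = (fine (mu A))%:E by rewrite fineK.
set u := fine (mu A) in AE; rewrite AE -EFinM lee_fin.
have u0 : 0 <= u by exact: fine_ge0.
have um : u <= m by rewrite -lee_fin -AE le_m.
case: j => [|j] in A mA Afin u AE u0 um *.
  have : 0 <= 6 * C0 by rewrite mulr_ge0// ltW.
  by rewrite expr0 mulr1; lra.
have t01 : 0 <= (1 : R) - 2^-1 ^+ j.+1 < 1.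
  apply/andP; split; last by rewrite gtrBl exprn_gt0// invr_gt0.
  by rewrite subr_ge0 exprn_ile1// ?invr_ge0// invf_le1// ler1n.
have := hC _ t01; rewrite -/A AE -EFinM lee_fin -/(radial_log _) radial_log_dyadic.
rewrite !powRr1; last 2 first.
- by rewrite subKr exprn_ge0// invr_ge0.
- by rewrite mulr_ge0// (le_trans _ ln2_ge_half)// invr_ge0.
rewrite subKr; set p := 2^-1 ^+ j.+1.
have p0 : 0 <= p by rewrite exprn_ge0// invr_ge0.
move=> h.
have h1 : u * (j.+1%:R * 2^-1) <= C0 * p.
  by apply: le_trans h; rewrite ler_wpM2l// ler_wpM2l// ln2_ge_half.
have h2 : j.+3%:R <= 3 * j.+1%:R :> R.
    have : 0 <= j%:R :> R by exact: ler0n.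
    by rewrite -(natr1 j.+2) -(natr1 j.+1) -(natr1 j); lra.
have h3 : j.+3%:R * u <= 3 * j.+1%:R * u by rewrite ler_wpM2r.
have h4 : 0 <= 2 * m * p by rewrite mulr_ge0// mulr_ge0.
have -> : (6 * C0 + 2 * m) * p = 6 * (C0 * p) + 2 * m * p by ring.
lra.
Qed.

(** The measure (1 + log(1/(1-t))) dmu(t) is an ordinary Carleson measure; this
    is its integral against 1 / (1 - t + d)^2, summed over dyadic pieces. *)
Lemma carleson_kernel_bound : exists2 C : R, 0 <= C & forall d : R, 0 < d ->
  (\int[mu]_(t in I01) ((1 + radial_log t) / ((1 - t) + d) ^+ 2)%:E <= (C / d)%:E)%E.
Proof.
have [C C0 hC] := carleson_dyadic.
exists (4 * C * 2); first by rewrite !mulr_ge0.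
move=> d d0; pose A j : set T1 := `[1 - 2^-1 ^+ j, 1%R[%classic.
have mA j : measurable (A j) by exact: measurable_itv.
pose w j : R := j.+2%:R * 4 / (2^-1 ^+ j + d) ^+ 2.
have p0 j : 0 < (2^-1 : R) ^+ j by rewrite exprn_gt0// invr_gt0.
have s0 j : 0 < (2^-1 : R) ^+ j + d by rewrite addr_gt0.
have w0 j : 0 <= w j.
  by apply: divr_ge0; [exact: mulr_ge0|exact/exprn_ge0/ltW/s0].
pose U (t : T1) : \bar R := (\sum_(0 <= j <oo) (w j * \1_(A j) t)%:E)%E.
have U0 t : (0 <= U t)%E by apply: nneseries_ge0 => j _ _; rewrite lee_fin mulr_ge0.
apply: (@le_trans _ _ (\int[mu]_t U t)%E).
  rewrite integral_mkcond; apply: le_integral_ge0 => t; rewrite patchE; case: ifPn => //.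
    rewrite inE => /I01P t01; have L0 := radial_log_ge0 t01.
    by rewrite lee_fin; apply: divr_ge0; [exact: addr_ge0|exact: sqr_ge0].
  rewrite inE => /I01P /andP[t0 t1].
  have [|j /andP[jl ju]] := @dyadic_small _ (1 - t); first by apply/andP; split; lra.
  refine (le_trans _ (nneseries_lim_ge j.+1 _)); last first.
    by move=> i _ _; rewrite lee_fin mulr_ge0.
  rewrite big_nat_recr//= indicE mem_set ?mulr1; last first.
    by rewrite /A /= in_itv/= t1 andbT; lra.
  apply: (@le_trans _ _ (w j)%:E); last first.
    by rewrite leeDr// sume_ge0// => i _; rewrite lee_fin mulr_ge0.
  rewrite lee_fin.
  have L1 : 1 + radial_log t <= j.+2%:R.
    have : radial_log t <= radial_log (1 - 2^-1 ^+ j.+1).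
      by apply: radial_log_le; [lra|rewrite gtrBl].
    rewrite radial_log_dyadic => h.
    have : j.+1%:R * ln 2 <= j.+1%:R :> R by rewrite ler_piMr// ln2_le1.
    rewrite -(natr1 j.+1); lra.
  have L0 : 0 <= radial_log t by apply: radial_log_ge0; rewrite t0.
  rewrite /w -mulrA; apply: ler_pM => //.
  - by rewrite addr_ge0.
  - by rewrite invr_ge0 exprn_ge0//; lra.
  have -> : 4 / (2^-1 ^+ j + d) ^+ 2 = (((2^-1 ^+ j + d) / 2) ^+ 2)^-1.
    by field; rewrite gt_eqF.
  rewrite lef_pV2 ?posrE ?exprn_gt0 ?divr_gt0//; last by lra.
  rewrite lerXn2r ?nnegrE ?divr_ge0 ?(ltW (s0 j))//; first by lra.
  by move: jl; rewrite exprS; lra.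
rewrite integral_nneseries//; last 2 first.
- move=> j; apply/measurable_EFinP; apply: measurable_funM; first exact: measurable_cst.
  exact: measurable_indic.
- by move=> j t _; rewrite lee_fin mulr_ge0.
apply: lime_le.
  apply: is_cvg_nneseries => j _ _; apply: integral_ge0 => t _.
  by rewrite lee_fin mulr_ge0.
apply: nearW => n.
apply: (@le_trans _ _ (\sum_(0 <= j < n) (4 * C * (2^-1 ^+ j / (2^-1 ^+ j + d) ^+ 2))%:E)%E).
  apply: lee_sum => j _; under eq_integral do rewrite EFinM.
  rewrite ge0_integralZl//; last 2 first.
  - by apply/measurable_EFinP; exact: measurable_indic.
  - by rewrite lee_fin.
  rewrite integral_indic// setIT /w.
  have -> : j.+2%:R * 4 / (2^-1 ^+ j + d) ^+ 2 = (4 / (2^-1 ^+ j + d) ^+ 2) * j.+2%:R.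
    by rewrite [j.+2%:R * 4]mulrC mulrAC.
  rewrite EFinM -muleA.
  have -> : 4 * C * (2^-1 ^+ j / (2^-1 ^+ j + d) ^+ 2) =
     (4 / (2^-1 ^+ j + d) ^+ 2) * (C * 2^-1 ^+ j) by ring.
  rewrite [leRHS]EFinM; apply: lee_wpmul2l; last exact: hC.
  by rewrite lee_fin divr_ge0// exprn_ge0// ltW.
rewrite sumEFin lee_fin -mulr_sumr -!mulrA ler_wpM2l// ler_wpM2l//.
exact: dyadic_telescope.
Qed.

End Carleson.

(** * Growth of Bloch functions along the radius *)

Section RadialGrowth.
Context {R : realType}.
Notation C := (Cplx R).

(** A fundamental theorem of calculus without derivatives: quadratic errors
    disappear when the interval is cut into many pieces. *)
Lemma subadditive_le (d : R -> R -> R) (W : R -> R) (t K : R) : 0 <= t ->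
  d 0 0 <= 0 ->
  (forall x y z, d x z <= d x y + d y z) ->
  (forall x y, 0 <= x -> x <= y -> y <= t -> d x y <= W y - W x + K * (y - x) ^+ 2) ->
  d 0 t <= W t - W 0.
Proof.
move=> t0 d00 dtri dW.
have step N i : (i <= N)%N -> d 0 (i%:R * (t / N%:R)) <=
    W (i%:R * (t / N%:R)) - W 0 + i%:R * (K * (t / N%:R) ^+ 2).
  have s0 : 0 <= t / N%:R by rewrite divr_ge0.
  elim: i => [|i ih] iN; first by rewrite !mul0r subrr addr0.
  have N0 : 0 < N%:R :> R by rewrite ltr0n (leq_ltn_trans _ iN).
  apply: le_trans (dtri _ (i%:R * (t / N%:R)) _) _.
  have h1 := ih (ltnW iN).
  have := dW (i%:R * (t / N%:R)) (i.+1%:R * (t / N%:R)).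
  rewrite -mulrBl -natrB// subSnn mul1r => h2.
  have {}h2 := h2 (mulr_ge0 (ler0n _ _) s0).
  have h3 : i%:R * (t / N%:R) <= i.+1%:R * (t / N%:R) by rewrite ler_wpM2r// ler_nat.
  have h4 : i.+1%:R * (t / N%:R) <= t.
    by rewrite mulrCA ler_piMr// ler_pdivrMr// mul1r ler_nat.
  have {}h2 := h2 h3 h4.
  have -> : i.+1%:R * (K * (t / N%:R) ^+ 2) =
      i%:R * (K * (t / N%:R) ^+ 2) + K * (t / N%:R) ^+ 2.
    by rewrite -natr1 mulrDl mul1r.
  lra.
apply/ler_addgt0Pr => e e0.
have [N0|] := leP (K * t ^+ 2) 0.
  have := step 1%N 1%N (leqnn _); rewrite !mul1r divr1; lra.
move=> Kt0.
have [N hN] : exists N : nat, K * t ^+ 2 / e < N%:R.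
  by exists (Num.bound (K * t ^+ 2 / e)); apply: archi_boundP; rewrite divr_ge0// ltW.
have NR : 0 < N%:R :> R by apply: le_lt_trans hN; rewrite divr_ge0// ltW.
have := step N N (leqnn _); rewrite mulrC divfK ?gt_eqF// => h.
apply: (le_trans h); rewrite lerD2l.
have -> : N%:R * (K * (t / N%:R) ^+ 2) = K * t ^+ 2 / N%:R.
  by field; rewrite gt_eqF.
by rewrite ler_pdivrMr//; move: hN; rewrite ltr_pdivrMr// [N%:R * e]mulrC => /ltW.
Qed.

(** The derivative 1 / (1 - t) is increasing, so an increment lies between its
    values at the end points times the length. *)
Lemma radial_log_convex (x y : R) : 0 <= x -> x <= y -> y < 1 ->
  (y - x) / (1 - x) <= radial_log y - radial_log x <= (y - x) / (1 - y).
Proof.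
move=> x0 xy y1; have x1 : 0 < 1 - x by lra.
have y1' : 0 < 1 - y by lra.
have E (u v : R) : 0 < 1 - u -> 0 < 1 - v ->
    radial_log v - radial_log u = - ln (1 + (u - v) / (1 - u)).
  move=> u1 v1; rewrite /radial_log !div1r !lnV ?posrE//.
  have -> : 1 + (u - v) / (1 - u) = (1 - v) / (1 - u) by field; rewrite gt_eqF.
  by rewrite ln_div ?posrE// opprB opprK addrC.
apply/andP; split.
  rewrite E//; have h : ln (1 + (x - y) / (1 - x)) <= (x - y) / (1 - x).
    by apply: le_ln1Dx; rewrite ltr_pdivlMr//; lra.
  have -> : (y - x) / (1 - x) = - ((x - y) / (1 - x)) by field; rewrite gt_eqF.
  by rewrite lerN2.
rewrite -opprB lerNl E// lerN2.
apply: le_trans (le_ln1Dx _) _.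
  by rewrite ltr_pdivlMr//; lra.
by [].
Qed.

Lemma radial_log0 : radial_log (0 : R) = 0.
Proof. by rewrite /radial_log subr0 divr1 ln1. Qed.

Lemma radial_growth (f : C -> C) (a : nat -> C) (B t : R) : sum_on_disc f a ->
  (forall x : R, 0 <= x < 1 -> cmod (derive1 f (ofR x)) * (1 - x) <= B) ->
  0 <= t < 1 -> cmod (f (ofR t)) <= cmod (f 0) + B * radial_log t.
Proof.
move=> hf hB t01; have [ha fE] := hf; case/andP: (t01) => t0 t1.
have [K K0 hK] := psum_taylor2 ha t01.
have in1 x : 0 <= x -> x <= t -> disc (ofR x) /\ cmod (ofR x : C) <= t.
  move=> x0 xt; rewrite cmod_ofR ger0_norm//; split => //.
  by apply/discE; rewrite cmod_ofR ger0_norm//; lra.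
have h : cmod (f (ofR t) - f (ofR 0)) <= B * radial_log t - B * radial_log 0.
  apply: (@subadditive_le (fun x y => cmod (f (ofR y) - f (ofR x)))
     (fun x => B * radial_log x) t K) => //.
  - by rewrite subrr cmod0.
  - move=> x y z; have := cmodD (f (ofR z) - f (ofR y)) (f (ofR y) - f (ofR x)).
    by rewrite addrA subrK [leRHS]addrC.
  move=> x y x0 xy yt; have [dx cx] := in1 x x0 (le_trans xy yt).
  have [dy cy] := in1 y (le_trans x0 xy) yt.
  have := hK _ _ cx cy; rewrite -!fE// -(derive1_psum hf dx) -ofRB cmod_ofR.
  have yx0 : 0 <= y - x by lra.
  rewrite ger0_norm// => q1.
  have x1 : 0 < 1 - x by lra.
  have Bx := hB x; rewrite x0/= in Bx.
  have d1 : cmod (derive1 f (ofR x)) <= B / (1 - x) by rewrite ler_pdivlMr// Bx//; lra.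
  have B0 : 0 <= B.
    by apply: le_trans (Bx _); [rewrite mulr_ge0 ?cmod_ge0//; lra|lra].
  have /andP[L1 _] := radial_log_convex x0 xy (le_lt_trans yt t1).
  have m1 : cmod (derive1 f (ofR x) * ofR (y - x)) <= B * (radial_log y - radial_log x).
    rewrite cmodM cmod_ofR ger0_norm//.
    apply: (@le_trans _ _ (B / (1 - x) * (y - x))); first by rewrite ler_wpM2r.
    by rewrite mulrAC -mulrA ler_wpM2l.
  have := cmod_triB (f (ofR y) - f (ofR x)) (derive1 f (ofR x) * ofR (y - x)).
  rewrite mulrBr in m1; lra.
rewrite radial_log0 mulr0 subr0 ofR0 in h.
have := cmod_triB (f (ofR t)) (f 0); lra.
Qed.

Lemma Qs_radial_growth (s : R) (f : C -> C) (t : R) : 0 < s -> Qs s f -> 0 <= t < 1 ->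
  cmod (f (ofR t)) <= (1 + bloch_const) * Qs_norm s f * (1 + radial_log t).
Proof.
move=> s0 qf t01; have [/analytic_sum_on_disc[a ha] _] := qf.
pose B := bloch_const * Qs_seminorm s f.
have hB x : 0 <= x < 1 -> cmod (derive1 f (ofR x)) * (1 - x) <= B.
  move=> /andP[x0 x1]; have dx : disc (ofR x) by apply/discE; rewrite cmod_ofR ger0_norm.
  by have := Qs_bloch s0 qf dx; rewrite cmod_ofR ger0_norm.
have h := radial_growth ha hB t01; apply: (le_trans h).
have L0 := radial_log_ge0 t01.
have b0 : 0 <= bloch_const :> R by rewrite mulr_ge0// sqrtr_ge0.
have r0 : 0 <= Qs_seminorm s f by rewrite sqrtr_ge0.
have f0 := cmod_ge0 (f 0).
rewrite /B /Qs_norm; set L := radial_log t in L0 *; set b := bloch_const in b0 *.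
set r := Qs_seminorm s f in r0 *; set c := cmod (f 0) in f0 *.
rewrite -subr_ge0.
have -> : (1 + b) * (c + r) * (1 + L) - (c + b * r * L) =
   b * c + r + b * r + L * (c + b * c + r) by ring.
by rewrite !addr_ge0// ?mulr_ge0// !addr_ge0// mulr_ge0.
Qed.

End RadialGrowth.

(** * The Taylor series of I_mu f *)

Section IntegralOperator.
Context {R : realType}.
Notation C := (Cplx R).
Notation T1 := (measurableTypeR R).
Variable mu : {finite_measure set (measurableTypeR R) -> \bar R}.
Notation I01 := (`[(0:R), 1[%classic : set T1).
Implicit Types (f : C -> C) (G : R -> R).

Import HBNNSimple.

(** As for [le_integral_ge0], by scaling the simple functions: G need not be
    measurable. *)
Lemma integral_scale_le (D : set T1) (G : R -> R) (c M : R) : 0 <= c ->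
  (forall t, D t -> 0 <= G t) ->
  (\int[mu]_(t in D) (G t)%:E <= M%:E)%E ->
  (\int[mu]_(t in D) (c * G t)%:E <= (c * M)%:E)%E.
Proof.
move=> c0 G0 GM.
have [->|cN0] := eqVneq c 0.
  rewrite mul0r (eq_integral (cst 0%E)) ?integral0// => t _.
  by rewrite mul0r.
have {}c0 : 0 < c by rewrite lt_def cN0.
have ciV : 0 <= c^-1 by rewrite invr_ge0 ltW.
rewrite integral_mkcond ge0_integralTE; last first.
  move=> t; rewrite patchE; case: ifPn => //; rewrite inE => Dt.
  by rewrite lee_fin mulr_ge0 ?(ltW c0)// G0.
apply: ge_ereal_sup => _ [h /= hG <-].
pose h' := scale_nnsfun h ciV.
have : (sintegral mu h' <= M%:E)%E.
  apply: le_trans GM; rewrite integral_mkcond ge0_integralTE; last first.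
    move=> t; rewrite patchE; case: ifPn => //; rewrite inE => Dt.
    by rewrite lee_fin G0.
  apply: ereal_sup_ubound; exists h' => // t /=.
  have := hG t; rewrite !patchE; case: ifPn => _; rewrite !lee_fin /= => ht.
    by rewrite mulrC ler_pdivrMr// mulrC.
  by rewrite mulr_ge0_le0.
rewrite /h' sintegralrM => hM.
rewrite EFinM -[leLHS]mul1e -(divff cN0) EFinM -muleA.
by rewrite lee_pmul2l ?lte_fin.
Qed.

(** Expanding 1 / (1 - t z) in powers of z shows that these are the Taylor
    coefficients of I_mu f. *)
Definition I_coef f (n : nat) : C := cintegral mu (fun t => ofR t ^+ n * f (ofR t)).

Lemma cmeasurable_expr_ofR n : cmeasurable I01 (fun t : T1 => (ofR t : C) ^+ n).
Proof.
have mt := @cmeasurable_ofR R.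
have := cmeasurable_horner ('X^n : {poly C}) mt.
by congr cmeasurable; apply/funext => t; rewrite hornerXn.
Qed.

Lemma cmeasurable_kernel (z : C) : disc z ->
  cmeasurable I01 (fun t : T1 => (1 - ofR t * z)^-1).
Proof.
move=> /discE z1; have [h1 h2] := sum_on_disc_kernel (ltW z1).
have [m1 m2] := cmeasurable_psum h1.
split; [apply: (eq_measurable_fun _ _ m1)|apply: (eq_measurable_fun _ _ m2)];
  by move=> t; rewrite inE => It; rewrite -h2 1?mulrC//; exact: disc_ofR.
Qed.

(** From 1 - z = (1 - t z) - (1 - t) z, the kernel is large only when both t and
    z are close to 1. *)
Lemma kernel_ge (z : C) (t : R) : disc z -> I01 t ->
  ((1 - t) + cmod (1 - z)) / 3 <= cmod (1 - ofR t * z) /\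
  1 - cmod z <= cmod (1 - ofR t * z).
Proof.
move=> /discE z1 /I01P/andP[t0 t1].
have z0 := cmod_ge0 z.
have ct : cmod (ofR t * z) = t * cmod z by rewrite cmodM cmod_ofR ger0_norm.
have h1 := cmod_triB 1 (ofR t * z); rewrite cmod1 ct in h1.
have h2 : t * cmod z <= t by rewrite ler_piMr// ltW.
have h3 : t * cmod z <= cmod z by rewrite ler_piMl// ltW.
have h4 : cmod (1 - z) <= cmod (1 - ofR t * z) + (1 - t).
  have -> : 1 - z = (1 - ofR t * z) - ofR (1 - t) * z by rewrite ofRB ofR1; ring.
  apply: le_trans (cmodB _ _) _; rewrite lerD2l cmodM cmod_ofR ger0_norm; last by lra.
  by rewrite ler_piMr//; lra.
split; lra.
Qed.

Lemma I_integrand_remainder f (z : C) (t : R) n : disc z -> I01 t ->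
  f (ofR t) / (1 - ofR t * z) * (ofR t * z) ^+ n -
  f (ofR t) / (1 - ofR t * z) * (ofR t * z) ^+ n.+1 =
  z ^+ n * (ofR t ^+ n * f (ofR t)).
Proof.
move=> dz It; have [_ h] := kernel_ge dz It; move/discE: dz => z1.
have nz : 1 - ofR t * z != 0 by rewrite -cmod_gt0; lra.
rewrite exprS !exprMn; field; exact: nz.
Qed.

Section Dominated.
Variables (f : C -> C) (G : R -> R) (M : R).
Hypothesis mf : cmeasurable I01 (fun t => f (ofR t)).
Hypothesis fG : forall t, I01 t -> cmod (f (ofR t)) <= G t.
Hypothesis GM : (\int[mu]_(t in I01) (G t)%:E <= M%:E)%E.

Let G0 t : I01 t -> 0 <= G t.
Proof. by move=> It; apply: le_trans (fG It); exact: cmod_ge0. Qed.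

Lemma cintegral_mul_dom (h : R -> C) (c : R) : 0 <= c -> cmeasurable I01 h ->
  (forall t, I01 t -> cmod (h t) <= c) ->
  cintegrable mu (fun t => f (ofR t) * h t) /\
  cmod (cintegral mu (fun t => f (ofR t) * h t)) <= 2 * (c * M).
Proof.
move=> c0 mh hc; apply: (@cintegral_dom _ mu _ (fun t => c * G t)).
- exact: cmeasurableM.
- move=> t It; rewrite cmodM mulrC; apply: ler_pM; rewrite ?cmod_ge0//.
    exact: hc.
  exact: fG.
exact: integral_scale_le.
Qed.

Lemma I_dom_dominated : I_dom mu f.
Proof.
move=> z dz; have z1 : cmod z < 1 by apply/discE.
have c0 : 0 <= (1 - cmod z)^-1 by rewrite invr_ge0 subr_ge0 ltW.
have [|h _] := cintegral_mul_dom c0 (cmeasurable_kernel dz); last exact: h.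
move=> t It; have [_ h] := kernel_ge dz It.
by rewrite cmodV lef_pV2 ?posrE ?subr_gt0// (lt_le_trans _ h)// subr_gt0.
Qed.

Lemma I_coef_dominated n : cintegrable mu (fun t => ofR t ^+ n * f (ofR t)) /\
  cmod (I_coef f n) <= 2 * M.
Proof.
have := @cintegral_mul_dom (fun t => ofR t ^+ n) 1 ler01 (cmeasurable_expr_ofR n).
rewrite /I_coef mul1r (_ : (fun t => f (ofR t) * ofR t ^+ n) =
  (fun t => ofR t ^+ n * f (ofR t))); last by apply/funext => t; rewrite mulrC.
apply=> t /I01P/andP[t0 t1].
by rewrite cmodX cmod_ofR ger0_norm// exprn_ile1// ltW.
Qed.

(** The remainder of the geometric series of the kernel after n terms is the
    kernel times (t z)^n, whose integral against f tends to 0. *)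
Lemma I_op_sum_on_disc : sum_on_disc (I_op mu f) (I_coef f).
Proof.
split.
  apply: bounded_abs_cvg_disc => r /andP[r0 r1]; exists (2 * M) => k.
  have [_ h] := I_coef_dominated k.
  by apply: le_trans h; rewrite ler_piMr ?cmod_ge0// exprn_ile1// ltW.
move=> z dz; have z1 : cmod z < 1 by apply/discE.
have zN : 0 < 1 - cmod z by rewrite subr_gt0.
pose F n := cintegral mu (fun t => f (ofR t) * ((1 - ofR t * z)^-1 * (ofR t * z) ^+ n)).
have Fdom n : cintegrable mu (fun t => f (ofR t) * ((1 - ofR t * z)^-1 * (ofR t * z) ^+ n))
    /\ cmod (F n) <= 2 * ((1 - cmod z)^-1 * cmod z ^+ n * M).
  apply: cintegral_mul_dom.
  - by rewrite mulr_ge0 ?exprn_ge0 ?cmod_ge0// invr_ge0 ltW.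
  - apply: cmeasurableM; first exact: cmeasurable_kernel.
    have mt := @cmeasurable_ofR R.
    have := cmeasurable_horner ((z *: 'X) ^+ n : {poly C}) mt.
    by congr cmeasurable; apply/funext => t; rewrite horner_exp hornerZ hornerX mulrC.
  - move=> t It; have [_ h] := kernel_ge dz It; move: It => /I01P/andP[t0 t1].
    rewrite cmodM cmodV cmodX; apply: ler_pM.
    + by rewrite invr_ge0 cmod_ge0.
    + by rewrite exprn_ge0 ?cmod_ge0.
    + by rewrite lef_pV2 ?posrE// (lt_le_trans _ h).
    + rewrite lerXn2r ?nnegrE ?cmod_ge0// cmodM cmod_ofR ger0_norm//.
      by rewrite ler_piMl ?cmod_ge0// ltW.
have FE n : I_op mu f z - series (fun k => I_coef f k * z ^+ k) n = F n.
  elim: n => [|n ih].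
    rewrite /series/= big_geq// subr0; apply: eq_cintegral => t _.
    by rewrite expr0 mulr1.
  have -> : series (fun k => I_coef f k * z ^+ k) n.+1 =
     series (fun k => I_coef f k * z ^+ k) n + I_coef f n * z ^+ n.
    by rewrite /series/= big_nat_recr.
  rewrite opprD addrA ih mulrC -cintegralZ; last by case: (I_coef_dominated n).
  have -> : cintegral mu (fun t => z ^+ n * (ofR t ^+ n * f (ofR t))) = F n - F n.+1.
    rewrite -cintegralB; [|by case: (Fdom n)|by case: (Fdom n.+1)].
    apply: eq_cintegral => t It; rewrite -(I_integrand_remainder f n dz It).
    by rewrite !mulrA.
  by rewrite subKr.
apply/esym/cvg_limC/cvg_cmod0P.
have h : 2 * ((1 - cmod z)^-1 * cmod z ^+ n * M) @[n --> \oo] -->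
    2 * ((1 - cmod z)^-1 * 0 * M).
  refine (cvgM (cvg_cst _) (cvgM (cvgM (cvg_cst _) (cvg_expr _)) (cvg_cst _))).
  by rewrite ger0_norm ?cmod_ge0.
rewrite mulr0 mul0r mulr0 in h.
apply: (squeeze_cvgr _ (cvg_cst 0) h); apply: nearW => n.
by rewrite cmod_ge0/= cmodBC FE; case: (Fdom n).
Qed.

End Dominated.

End IntegralOperator.

(** * Boundedness of I_mu *)

Section BoundedIntegralOperator.
Context {R : realType}.
Notation C := (Cplx R).
Notation T1 := (measurableTypeR R).
Notation I01 := (`[(0:R), 1[%classic : set T1).
Implicit Types (f g : C -> C) (s : R).

Lemma Qs_of_derive_bound s : 0 < s -> exists2 A : R, 0 <= A &
  forall g (K : R), 0 <= K -> analytic_on_disc g ->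
    (forall z, disc z -> cmod (derive1 g z) <= K / cmod (1 - z)) ->
    Qs s g /\ Qs_seminorm s g <= K * A.
Proof.
move=> s0; have [A A0 hA] := Qs_integral_le s0.
exists (Num.sqrt A); first exact: sqrtr_ge0.
move=> g K K0 ag hg.
have le : (Qs_sup s g <= (K ^+ 2 * A)%:E)%E.
  by apply: ge_ereal_sup => _ [b db <-]; exact: hA.
have fin : (Qs_sup s g < +oo)%E by apply: le_lt_trans le _; exact: ltry.
split; first by split.
have S0 : (0 <= Qs_sup s g)%E.
  apply: (@le_trans _ _ (Qs_integral s g 0)); first exact: Qs_integral_ge0.
  by apply: ereal_sup_ubound; exists 0 => //; exact: disc0.
rewrite /Qs_seminorm -[K in K * _]ger0_norm// -sqrtr_sqr -sqrtrM ?sqr_ge0//.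
rewrite ler_wsqrtr// -lee_fin fineK// ge0_fin_numE//.
Qed.

Variable mu : {finite_measure set (measurableTypeR R) -> \bar R}.
Variable Cmu : R.
Hypothesis Cmu0 : 0 <= Cmu.
Hypothesis hmu : forall d : R, 0 < d ->
  (\int[mu]_(t in I01) ((1 + radial_log t) / ((1 - t) + d) ^+ 2)%:E <= (Cmu / d)%:E)%E.

Let kernel_ge0 (d t : R) : I01 t -> 0 <= (1 + radial_log t) / ((1 - t) + d) ^+ 2.
Proof.
move=> /I01P t01; apply: divr_ge0; last exact: sqr_ge0.
by rewrite addr_ge0// radial_log_ge0.
Qed.

Lemma carleson_log_integral (K : R) : 0 <= K ->
  (\int[mu]_(t in I01) (K * (1 + radial_log t))%:E <= (4 * K * Cmu)%:E)%E.
Proof.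
move=> K0.
have K40 : 0 <= 4 * K by rewrite mulr_ge0.
have h1 := hmu ltr01; rewrite divr1 in h1.
have h := integral_scale_le K40 (@kernel_ge0 1) h1.
apply: le_trans h; apply: le_integral_dom => t It.
  by rewrite lee_fin mulr_ge0// addr_ge0// radial_log_ge0//; apply/I01P.
have L0 : 0 <= 1 + radial_log t by rewrite addr_ge0// radial_log_ge0//; apply/I01P.
move/I01P/andP: It => [t0 t1]; rewrite lee_fin [4 * K]mulrC -mulrA ler_wpM2l//.
rewrite mulrCA -[leLHS]mulr1 ler_wpM2l// ler_pdivlMr ?mul1r; last by rewrite exprn_gt0//; lra.
have -> : (4 : R) = 2 ^+ 2 by rewrite -natrX.
rewrite lerXn2r ?nnegrE//; lra.
Qed.

Section Growth.
Variables (f : C -> C) (K : R).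
Hypothesis K0 : 0 <= K.
Hypothesis mf : cmeasurable I01 (fun t => f (ofR t)).
Hypothesis fK : forall t, I01 t -> cmod (f (ofR t)) <= K * (1 + radial_log t).

(** Bounding difference quotients avoids differentiating under the integral.
    Each of the two kernels is at most 3 / (1 - t + d) with d = |1 - z| / 2, so the
    Carleson bound at scale d applies; 36 = 3 . 3 . 2 . 2, with one 2 from d and
    one from the real and imaginary parts. *)
Lemma I_op_quotient_bound (z h : C) : disc z -> disc (h + z) ->
  cmod h <= cmod (1 - z) / 2 ->
  cmod (I_op mu f (h + z) - I_op mu f z) <= 36 * Cmu * K / cmod (1 - z) * cmod h.
Proof.
move=> dz dhz hz; have z1 : cmod z < 1 by apply/discE.
pose d := cmod (1 - z) / 2.
have c0 := cmod_1B_gt0 dz.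
have d0 : 0 < d by rewrite divr_gt0.
have dom := I_dom_dominated mf fK (carleson_log_integral K0).
rewrite -cintegralB; [|exact: dom|exact: dom].
have E t : I01 t -> I_integrand f (h + z) t - I_integrand f z t =
    f (ofR t) * (h * ofR t * ((1 - ofR t * (h + z))^-1 * (1 - ofR t * z)^-1)).
  move=> It; have [_ n1] := kernel_ge dz It; have [_ n2] := kernel_ge dhz It.
  have hz1 : cmod (h + z) < 1 by apply/discE.
  have nz1 : 1 - ofR t * z != 0 by rewrite -cmod_gt0; lra.
  have nz2 : 1 - ofR t * (h + z) != 0 by rewrite -cmod_gt0; lra.
  rewrite /I_integrand; field; apply/andP; split; [exact: nz1|exact: nz2].
rewrite (eq_cintegral _ E).
have mt := @cmeasurable_ofR R.
have c90 : 0 <= 9 * K * cmod h by rewrite mulr_ge0 ?cmod_ge0// mulr_ge0.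
have bnd := integral_scale_le c90 (@kernel_ge0 d) (hmu d0).
refine (le_trans (proj2 (@cintegral_dom _ mu _ _ _ _ _ bnd)) _).
- apply: cmeasurableM => //; apply: cmeasurableM.
    by apply: cmeasurableM => //; exact: cmeasurable_cst.
  by apply: cmeasurableM; exact: cmeasurable_kernel.
- move=> t It; have [k1 _] := kernel_ge dz It; have [k2 _] := kernel_ge dhz It.
  have fKt := fK It; move/I01P/andP: (It) => [t0 t1].
  have L0 : 0 <= 1 + radial_log t by rewrite addr_ge0// radial_log_ge0//; apply/I01P.
  have e1 : (1 - t + d) / 3 <= cmod (1 - ofR t * z) by move: k1; rewrite /d; lra.
  have e2 : (1 - t + d) / 3 <= cmod (1 - ofR t * (h + z)).
    have := cmodD (1 - (h + z)) h; have -> : 1 - (h + z) + h = 1 - z by ring.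
    move: k2 hz; rewrite /d; lra.
  have s0 : 0 < (1 - t + d) / 3 by rewrite divr_gt0//; lra.
  have inv (u : C) : (1 - t + d) / 3 <= cmod u -> cmod u^-1 <= 3 / (1 - t + d).
    move=> hu; rewrite cmodV -invf_div lef_pV2 ?posrE//; exact: lt_le_trans hu.
  have i1 := inv _ e1; have i2 := inv _ e2.
  rewrite !cmodM cmod_ofR ger0_norm//.
  have -> : 9 * K * cmod h * ((1 + radial_log t) / (1 - t + d) ^+ 2) =
    (K * (1 + radial_log t)) * (cmod h * 1 * (3 / (1 - t + d) * (3 / (1 - t + d)))).
    by field; rewrite gt_eqF//; lra.
  apply: ler_pM => //; rewrite ?mulr_ge0 ?cmod_ge0//.
  apply: ler_pM => //; rewrite ?mulr_ge0 ?cmod_ge0//.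
    by apply: ler_pM => //; rewrite ?cmod_ge0// ltW.
  by apply: ler_pM; rewrite ?cmod_ge0.
apply: eq_ler; rewrite /d; field.
by rewrite gt_eqF.
Qed.

Lemma I_op_derive_bound (z : C) : disc z ->
  cmod (derive1 (I_op mu f) z) <= 36 * Cmu * K / cmod (1 - z).
Proof.
move=> dz; have z1 : cmod z < 1 by apply/discE.
have hs := I_op_sum_on_disc mf fK (carleson_log_integral K0).
rewrite (derive1_psum hs dz).
have q := quotient_psum hs dz.
have c0 := cmod_1B_gt0 dz.
refine (cvg_le_cst (cvg_cmod q) _).
apply: (@near_dnbhs0C _ _ (Num.min (cmod (1 - z) / 2) (1 - cmod z))).
  by rewrite lt_min divr_gt0//= subr_gt0.
move=> h h0; rewrite lt_min => /andP[h1 h2].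
have dhz : disc (h + z) by apply/discE; rewrite (le_lt_trans (cmodD _ _))//; lra.
have b := I_op_quotient_bound dz dhz (ltW h1).
rewrite /GRing.scale/= cmodM cmodV mulrC ler_pdivrMr ?cmod_gt0//.
Qed.

End Growth.

Lemma I_op_bounded s : 0 < s -> bounded_on_Qs s (I_dom mu) (I_op mu).
Proof.
move=> s0; have [A A0 hA] := Qs_of_derive_bound s0.
pose b : R := 1 + bloch_const.
have b0 : 0 <= b by rewrite addr_ge0// mulr_ge0// sqrtr_ge0.
have N0 f : 0 <= Qs_norm s f by rewrite addr_ge0 ?cmod_ge0// sqrtr_ge0.
have main f : Qs s f -> [/\ I_dom mu f, Qs s (I_op mu f) &
    Qs_norm s (I_op mu f) <= (8 * Cmu * b + 36 * Cmu * b * A) * Qs_norm s f].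
  move=> qf; have [/analytic_sum_on_disc[a ha] _] := qf.
  have fK t : I01 t -> cmod (f (ofR t)) <= b * Qs_norm s f * (1 + radial_log t).
    by move=> It; apply: (Qs_radial_growth s0 qf); exact/I01P.
  have K0 : 0 <= b * Qs_norm s f by rewrite mulr_ge0.
  have mf := cmeasurable_sum_on_disc ha.
  have L := carleson_log_integral K0.
  have hs := I_op_sum_on_disc mf fK L.
  have [q n] := hA (I_op mu f) _ (mulr_ge0 (mulr_ge0 (ler0n R 36) Cmu0) K0)
    (sum_on_disc_analytic hs) (fun z dz => I_op_derive_bound K0 mf fK dz).
  split => //; first exact: I_dom_dominated mf fK L.
  have [_ c0] := I_coef_dominated mf fK L 0.
  rewrite /Qs_norm hs.2 ?psum0; last exact: disc0.
  rewrite -/(Qs_norm s f) mulrDl; apply: lerD.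
    apply: (le_trans c0); apply: eq_ler; ring.
  apply: (le_trans n); apply: eq_ler; ring.
split; first by move=> f /main[].
by exists (8 * Cmu * b + 36 * Cmu * b * A) => f /main[].
Qed.

End BoundedIntegralOperator.

(** * Comparison of H_mu with I_mu *)

Section HankelIntegral.
Context {R : realType}.
Notation C := (Cplx R).
Notation T1 := (measurableTypeR R).
Notation I01 := (`[(0:R), 1[%classic : set T1).
Variable mu : {finite_measure set (measurableTypeR R) -> \bar R}.

Lemma measurable_exprR n : measurable_fun I01 (fun t : T1 => t ^+ n).
Proof. by apply: measurable_funX; exact: measurable_id. Qed.

Lemma integral_cst1_fin : (\int[mu]_(t in I01) 1%:E < +oo)%E.
Proof.
rewrite integral_cst; last exact: measurable_I01.
by rewrite mul1e -ge0_fin_numE// fin_num_measure//; exact: measurable_I01.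
Qed.

Lemma expr_integrable n : mu.-integrable I01 (EFin \o (fun t => t ^+ n)).
Proof.
apply/integrableP; split; first by apply/measurable_EFinP; exact: measurable_exprR.
apply: le_lt_trans integral_cst1_fin.
apply: le_integral_dom => t /I01P/andP[t0 t1]; first exact: abse_ge0.
by rewrite /= lee_fin ger0_norm ?exprn_ge0// exprn_ile1// ltW.
Qed.

Lemma integral_exprE n : (\int[mu]_(t in I01) (t ^+ n)%:E = (moment mu n)%:E)%E.
Proof.
rewrite /moment /Rintegral fineK//.
have := integrable_fin_num measurable_I01 (expr_integrable n).
by [].
Qed.

Lemma moment_ge0 n : 0 <= moment mu n.
Proof. by apply: Rintegral_ge0 => t /I01P/andP[t0 _]; rewrite exprn_ge0. Qed.

Lemma cintegral_expr n : cintegral mu (fun t => (ofR t : C) ^+ n) = ofR (moment mu n).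
Proof.
rewrite /cintegral /moment /ofR; congr (_ +i* _)%C.
  by apply: eq_Rintegral => t _; rewrite -ofRX.
transitivity (\int[mu]_(t in I01) (0 : R)).
  by apply: eq_Rintegral => t _; rewrite -ofRX.
by rewrite Rintegral_cst ?mul0r//; exact: measurable_I01.
Qed.

(** Monotone convergence, with the sum of the series only required to dominate W. *)
Lemma integral_series_le (u : nat -> T1 -> R) (m : nat -> R) (W : T1 -> R) (S : R) :
  (forall k t, I01 t -> 0 <= u k t) -> (forall k, measurable_fun I01 (u k)) ->
  (forall k, \int[mu]_(t in I01) (u k t)%:E = (m k)%:E)%E ->
  (forall n, \sum_(0 <= k < n) m k <= S) ->
  (forall t, I01 t -> 0 <= W t) ->
  (forall t, I01 t -> (W t)%:E <= \sum_(0 <= k <oo) (u k t)%:E)%E ->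
  (\int[mu]_(t in I01) (W t)%:E <= S%:E)%E.
Proof.
move=> u0 mu' um mS W0 Wu.
apply: (@le_trans _ _ (\int[mu]_(t in I01) (\sum_(0 <= k <oo) (u k t)%:E))%E).
  by apply: le_integral_dom => t It; [rewrite lee_fin W0|exact: Wu].
rewrite integral_nneseries; last 3 first.
- exact: measurable_I01.
- by move=> k; apply/measurable_EFinP.
- by move=> k t It; rewrite lee_fin u0.
apply: lime_le.
  apply: is_cvg_nneseries => k _ _; apply: integral_ge0 => t It.
  by rewrite lee_fin u0.
by apply: nearW => n; under eq_bigr do rewrite um; rewrite sumEFin lee_fin.
Qed.

Lemma big_nat_shift (u : nat -> R) N n :
  \sum_(N <= k < N + n) u k = \sum_(0 <= k < n) u (N + k)%N.
Proof.
rewrite -[X in \sum_(X <= _ < _) _]add0n big_addn addKn.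
by apply: eq_bigr => k _; rewrite addnC.
Qed.

Lemma le_nneseries_of_tail (u : nat -> R) (x : R) N : (forall k, 0 <= u k) ->
  cvgn (series u) -> x <= limn (series u) - series u N ->
  (x%:E <= \sum_(0 <= k <oo) (u (N + k)%N)%:E)%E.
Proof.
move=> u0 cu xl; set Z := (\sum_(0 <= k <oo) _)%E.
have Zge n : ((series u (N + n)%N - series u N)%:E <= Z)%E.
  have -> : series u (N + n)%N - series u N = \sum_(0 <= k < n) u (N + k)%N.
    by rewrite sub_series_geq ?leq_addr// (big_nat_shift _ N).
  rewrite -sumEFin; apply: nneseries_lim_ge => k _ _.
  by rewrite lee_fin.
have Z0 : (0 <= Z)%E by apply: nneseries_ge0 => k _ _; rewrite lee_fin.
have [Zfin|] := boolP (Z \is a fin_num); last first.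
  by rewrite ge0_fin_numE// -leNgt leye_eq => /eqP ->; rewrite leey.
rewrite -(fineK Zfin) lee_fin; apply: (le_trans xl); rewrite lerBlDr.
refine (cvg_le_cst cu _); exists N => // n /= Nn.
have := Zge (n - N)%N; rewrite subnKC// -(fineK Zfin) lee_fin; lra.
Qed.

Section AbsolutelySummable.
Variables (f : C -> C) (a : nat -> C).
Hypothesis hf : sum_on_disc f a.
Hypothesis cs : cvgn (series (fun k => cmod (a k) * moment mu k)).

Let m k := cmod (a k) * moment mu k.
Let S := limn (series m).

Let m0 k : 0 <= m k. Proof. by rewrite mulr_ge0 ?cmod_ge0 ?moment_ge0. Qed.

(** The Taylor remainder at t is at most the tail of sum |a_k| t^k, whose integral
    is the tail of the convergent series of |a_k| mu_k. *)
Lemma remainder_integral_le N :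
  (\int[mu]_(t in I01) (cmod (f (ofR t) - series (fun k => a k * ofR t ^+ k) N))%:E <=
   (S - series m N)%:E)%E.
Proof.
apply: (@integral_series_le (fun k t => cmod (a (N + k)%N) * t ^+ (N + k))
  (fun k => m (N + k)%N)).
- by move=> k t /I01P/andP[t0 _]; rewrite mulr_ge0 ?cmod_ge0// exprn_ge0.
- by move=> k; apply: measurable_funM; [exact: measurable_cst|exact: measurable_exprR].
- move=> k; under eq_integral do rewrite EFinM.
  rewrite ge0_integralZl ?lee_fin ?cmod_ge0//; last 2 first.
  + by apply/measurable_EFinP; exact: measurable_exprR.
  + by move=> t /I01P/andP[t0 _]; rewrite lee_fin exprn_ge0.
  by rewrite integral_exprE.
- move=> n; have -> : \sum_(0 <= k < n) m (N + k)%N = series m (N + n)%N - series m N.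
    by rewrite sub_series_geq ?leq_addr// (big_nat_shift _ N).
  by rewrite lerD2r; apply: ge0_series_le_lim.
- by move=> t _; exact: cmod_ge0.
move=> t It; move/I01P: (It) => t01; case/andP: (t01) => t0 t1.
apply: (le_nneseries_of_tail (u := fun k => cmod (a k) * t ^+ k)).
- by move=> k; rewrite mulr_ge0 ?cmod_ge0// exprn_ge0.
- exact: hf.1.
rewrite hf.2; last exact: disc_ofR.
by apply: psum_tail_le hf.1 _ t1; rewrite cmod_ofR ger0_norm.
Qed.

Let mf : cmeasurable I01 (fun t => f (ofR t)).
Proof. exact: cmeasurable_sum_on_disc hf. Qed.

Let fS : (\int[mu]_(t in I01) (cmod (f (ofR t)))%:E <= S%:E)%E.
Proof.
have := remainder_integral_le 0; rewrite {2}/series/= big_geq// subr0.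
by apply: le_trans; apply: le_integral_dom => t It;
  rewrite ?lee_fin ?cmod_ge0// /series/= big_geq// subr0.
Qed.

Let fle t : I01 t -> cmod (f (ofR t)) <= cmod (f (ofR t)). Proof. by []. Qed.

Lemma I_dom_summable : I_dom mu f.
Proof. exact: I_dom_dominated mf fle fS. Qed.

Lemma H_coef_cvg n : H_coef_series mu f n @ \oo --> I_coef mu f n.
Proof.
pose rem N := cintegral mu (fun t =>
  ofR t ^+ n * (f (ofR t) - series (fun k => a k * ofR t ^+ k) N)).
have mr N : cmeasurable I01 (fun t => f (ofR t) - series (fun k => a k * ofR t ^+ k) N).
  have mt := @cmeasurable_ofR R.
  have mp := cmeasurable_horner (\poly_(k < N) (- a k)) mt.
  have := cmeasurableD mf mp; congr cmeasurable; apply/funext => t; congr (_ + _).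
  rewrite horner_poly /series/= big_mkord -sumrN.
  by apply: eq_bigr => k _; rewrite mulNr.
have dom N : cintegrable mu (fun t =>
    ofR t ^+ n * (f (ofR t) - series (fun k => a k * ofR t ^+ k) N)) /\
    cmod (rem N) <= 2 * (S - series m N).
  apply: cintegral_dom (remainder_integral_le N).
    by apply: cmeasurableM; [exact: cmeasurable_expr_ofR|exact: mr].
  move=> t /I01P/andP[t0 t1]; rewrite cmodM cmodX cmod_ofR ger0_norm//.
  by rewrite ler_piMl ?cmod_ge0// exprn_ile1// ltW.
have E N : I_coef mu f n - H_coef_series mu f n N = rem N.
  elim: N => [|N ih].
    rewrite /H_coef_series /series/= big_geq// subr0; apply: eq_cintegral => t _.
    by rewrite /series/= big_geq// subr0.
  have -> : H_coef_series mu f n N.+1 = H_coef_series mu f n N +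
      a N * ofR (moment mu (n + N)).
    by rewrite /H_coef_series /series/= big_nat_recr//= (taylor_sum_on_disc _ hf) mulrC.
  rewrite opprD addrA ih -cintegral_expr -cintegralZ; last first.
    have := cintegral_dom (mu := mu) (h := fun t => (ofR t : C) ^+ (n + N))
      (G := fun=> 1) (M := fine (mu I01)).
    case => //; first exact: cmeasurable_expr_ofR.
      move=> t /I01P/andP[t0 t1].
      by rewrite cmodX cmod_ofR ger0_norm// exprn_ile1// ltW.
    rewrite integral_cst ?mul1e; last exact: measurable_I01.
    by rewrite fineK// fin_num_measure//; exact: measurable_I01.
  have -> : cintegral mu (fun t => a N * ofR t ^+ (n + N)) = rem N - rem N.+1.
    rewrite -cintegralB; [|by case: (dom N)|by case: (dom N.+1)].
    apply: eq_cintegral => t _; rewrite /series/= big_nat_recr//= exprD.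
    by ring.
  by rewrite subKr.
apply/cvg_cmod0P.
have h : 2 * (S - series m N) @[N --> \oo] --> 2 * (S - S).
  by refine (cvgM (cvg_cst _) (cvgB (cvg_cst _) cs)).
rewrite subrr mulr0 in h.
apply: (squeeze_cvgr _ (cvg_cst 0) h); apply: nearW => N.
by rewrite cmod_ge0/= cmodBC E; case: (dom N).
Qed.

(** Taylor remainders of f have small integrals, so the sum over k may be
    exchanged with the integral in every row of the Hankel matrix; the rows are
    then the Taylor coefficients of I_mu f. *)
Lemma H_eq_I : H_dom mu f /\ forall z, disc z -> H_op mu f z = I_op mu f z.
Proof.
have hs := I_op_sum_on_disc mf fle fS.
have hc n : limn (H_coef_series mu f n) = I_coef mu f n.
  by refine (cvg_limC (@H_coef_cvg n)).
have hz z : disc z -> H_series mu f z @ \oo --> I_op mu f z.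
  move=> dz; rewrite /H_series; have -> : (fun n => limn (H_coef_series mu f n) * z ^+ n) =
    (fun n => I_coef mu f n * z ^+ n) by apply/funext => n; rewrite hc.
  by rewrite hs.2//; apply: psum_cvg hs.1 _; apply/discE.
split; last by move=> z dz; refine (cvg_limC (hz z dz)).
split; first by move=> n; refine (cvgP _ (@H_coef_cvg n)).
by move=> z dz; refine (cvgP _ (hz z dz)).
Qed.

End AbsolutelySummable.

End HankelIntegral.

(** * The logarithm as a test function *)

Section LogarithmTest.
Context {R : realType}.
Notation C := (Cplx R).
Notation T1 := (measurableTypeR R).
Notation I01 := (`[(0:R), 1[%classic : set T1).

(** The coefficients of log(1/(1-z)); at k = 0 the inverse is 0. *)
Definition log_coef (k : nat) : C := ofR (k%:R^-1).

Fact clog_key : unit. Proof. exact: tt. Qed.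

Definition clog : C -> C := locked_with clog_key (psum log_coef).

Lemma clogE : clog = psum log_coef.
Proof. by rewrite /clog unlock. Qed.

Lemma cmod_log_coef k : cmod (log_coef k) = k%:R^-1.
Proof. by rewrite cmod_ofR ger0_norm ?invr_ge0. Qed.

Lemma sum_on_disc_clog : sum_on_disc clog log_coef.
Proof.
split; last by move=> z _; rewrite clogE.
apply: bounded_abs_cvg_disc => r /andP[r0 r1]; exists 1 => k.
rewrite cmod_log_coef; apply: mulr_ile1; rewrite ?invr_ge0 ?exprn_ge0//.
  by case: k => [|k]; rewrite ?invr0// invf_le1 ?ler1n ?ltr0n.
by rewrite exprn_ile1// ltW.
Qed.

Lemma derive1_clog z : disc z -> derive1 clog z = (1 - z)^-1.
Proof.
move=> dz; rewrite (derive1_psum sum_on_disc_clog dz).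
have -> : dcoef log_coef = (fun k => (1 : C) ^+ k).
  apply/funext => k; rewrite /dcoef /log_coef expr1n ofRV ofR_nat mulfV//.
have w1 : cmod (1 : C) <= 1 by rewrite cmod1.
by have [_ <-] := sum_on_disc_kernel w1; rewrite ?mul1r.
Qed.

(** The derivative is 1 / (1 - z), the extremal case of the area estimate. *)
Lemma Qs_clog s : 0 < s -> Qs s clog.
Proof.
move=> s0; have [A A0 hA] := Qs_of_derive_bound s0.
have [] // := hA clog 1 ler01 (sum_on_disc_analytic sum_on_disc_clog).
by move=> z dz; rewrite derive1_clog// cmodV mul1r.
Qed.

(** Both sides vanish at 0 and have the derivative 1 / (1 - t). *)
Lemma clog_ge t : 0 <= t < 1 -> radial_log t <= complex.Re (clog (ofR t)).
Proof.
move=> t01; case/andP: (t01) => t0 t1.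
have [K K0 hK] := psum_taylor2 sum_on_disc_clog.1 t01.
have c0 : complex.Re (clog (ofR 0)) = 0.
  by rewrite ofR0 clogE psum0 /log_coef invr0.
suff : radial_log t - radial_log 0 <= complex.Re (clog (ofR t)) - complex.Re (clog (ofR 0)).
  by rewrite radial_log0 c0 !subr0.
refine (@subadditive_le R (fun x y => radial_log y - radial_log x)
  (fun x => complex.Re (clog (ofR x))) t (K + ((1 - t) ^+ 2)^-1) t0 _ _ _).
- by rewrite subrr.
- by move=> x y z; lra.
move=> x y x0 xy yt.
have /andP[_ h1] := radial_log_convex x0 xy (le_lt_trans yt t1).
have in1 u : 0 <= u -> u <= t -> disc (ofR u) /\ cmod (ofR u : C) <= t.
  move=> u0 ut; rewrite cmod_ofR ger0_norm//; split => //.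
  by apply/discE; rewrite cmod_ofR ger0_norm//; lra.
have [dx cx] := in1 x x0 (le_trans xy yt).
have [dy cy] := in1 y (le_trans x0 xy) yt.
have := hK _ _ cx cy.
rewrite -(derive1_psum sum_on_disc_clog dx) (derive1_clog dx) -clogE.
rewrite -ofR1 -!ofRB -ofRV cmod_ofR real_normK ?num_real// => h2.
have := le_trans (Re_le_cmod _) h2; rewrite !ReB -ofRM.
have -> : complex.Re (ofR ((1 - x)^-1 * (y - x)) : C) = (1 - x)^-1 * (y - x) by [].
rewrite ler_norml => /andP[h3 _].
have x1 : 0 < 1 - x by lra.
have y1 : 0 < 1 - y by lra.
have t1' : 0 < 1 - t by lra.
have h4 : (y - x) / (1 - y) - (1 - x)^-1 * (y - x) <= ((1 - t) ^+ 2)^-1 * (y - x) ^+ 2.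
  have -> : (y - x) / (1 - y) - (1 - x)^-1 * (y - x) =
     ((1 - y) * (1 - x))^-1 * (y - x) ^+ 2 by field; rewrite !gt_eqF.
  rewrite ler_wpM2r ?sqr_ge0// lef_pV2 ?posrE ?mulr_gt0 ?exprn_gt0//.
  by rewrite expr2; apply: ler_pM; lra.
rewrite mulrDl; lra.
Qed.

Variable mu : {finite_measure set (measurableTypeR R) -> \bar R}.

Section Necessity.
Variables (s : R).
Hypothesis s0 : 0 < s.
Hypothesis dom : I_dom mu clog.
Hypothesis qI : Qs s (I_op mu clog).

Let m r := fine (mu `[r, 1%R[%classic).

Let mE r : mu `[r, 1%R[%classic = (m r)%:E.
Proof. by rewrite /m fineK// fin_num_measure//; exact: measurable_itv. Qed.

Lemma indic_integrable (A : set T1) : measurable A ->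
  mu.-integrable I01 (EFin \o (\1_A : T1 -> R)).
Proof.
move=> mA; apply/integrableP; split.
  by apply/measurable_EFinP; exact: measurable_indic.
apply: le_lt_trans (integral_cst1_fin mu).
apply: le_integral_dom => t _; first exact: abse_ge0.
by rewrite /= lee_fin ger0_norm// indicE; case: (_ \in _).
Qed.

(** The integrand of the difference is nonnegative, and on [r,1) both factors
    1 - t r and 1 - t (r + h) of its denominator are at most 2 (1 - r), while the
    logarithm is at least its value at r. *)
Lemma I_clog_increment (r h : R) : 0 <= r -> 0 < h -> r + h < 1 ->
  h * (r * radial_log r / (4 * (1 - r) ^+ 2)) * m r <=
  complex.Re (I_op mu clog (ofR (r + h)) - I_op mu clog (ofR r)).
Proof.
move=> r0 h0 rh1; have r1 : r < 1 by lra.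
have dr : disc (ofR r) by apply/discE; rewrite cmod_ofR ger0_norm.
have drh : disc (ofR (r + h)) by apply/discE; rewrite cmod_ofR ger0_norm//; lra.
rewrite -cintegralB; [|exact: dom|exact: dom].
set c := h * _.
pose A : set T1 := `[r, 1%R[%classic.
have mA : measurable A by exact: measurable_itv.
have -> : c * m r = \int[mu]_(t in I01) (c * \1_A t).
  rewrite RintegralZl; [|exact: measurable_I01|exact: indic_integrable].
  congr (_ * _); rewrite /Rintegral integral_indic//.
  rewrite /m; congr (fine (mu _)); apply/seteqP; split => [t /= It|t []//].
  split=> //; move: It; rewrite /= !in_itv/= => /andP[rt t1].
  by rewrite t1 (le_trans r0).
have e t : I01 t -> I_integrand clog (ofR (r + h)) t - I_integrand clog (ofR r) t =
    ofR (h * t / ((1 - t * (r + h)) * (1 - t * r))) * clog (ofR t).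
  move=> /I01P/andP[t0 t1].
  have n1 : 1 - t * r != 0.
    by rewrite gt_eqF// subr_gt0 (le_lt_trans _ t1)// ler_piMr// ltW.
  have n2 : 1 - t * (r + h) != 0.
    by rewrite gt_eqF// subr_gt0 (le_lt_trans _ t1)// ler_piMr//; lra.
  rewrite /I_integrand -!ofRM -ofR1 -!ofRB -!ofRV.
  rewrite -mulrBr mulrC -ofRB; congr (ofR _ * _).
  by field; rewrite ?n1 ?n2.
rewrite (eq_cintegral _ e) /cintegral /=.
have [iRe _] := dom drh; have [jRe _] := dom dr.
apply: le_Rintegral.
- exact: measurable_I01.
- have := integrableZl measurable_I01 c (indic_integrable mA).
  by apply: eq_integrable; first exact: measurable_I01.
- have := integrableB measurable_I01 iRe jRe.
  apply: eq_integrable; first exact: measurable_I01.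
  by move=> t; rewrite inE => It; rewrite /= -EFinB -ReB e.
move=> t It; rewrite Re_ofRM.
move: (It) => /I01P t01; case/andP: (t01) => t0 t1.
have L0 := radial_log_ge0 t01.
have uL := clog_ge t01.
have P0 : 0 < 1 - t * (r + h).
  by rewrite subr_gt0 (le_lt_trans _ t1)// ler_piMr//; lra.
have Q0 : 0 < 1 - t * r.
  by rewrite subr_gt0 (le_lt_trans _ t1)// ler_piMr// ltW.
have PQ0 : 0 < (1 - t * (r + h)) * (1 - t * r) by exact: mulr_gt0.
have ht0 : 0 <= h * t / ((1 - t * (r + h)) * (1 - t * r)).
  by apply: divr_ge0; [apply: mulr_ge0 => //; exact: ltW|exact: ltW].
rewrite indicE; case: (boolP (t \in A)) => [|_]; last first.
  by rewrite mulr0; apply: mulr_ge0 => //; exact: le_trans L0 uL.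
rewrite inE /A /= in_itv/= => /andP[rt _]; rewrite mulr1 /c.
have Lr0 : 0 <= radial_log r by apply: radial_log_ge0; rewrite r0.
have Lrt : radial_log r <= complex.Re (clog (ofR t)).
  exact: le_trans (radial_log_le rt t1) uL.
have -> : h * (r * radial_log r / (4 * (1 - r) ^+ 2)) =
   (h * r / (4 * (1 - r) ^+ 2)) * radial_log r by ring.
have r1' : 0 < 1 - r by lra.
have D0 : 0 < 4 * (1 - r) ^+ 2 by rewrite mulr_gt0// exprn_gt0.
apply: ler_pM => //.
  by apply: divr_ge0; [apply: mulr_ge0 => //; exact: ltW|exact: ltW].
apply: ler_pM.
- by rewrite mulr_ge0// ltW.
- by rewrite invr_ge0 ltW.
- by rewrite ler_wpM2l// ltW.
rewrite lef_pV2 ?posrE//.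
have -> : 4 * (1 - r) ^+ 2 = (2 * (1 - r)) * (2 * (1 - r)) by ring.
have tr : r * r <= t * r by rewrite ler_wpM2r.
have th : 0 <= t * h by rewrite mulr_ge0// ltW.
have rr : 0 <= (1 - r) ^+ 2 by exact: sqr_ge0.
apply: ler_pM; [exact: ltW|exact: ltW| |]; nra.
Qed.

(** Letting h tend to 0 in [I_clog_increment] bounds r L(r) mu([r,1)) by
    4 (1 - r)^2 (I_mu log)'(r), where L(r) = log(1/(1-r)), and the Bloch property
    of I_mu log bounds the derivative by B / (1 - r). Near 0 the factor r is lost, but
    there L is bounded by 1 and 1 - r is bounded below. *)
Lemma log_Carleson_of_I_clog : log_Carleson 1 1 mu.
Proof.
pose B := bloch_const * Qs_seminorm s (I_op mu clog).
have [c hc] := analytic_sum_on_disc qI.1.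
have m0 r : 0 <= m r by exact: fine_ge0.
have key r : 0 <= r < 1 -> r * radial_log r * m r <= 4 * B * (1 - r).
  move=> r01; case/andP: (r01) => r0 r1.
  have dr : disc (ofR r) by apply/discE; rewrite cmod_ofR ger0_norm.
  have r1' : 0 < 1 - r by lra.
  pose v := r * radial_log r / (4 * (1 - r) ^+ 2) * m r.
  pose rho := (1 + r) / 2.
  have rho01 : 0 <= rho < 1 by rewrite /rho; apply/andP; split; lra.
  have [K K0 hK] := psum_taylor2 hc.1 rho01.
  have K1 : 0 < K + 1 by lra.
  have : v <= complex.Re (derive1 (I_op mu clog) (ofR r)).
    apply/ler_addgt0Pr => e e0.
    pose h := Num.min ((1 - r) / 2) (e / (K + 1)).
    have h0 : 0 < h by rewrite lt_min !divr_gt0.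
    have h1 : h <= (1 - r) / 2 by rewrite ge_min lexx.
    have h2 : h <= e / (K + 1) by rewrite ge_min lexx orbT.
    have rh1 : r + h < 1 by lra.
    have c1 : cmod (ofR r : C) <= rho by rewrite cmod_ofR ger0_norm// /rho; lra.
    have c2 : cmod (ofR (r + h) : C) <= rho by rewrite cmod_ofR ger0_norm /rho; lra.
    have drh : disc (ofR (r + h)) by apply/discE; rewrite cmod_ofR ger0_norm//; lra.
    have rhE : ofR (r + h) - ofR r = ofR h :> C by rewrite -ofRB addrAC subrr add0r.
    have := hK _ _ c1 c2; rewrite -!hc.2// -(derive1_psum hc dr) rhE.
    rewrite cmod_ofR real_normK ?num_real// => q.
    have := le_trans (Re_le_cmod _) q.
    rewrite ReB [_ * ofR h]mulrC Re_ofRM ler_norml => /andP[_ q1].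
    have q2 := I_clog_increment r0 h0 rh1.
    have Kh : K * h ^+ 2 <= e * h.
      have : K * h <= e.
        apply: (@le_trans _ _ ((K + 1) * h)); first by rewrite ler_wpM2r// ?lerDl// ltW.
        by move: h2; rewrite ler_pdivlMr// mulrC.
      by move=> kh; rewrite expr2 mulrA ler_wpM2r// ltW.
    rewrite -(ler_pM2l h0) mulrDr /v mulrA; lra.
  move=> hv.
  have bl := Qs_bloch s0 qI dr; rewrite cmod_ofR ger0_norm// -/B in bl.
  have v1 : v * (1 - r) <= B.
    apply: le_trans bl; rewrite ler_wpM2r ?(ltW r1')//.
    apply: (le_trans hv); apply: le_trans (Re_le_cmod _); exact: ler_norm.
  have -> : r * radial_log r * m r = v * (1 - r) * (4 * (1 - r)).
    by rewrite /v; field; rewrite gt_eqF.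
  have -> : 4 * B * (1 - r) = B * (4 * (1 - r)) by ring.
  by rewrite ler_wpM2r// mulr_ge0// ltW.
have B0 : 0 <= B by rewrite mulr_ge0 ?sqrtr_ge0// mulr_ge0// sqrtr_ge0.
exists (8 * B + 2 * m 0 + 1).
  by rewrite ltr_wpDl// addr_ge0// mulr_ge0.
move=> t t01; case/andP: (t01) => t0 t1.
have L0 := radial_log_ge0 t01.
rewrite -/(radial_log t) !powRr1//; last by rewrite subr_ge0 ltW.
rewrite mE -EFinM lee_fin mulrC.
have t1' : 0 < 1 - t by lra.
have c1 : 0 <= 8 * B * (1 - t).
  by apply: mulr_ge0; [exact: mulr_ge0|exact: ltW].
have c2 : 0 <= m 0 * (1 - t) by apply: mulr_ge0 => //; exact: ltW.
have c3 := key t t01.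
have [th|th] := leP 2^-1 t.
  have : 2^-1 * (radial_log t * m t) <= t * (radial_log t * m t).
    by rewrite ler_wpM2r// mulr_ge0.
  rewrite mulrA in c3 *; rewrite !mulrDl mul1r; lra.
have mt : m t <= m 0.
  rewrite -lee_fin -!mE; apply: le_measure; rewrite ?inE; try exact: measurable_itv.
  by move=> x /=; rewrite !in_itv/= => /andP[tx ->]; rewrite (le_trans t0).
have Lt : radial_log t <= 1.
  apply: le_trans ln2_le1.
  have := radial_log_dyadic (R := R) 1; rewrite expr1 mul1r => <-.
  by apply: radial_log_le; lra.
have : radial_log t * m t <= 1 * m 0 by apply: ler_pM.
have : m 0 * 2^-1 <= m 0 * (1 - t) by rewrite ler_wpM2l//; lra.
rewrite !mulrDl !mul1r; lra.
Qed.

End Necessity.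

(** The first row of the Hankel matrix applied to the coefficients 1/k is a
    series of nonnegative terms, so its convergence, part of H_mu log being
    defined, is absolute and makes the two operators agree on the logarithm. *)
Lemma clog_summable : H_dom mu clog ->
  cvgn (series (fun k => cmod (log_coef k) * moment mu k)).
Proof.
move=> [hd _]; have /cvg_ex[l hl] := hd 0%N.
have E : (fun n => complex.Re (H_coef_series mu clog 0 n)) =
    series (fun k => cmod (log_coef k) * moment mu k); last first.
  by rewrite -E; refine (cvgP _ (cvg_Re hl)).
apply/funext => n; rewrite /H_coef_series /series Re_sum; apply: eq_bigr => k _.
by rewrite cmod_log_coef Re_ofRM (taylor_sum_on_disc _ sum_on_disc_clog) mulrC.
Qed.

End LogarithmTest.

(** * Taylor coefficients of Bloch functions and moments *)

Section CoefficientSums.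
Context {R : realType}.
Notation C := (Cplx R).
Notation T1 := (measurableTypeR R).
Notation I01 := (`[(0:R), 1[%classic : set T1).

(** A partial sum of degree < N that is close to g on |z| = r is sampled at N
    points of that circle. Parseval turns the Bloch bound at these points into a
    bound for the coefficients. *)
Lemma bloch_coef_sqr_sum (g : C -> C) (c : nat -> C) (B r : R) K :
  sum_on_disc g c -> 0 <= B -> 0 < r < 1 ->
  (forall z, disc z -> cmod (g z) * (1 - cmod z) <= B) ->
  \sum_(0 <= k < K) cmod (c k) ^+ 2 * (r ^+ 2) ^+ k <= ((B + 1) / (1 - r)) ^+ 2.
Proof.
move=> hg B0 /andP[r0 r1] hB.
have r1' : 0 < 1 - r by rewrite subr_gt0.
have e0 : 0 < 1 / (1 - r) by rewrite divr_gt0.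
have r01 : 0 <= r < 1 by rewrite (ltW r0).
have [n0 _ hn0] := psum_approx hg.1 r01 e0.
pose n := maxn n0 K.
have hn := hn0 n (leq_maxl _ _).
pose q := \poly_(k < n) (c k * ofR r ^+ k).
have qE z : q.[z] = series (fun k => c k * (ofR r * z) ^+ k) n.
  rewrite horner_poly /series/= big_mkord; apply: eq_bigr => k _.
  by rewrite exprMn mulrA.
have [w hw] := exists_root_neg1 (R := R) n; have wp := prim_root_neg1 hw.
set N := (2 ^ n.+1)%N in wp.
have nN : (n <= N)%N.
  by apply: ltnW; apply: (ltn_trans (ltnSn n)); rewrite /N ltn_expl.
have qN : (size q <= N)%N by apply: leq_trans (size_poly _ _) nN.
have w1 := cmod_prim_root wp.
have N0 : 0 < N%:R :> R by rewrite ltr0n (prim_order_gt0 wp).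
have bnd (j : 'I_N) : cmod q.[w ^+ j] ^+ 2 <= ((B + 1) / (1 - r)) ^+ 2.
  have cz : cmod (ofR r * w ^+ j) = r.
    by rewrite cmodM cmod_ofR cmodX w1 expr1n mulr1 ger0_norm// ltW.
  have dz : disc (ofR r * w ^+ j) by apply/discE; rewrite cz.
  rewrite lerXn2r ?nnegrE ?cmod_ge0//.
    by apply: divr_ge0; [apply: addr_ge0|exact: ltW].
  have h1 := hn _ (eq_ind _ (fun x => x <= r) (lexx r) _ (esym cz)).
  rewrite -qE -hg.2// in h1.
  have h2 : cmod (g (ofR r * w ^+ j)) <= B / (1 - r).
    by rewrite ler_pdivlMr//; have := hB _ dz; rewrite cz.
  have := cmod_triB q.[w ^+ j] (g (ofR r * w ^+ j)); rewrite cmodBC mulrDl; lra.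
have := parseval wp qN.
have s1 : \sum_(j < N) cmod q.[w ^+ j] ^+ 2 <= N%:R * ((B + 1) / (1 - r)) ^+ 2.
  rewrite mulr_natl -[N in leRHS]card_ord -sumr_const; apply: ler_sum => j _.
  exact: bnd.
move=> E; rewrite E ler_pM2l// in s1; apply: le_trans s1.
have KN : (K <= N)%N by apply: leq_trans nN; exact: leq_maxr.
apply: (@le_trans _ _ (\sum_(0 <= k < K) cmod q`_k ^+ 2)).
  apply: eq_ler; rewrite big_nat [RHS]big_nat.
  apply: eq_bigr => k /andP[_ kK]; rewrite coef_poly.
  rewrite (leq_trans kK (leq_maxr n0 K)) cmodM cmodX cmod_ofR ger0_norm ?(ltW r0)//.
  by rewrite [RHS]exprMn -!exprM mulnC.
rewrite -(big_mkord xpredT (fun k => cmod q`_k ^+ 2)) [leRHS](big_cat_nat (n := K))//= lerDl.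
by apply: sumr_ge0 => k _; exact: sqr_ge0.
Qed.

(** The radius r = 1 - 1 / (4 K) balances the two sides of [bloch_coef_sqr_sum]: the
    weights r^(2k) stay above 1/2 for k < K. *)
Lemma bloch_coef_sqr_sum_le (g : C -> C) (c : nat -> C) (B : R) K :
  sum_on_disc g c -> 0 <= B -> (0 < K)%N ->
  (forall z, disc z -> cmod (g z) * (1 - cmod z) <= B) ->
  \sum_(0 <= k < K) cmod (c k) ^+ 2 <= 32 * (B + 1) ^+ 2 * K%:R ^+ 2.
Proof.
move=> hg B0 K0 hB; have KR : 1 <= K%:R :> R by rewrite ler1n.
pose r : R := 1 - (4 * K%:R)^-1.
have v0 : 0 < (4 * K%:R : R)^-1 by rewrite invr_gt0 mulr_gt0// ltr0n.
have v1 : (4 * K%:R : R)^-1 <= 4^-1.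
  by rewrite lef_pV2 ?posrE ?mulr_gt0 ?ltr0n//; lra.
have r01 : 0 < r < 1 by rewrite /r; apply/andP; split; lra.
have h := bloch_coef_sqr_sum K hg B0 r01 hB.
have r0 : 0 <= r by case/andP: r01 => /ltW.
(* Bernoulli's inequality: r ^ (2 K) >= 1 - 2 K / (4 K). *)
have ber m : 1 - m%:R * (4 * K%:R)^-1 <= r ^+ m.
  elim: m => [|m ih]; first by rewrite mul0r subr0 expr0.
  rewrite exprS; apply: (@le_trans _ _ (r * (1 - m%:R * (4 * K%:R)^-1))); last first.
    by rewrite ler_wpM2l.
  have : 0 <= m%:R * (4 * K%:R)^-1 * (4 * K%:R : R)^-1.
    by apply: mulr_ge0; [apply: mulr_ge0 => //|]; exact: ltW.
  by rewrite /r -natr1; lra.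
have half k : (k < K)%N -> 2^-1 <= (r ^+ 2) ^+ k.
  move=> kK; rewrite -exprM; apply: le_trans (ber _).
  have : (2 * k)%:R * (4 * K%:R)^-1 <= 2^-1 :> R.
    rewrite ler_pdivrMr ?mulr_gt0 ?ltr0n// natrM.
    have : (k%:R <= K%:R :> R) by rewrite ler_nat ltnW.
    lra.
  lra.
have : 2^-1 * \sum_(0 <= k < K) cmod (c k) ^+ 2 <= ((B + 1) / (1 - r)) ^+ 2.
  apply: le_trans h; rewrite mulr_sumr big_nat [leRHS]big_nat; apply: ler_sum => k /andP[_ kK].
  by rewrite mulrC ler_wpM2l ?sqr_ge0// half.
have -> : ((B + 1) / (1 - r)) ^+ 2 = 16 * (B + 1) ^+ 2 * K%:R ^+ 2.
  by rewrite /r subKr invrK; ring.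
lra.
Qed.

Variable mu : {finite_measure set (measurableTypeR R) -> \bar R}.
Variable Cmu : R.
Hypothesis Cmu0 : 0 <= Cmu.
Hypothesis hmu : forall d : R, 0 < d ->
  (\int[mu]_(t in I01) ((1 + radial_log t) / ((1 - t) + d) ^+ 2)%:E <= (Cmu / d)%:E)%E.

(** The Carleson bound at the scale d = 2/k, since
    t^k <= exp(- k (1 - t)) <= (d / (1 - t + d))^2. *)
Lemma moment_le_inv k : (0 < k)%N -> moment mu k <= 2 * Cmu / k%:R.
Proof.
move=> k0; have kR : 0 < k%:R :> R by rewrite ltr0n.
have d0 : 0 < 2 / k%:R :> R by rewrite divr_gt0.
have c0 : 0 <= (2 / k%:R) ^+ 2 :> R by exact: sqr_ge0.
have ker0 t : I01 t -> 0 <= (1 + radial_log t) / ((1 - t) + 2 / k%:R) ^+ 2.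
  move=> /I01P t01; apply: divr_ge0; last exact: sqr_ge0.
  by rewrite addr_ge0// radial_log_ge0.
have h := integral_scale_le c0 ker0 (hmu d0).
rewrite -lee_fin -integral_exprE.
have -> : 2 * Cmu / k%:R = (2 / k%:R) ^+ 2 * (Cmu / (2 / k%:R)).
  by field; rewrite gt_eqF.
apply: le_trans h; apply: le_integral_dom => t /I01P t01; case/andP: (t01) => t0 t1.
  by rewrite lee_fin exprn_ge0.
have L0 := radial_log_ge0 t01.
rewrite lee_fin; set u := 1 - t; have u0 : 0 < u by rewrite subr_gt0.
have s0 : 0 < u + 2 / k%:R by rewrite addr_gt0.
apply: (@le_trans _ _ ((2 / k%:R) ^+ 2 / (u + 2 / k%:R) ^+ 2)); last first.
  rewrite mulrA ler_pM2r ?invr_gt0 ?exprn_gt0// ler_peMr//; lra.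
have -> : (2 / k%:R) ^+ 2 / (u + 2 / k%:R) ^+ 2 = ((1 + k%:R * u / 2) ^+ 2)^-1.
  have ku : 0 < 1 + k%:R * u / 2.
    have : 0 < k%:R * u / 2 by rewrite divr_gt0// mulr_gt0.
    lra.
  by field; rewrite !gt_eqF//; move: s0 ku; nra.
have e1 : t <= expR (- u).
  by have := expR_ge1Dx (- u); rewrite /u; lra.
apply: (@le_trans _ _ (expR (- u) ^+ k)).
  by rewrite lerXn2r ?nnegrE ?expR_ge0.
have -> : expR (- u) ^+ k = (expR (k%:R * u / 2) ^+ 2)^-1.
  by rewrite -expRM_natl -expRM_natl -expRN; congr expR; field.
have h1 := expR_ge1Dx (k%:R * u / 2).
have ku : 0 <= k%:R * u / 2 by rewrite divr_ge0// mulr_ge0// ltW.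
have h2 : 0 < 1 + k%:R * u / 2 by lra.
by rewrite lef_pV2 ?posrE ?exprn_gt0 ?expR_gt0// lerXn2r ?nnegrE ?expR_ge0// ltW.
Qed.

(** The block sums over 2^n <= k < 2^(n+1) are estimated with
    2 x <= x^2 / lambda + lambda; the choice lambda = (3/2)^n makes both
    resulting series converge. *)
Lemma bloch_moment_summable (f : C -> C) (a : nat -> C) (B : R) :
  sum_on_disc f a -> 0 <= B ->
  (forall z, disc z -> cmod (derive1 f z) * (1 - cmod z) <= B) ->
  cvgn (series (fun k => cmod (a k) * moment mu k)).
Proof.
move=> hf B0 hB; have hg := sum_on_disc_derive1 hf.
pose u k := cmod (a k) * moment mu k.
have u0 k : 0 <= u k by rewrite mulr_ge0 ?cmod_ge0 ?moment_ge0.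
pose D := 128 * (B + 1) ^+ 2.
have D0 : 0 <= D by rewrite mulr_ge0// sqr_ge0.
have blk n : \sum_(2 ^ n <= k < 2 ^ n.+1) u k <=
    Cmu * (D * (2 / 3) ^+ n + (3 / 4) ^+ n).
  have p0 : (0 < 2 ^ n)%N by rewrite expn_gt0.
  have pR : 0 < (2 ^ n)%:R :> R by rewrite ltr0n.
  pose lam : R := (3 / 2) ^+ n; have lam0 : 0 < lam by rewrite exprn_gt0// divr_gt0.
  have term k : (2 ^ n <= k < 2 ^ n.+1)%N ->
      u k <= Cmu / (2 ^ n)%:R ^+ 2 * (cmod (dcoef a k.-1) ^+ 2 / lam + lam).
    move=> /andP[k1 k2]; have k0 : (0 < k)%N by apply: leq_trans k1.
    have kR : 0 < k%:R :> R by rewrite ltr0n.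
    have ck : cmod (a k) = cmod (dcoef a k.-1) / k%:R.
      by rewrite /dcoef prednK// cmodM cmod_nat mulrC mulKf// gt_eqF.
    set x := cmod (dcoef a k.-1) in ck *; have x0 : 0 <= x by exact: cmod_ge0.
    have amgm : 2 * x <= x ^+ 2 / lam + lam.
      have : 0 <= (x - lam) ^+ 2 / lam by rewrite divr_ge0 ?sqr_ge0// ltW.
      have -> : (x - lam) ^+ 2 / lam = x ^+ 2 / lam + lam - 2 * x.
        by field; rewrite gt_eqF.
      by rewrite subr_ge0.
    rewrite /u ck; apply: (@le_trans _ _ (x / k%:R * (2 * Cmu / k%:R))).
      by rewrite ler_wpM2l ?divr_ge0 ?(ltW kR)// moment_le_inv.
    have -> : x / k%:R * (2 * Cmu / k%:R) = Cmu / k%:R ^+ 2 * (2 * x).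
      by field; rewrite gt_eqF.
    apply: ler_pM => //.
    - by rewrite divr_ge0// exprn_ge0// ltW.
    - by rewrite mulr_ge0.
    rewrite ler_wpM2l// lef_pV2 ?posrE ?exprn_gt0// lerXn2r ?nnegrE ?(ltW pR) ?(ltW kR)//.
    by rewrite ler_nat.
  apply: (@le_trans _ _ (\sum_(2 ^ n <= k < 2 ^ n.+1)
      Cmu / (2 ^ n)%:R ^+ 2 * (cmod (dcoef a k.-1) ^+ 2 / lam + lam))).
    by rewrite big_nat [leRHS]big_nat; apply: ler_sum => k; exact: term.
  rewrite -mulr_sumr big_split/= -mulr_suml sumr_const_nat.
  have -> : (2 ^ n.+1 - 2 ^ n = 2 ^ n)%N by rewrite expnS mul2n -addnn addnK.
  have sq : \sum_(2 ^ n <= k < 2 ^ n.+1) cmod (dcoef a k.-1) ^+ 2 <= D * (2 ^ n)%:R ^+ 2.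
    apply: (@le_trans _ _ (\sum_(0 <= k < 2 ^ n.+1) cmod (dcoef a k) ^+ 2)).
      rewrite -[X in \sum_(X <= _ < _) _](prednK p0) -(prednK (n := 2 ^ n.+1)) ?expn_gt0//.
      rewrite big_add1 /= (big_cat_nat (n := (2 ^ n).-1) (p := (2 ^ n.+1).-1.+1))//=.
        rewrite [X in _ <= _ + X]big_nat_recr ?/=; last first.
          by rewrite -!subn1 leq_sub2r// leq_exp2l.
        rewrite addrCA lerDl; apply: addr_ge0; last exact: sqr_ge0.
        by apply: sumr_ge0 => k _; exact: sqr_ge0.
      by rewrite ltnW// ltnS -!subn1 leq_sub2r// leq_exp2l.
    have e0 : (0 < 2 ^ n.+1)%N by rewrite expn_gt0.
    apply: le_trans (bloch_coef_sqr_sum_le hg B0 e0 hB) _.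
    by rewrite expnS natrM /D; apply: eq_ler; ring.
  apply: (@le_trans _ _ (Cmu / (2 ^ n)%:R ^+ 2 * (D * (2 ^ n)%:R ^+ 2 / lam + lam *+ 2 ^ n))).
    apply: ler_wpM2l; first by rewrite divr_ge0// exprn_ge0// ltW.
    by rewrite lerD2r ler_wpM2r// invr_ge0 ltW.
  rewrite -mulr_natl.
  have -> : (2 / 3 : R) ^+ n = lam^-1 by rewrite -exprVn invf_div.
  have -> : (3 / 4 : R) ^+ n = lam / (2 ^ n)%:R.
    by rewrite natrX /lam -expr_div_n; congr (_ ^+ _); field.
  by apply: eq_ler; field; rewrite !gt_eqF.
have total n : series u (2 ^ n)%N <=
    u 0 + \sum_(0 <= j < n) Cmu * (D * (2 / 3) ^+ j + (3 / 4) ^+ j).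
  elim: n => [|n ih]; first by rewrite /series/= expn0 big_nat1 big_geq// addr0.
  rewrite big_nat_recr//= addrA.
  have -> : series u (2 ^ n.+1)%N = series u (2 ^ n)%N + \sum_(2 ^ n <= k < 2 ^ n.+1) u k.
    by rewrite -sub_series_geq ?leq_exp2l// addrC subrK.
  exact: lerD ih (blk n).
apply: (@ge0_series_cvg _ _ (u 0 + Cmu * (D * 3 + 4)) u0) => n.
apply: (@le_trans _ _ (series u (2 ^ n)%N)).
  rewrite -subr_ge0 sub_series_geq; last by rewrite ltnW// ltn_expl.
  by apply: sumr_ge0 => k _; exact: u0.
apply: le_trans (total n) _; rewrite lerD2l -mulr_sumr ler_wpM2l// big_split/=.
rewrite -mulr_sumr.
have g1 : \sum_(0 <= j < n) (2 / 3 : R) ^+ j <= 3.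
  apply: le_trans (sum_geo_le _ _) _; first by apply/andP; split; lra.
  by apply: eq_ler; field.
have g2 : \sum_(0 <= j < n) (3 / 4 : R) ^+ j <= 4.
  apply: le_trans (sum_geo_le _ _) _; first by apply/andP; split; lra.
  by apply: eq_ler; field.
by apply: lerD => //; rewrite ler_wpM2l.
Qed.

End CoefficientSums.

(** * The equivalences *)

Section Equivalences.
Context {R : realType}.
Notation C := (Cplx R).
Variable mu : {finite_measure set (measurableTypeR R) -> \bar R}.
Implicit Type s : R.

Lemma I_bounded_log_Carleson s : 0 < s -> bounded_on_Qs s (I_dom mu) (I_op mu) ->
  log_Carleson 1 1 mu.
Proof.
move=> s0 [hI _]; have [dom qI] := hI _ (Qs_clog s0).
exact: (log_Carleson_of_I_clog s0 dom qI).
Qed.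

Lemma H_bounded_log_Carleson s : 0 < s -> bounded_on_Qs s (H_dom mu) (H_op mu) ->
  log_Carleson 1 1 mu.
Proof.
move=> s0 [hH _]; have [dom qH] := hH _ (Qs_clog s0).
have cs := clog_summable dom.
have [_ HI] := H_eq_I sum_on_disc_clog cs.
have [qI _] := Qs_eq_on_disc HI qH.
exact: (log_Carleson_of_I_clog s0 (I_dom_summable sum_on_disc_clog cs) qI).
Qed.

Lemma log_Carleson_I_bounded s : log_Carleson 1 1 mu -> 0 < s ->
  bounded_on_Qs s (I_dom mu) (I_op mu).
Proof.
move=> hmu s0; have [Cmu Cmu0 hC] := carleson_kernel_bound hmu.
exact: (I_op_bounded Cmu0 hC s0).
Qed.

Lemma log_Carleson_H_bounded s : log_Carleson 1 1 mu -> 0 < s ->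
  bounded_on_Qs s (H_dom mu) (H_op mu).
Proof.
move=> hmu s0; have [Cmu Cmu0 hC] := carleson_kernel_bound hmu.
have [hI [M hM]] := I_op_bounded Cmu0 hC s0.
have main f : Qs s f -> [/\ H_dom mu f, Qs s (H_op mu f) &
    Qs_norm s (H_op mu f) = Qs_norm s (I_op mu f)].
  move=> qf; have [/analytic_sum_on_disc[a ha] _] := qf.
  have B0 : 0 <= bloch_const * Qs_seminorm s f.
    by rewrite mulr_ge0 ?sqrtr_ge0// mulr_ge0// sqrtr_ge0.
  have cs := bloch_moment_summable Cmu0 hC ha B0 (fun z => Qs_bloch s0 qf (a := z)).
  have [dom HI] := H_eq_I ha cs.
  have IH z : disc z -> I_op mu f z = H_op mu f z by move=> dz; rewrite HI.
  by have [qH <-] := Qs_eq_on_disc IH (proj2 (hI f qf)).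
split=> [f qf|]; first by have [d q _] := main f qf; refine (conj d q).
by exists M => f qf; have [_ _ ->] := main f qf; exact: hM.
Qed.

End Equivalences.

Theorem theorem1p3 (R : realType)
    (mu : {finite_measure set (measurableTypeR R) -> \bar R})
    (mu_supp : mu (~` `[0, 1[) = 0%E) :
  [<-> exists s : R, 0 < s /\ bounded_on_Qs s (I_dom mu) (I_op mu);
       forall s : R, 0 < s -> bounded_on_Qs s (I_dom mu) (I_op mu);
       exists s : R, 0 < s /\ bounded_on_Qs s (H_dom mu) (H_op mu);
       forall s : R, 0 < s -> bounded_on_Qs s (H_dom mu) (H_op mu);
       log_Carleson 1 1 mu].
Proof.
tfae.
- move=> [s [s0 hI]] t t0.
  exact: (log_Carleson_I_bounded (I_bounded_log_Carleson s0 hI) t0).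
- move=> hI; exists 1; split; first exact: ltr01.
  exact: (log_Carleson_H_bounded (I_bounded_log_Carleson ltr01 (hI 1 ltr01)) ltr01).
- move=> [s [s0 hH]] t t0.
  exact: (log_Carleson_H_bounded (H_bounded_log_Carleson s0 hH) t0).
- move=> hH; exact: (H_bounded_log_Carleson ltr01 (hH 1 ltr01)).
- move=> hmu; exists 1; split; first exact: ltr01.
  exact: (log_Carleson_I_bounded hmu ltr01).
Qed.
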